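(* Let $\alpha>0$. There is a constant $M_\alpha>0$, depending only on $\alpha$, such that for every weight $\mu$ on the unit disk $\mathbb{D}$ and every analytic self-map $\phi$ of $\mathbb{D}$ for which the composition operator $C_\phi:\mathcal{B}^\alpha\to\mathcal{B}^\mu$, $C_\phi(f)=f\circ\phi$, is a (well-defined) continuous linear operator, one has $$ \frac{1}{M_\alpha}\,\|C_\phi\|_e^{\mathcal{B}^\alpha\to\mathcal{B}^\mu}\;\leq\;\limsup_{|a|\to 1^-}\|\sigma_a\circ\phi\|_{\mathcal{B}^\mu}\;\leq\; M_\alpha\,\|C_\phi\|_e^{\mathcal{B}^\alpha\to\mathcal{B}^\mu}. $$
   Context: $\mathbb{D}$ is the open unit disk of $\mathbb{C}$ and $H(\mathbb{D})$ is the space of all holomorphic functions on $\mathbb{D}$. A weight on $\mathbb{D}$ is a bounded, continuous and strictly positive function $\mu:\mathbb{D}\to(0,\infty)$. The $\mu$-Bloch space $\mathcal{B}^\mu$ consists of all $f\in H(\mathbb{D})$ such that $$\|f\|_\mu:=\sup_{z\in\mathbb{D}}\mu(z)|f'(z)|<\infty,$$ and it is a Banach space with the norm $\|f\|_{\mathcal{B}^\mu}:=|f(0)|+\|f\|_\mu$. For $\alpha>0$, the $\alpha$-Bloch space $\mathcal{B}^\alpha$ is the $\mu$-Bloch space for the weight $\mu(z)=v_\alpha(z):=(1-|z|^2)^\alpha$, with the corresponding norm. An analytic self-map of $\mathbb{D}$ is a holomorphic function $\phi:\mathbb{D}\to\mathbb{D}$. For a fixed $\alpha>0$ and for $a\in\mathbb{D}$,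 the function $\sigma_a\in\mathcal{B}^\alpha$ is defined by $$\sigma_a(z)=(1-|a|)\left((1-\overline{a}z)^{-\alpha}-1\right),\qquad z\in\mathbb{D},$$ where the power is the principal branch. The essential norm of a continuous linear operator $T:X\to Y$ between normed linear spaces is $$\|T\|_e^{X\to Y}=\inf\{\|T-K\|^{X\to Y} : K:X\to Y \text{ is a compact linear operator}\},$$ where $\|\cdot\|^{X\to Y}$ denotes the operator norm. *)

(* Defs.v *)
From Stdlib Require Import Reals Lra FunctionalExtensionality ProofIrrelevance.
From Coquelicot Require Export Coquelicot.
Open Scope R_scope.

Definition unit_disk (z : C) : Prop := Cmod z < 1.

(* Functions on the disk are given as total functions [C -> C] (or [C -> R]);
   the predicates below only look at their values on the disk. *)
Definition holomorphic_on_disk (f : C -> C) : Prop :=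
  forall z : C, unit_disk z ->
    ex_derive (K := C_AbsRing) (V := C_NormedModule) f z.

Definition analytic_self_map (phi : C -> C) : Prop :=
  holomorphic_on_disk phi /\ forall z : C, unit_disk z -> unit_disk (phi z).

Record weight : Type := mk_weight {
  weight_fun :> C -> R;
  weight_bounded : exists M : R, forall z : C, unit_disk z -> weight_fun z <= M;
  weight_continuous : forall z : C, unit_disk z ->
    continuous (T := C_UniformSpace) (U := R_UniformSpace) weight_fun z;
  weight_pos : forall z : C, unit_disk z -> 0 < weight_fun z }.

(* On holomorphic functions [C_derive] is the complex derivative
   ([C_derive_correct]). The two quantities below may be [p_infty]. *)
Definition bloch_seminorm (mu : C -> R) (f : C -> C) : Rbar :=
  Lub_Rbar (fun r : R =>
    exists z : C, unit_disk z /\ r = mu z * Cmod (C_derive f z)).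

Definition bloch_norm (mu : C -> R) (f : C -> C) : Rbar :=
  Rbar_plus (Cmod (f 0)) (bloch_seminorm mu f).

(* Elements are normalised to vanish off the disk, so that two of them are
   equal exactly when they agree on the disk. *)
Record Bloch (mu : weight) : Type := mk_Bloch {
  bloch_fun :> C -> C;
  bloch_off_disk : forall z : C, ~ unit_disk z -> bloch_fun z = 0%C;
  bloch_holomorphic : holomorphic_on_disk bloch_fun;
  bloch_finite : Rbar_lt (bloch_seminorm mu bloch_fun) p_infty }.

Arguments bloch_fun {mu} _ _.
Arguments bloch_off_disk {mu} _ _ _.
Arguments bloch_holomorphic {mu} _ _ _.
Arguments bloch_finite {mu} _.

Lemma bloch_seminorm_le (mu : C -> R) (f : C -> C) (M : R) :
  (forall z, unit_disk z -> mu z * Cmod (C_derive f z) <= M) ->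
  Rbar_le (bloch_seminorm mu f) M.
Proof.
intros H. apply (Lub_Rbar_correct _). intros r [z [Hz ->]]. exact (H z Hz).
Qed.

Lemma unit_disk_0 : unit_disk 0.
Proof. unfold unit_disk. rewrite Cmod_0. lra. Qed.

Section BlochSpace.
Variable mu : weight.

Lemma bloch_seminorm_ge0 (f : C -> C) : Rbar_le 0 (bloch_seminorm mu f).
Proof.
apply Rbar_le_trans with (mu 0%C * Cmod (C_derive f 0))%R.
- simpl. apply Rmult_le_pos.
  + apply Rlt_le, weight_pos, unit_disk_0.
  + apply Cmod_ge_0.
- apply (Lub_Rbar_correct _). exists (RtoC 0). split; [apply unit_disk_0|reflexivity].
Qed.

Lemma bloch_seminorm_finite (f : C -> C) :
  Rbar_lt (bloch_seminorm mu f) p_infty ->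
  bloch_seminorm mu f = Finite (real (bloch_seminorm mu f)).
Proof.
generalize (bloch_seminorm_ge0 f). destruct (bloch_seminorm mu f); simpl; tauto.
Qed.

Lemma bloch_bound (f : C -> C) (z : C) :
  Rbar_lt (bloch_seminorm mu f) p_infty -> unit_disk z ->
  mu z * Cmod (C_derive f z) <= real (bloch_seminorm mu f).
Proof.
intros Hf Hz. change (Rbar_le (mu z * Cmod (C_derive f z)) (real (bloch_seminorm mu f))).
rewrite <- (bloch_seminorm_finite f Hf).
apply (Lub_Rbar_correct _). exists z. split; [exact Hz|reflexivity].
Qed.

Lemma bloch_seminorm_le_real (f : C -> C) (M : R) :
  (forall z, unit_disk z -> mu z * Cmod (C_derive f z) <= M) ->
  Rbar_lt (bloch_seminorm mu f) p_infty /\ real (bloch_seminorm mu f) <= M.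
Proof.
intros H. apply bloch_seminorm_le in H. generalize (bloch_seminorm_ge0 f).
destruct (bloch_seminorm mu f); simpl in *; tauto.
Qed.

Lemma C_derive_plus_on_disk (f g : C -> C) (z : C) :
  holomorphic_on_disk f -> holomorphic_on_disk g -> unit_disk z ->
  is_derive (K := C_AbsRing) (V := C_NormedModule)
    (fun w : C => (f w + g w)%C) z (C_derive f z + C_derive g z)%C.
Proof.
intros Hf Hg Hz.
apply (is_derive_plus (K := C_AbsRing) (V := C_NormedModule) f g);
  apply C_derive_correct; auto.
Qed.

Lemma C_derive_scal_on_disk (c : C) (f : C -> C) (z : C) :
  holomorphic_on_disk f -> unit_disk z ->
  is_derive (K := C_AbsRing) (V := C_NormedModule)
    (fun w : C => (c * f w)%C) z (c * C_derive f z)%C.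
Proof.
intros Hf Hz.
unfold is_derive.
apply (filterdiff_ext_lin (K := C_AbsRing) (U := AbsRing_NormedModule C_AbsRing)
  (V := C_NormedModule) _ (fun y : C => (c * (y * C_derive f z))%C)).
- apply (filterdiff_scal_r_fct (K := C_AbsRing)
    (U := AbsRing_NormedModule C_AbsRing) (V := C_NormedModule)
    c f (fun y : C => (y * C_derive f z)%C)).
  + intros n m. apply Cmult_comm.
  + apply (C_derive_correct f z c). auto.
- intros y. unfold scal; simpl; unfold mult; simpl. ring.
Qed.

Lemma bloch_ext (f g : Bloch mu) : (forall z, unit_disk z -> f z = g z) -> f = g.
Proof.
destruct f as [f f1 f2 f3], g as [g g1 g2 g3]; simpl; intros H.
assert (E : f = g).
{ apply functional_extensionality. intros z.
  destruct (Rlt_dec (Cmod z) 1) as [Hz|Hz].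
  - exact (H z Hz).
  - rewrite f1, g1; auto. }
subst g. f_equal; apply proof_irrelevance.
Qed.

Definition bloch_plus (f g : Bloch mu) : Bloch mu.
Proof.
refine (mk_Bloch mu (fun z => (f z + g z)%C) _ _ _).
- intros z Hz. rewrite !bloch_off_disk by exact Hz. ring.
- intros z Hz. eexists. apply C_derive_plus_on_disk; [apply f|apply g|exact Hz].
- apply (bloch_seminorm_le_real _
    (real (bloch_seminorm mu f) + real (bloch_seminorm mu g))).
  intros z Hz.
  rewrite (is_C_derive_unique _ _ _ (C_derive_plus_on_disk f g z
    (bloch_holomorphic f) (bloch_holomorphic g) Hz)).
  generalize (bloch_bound f z (bloch_finite f) Hz)
    (bloch_bound g z (bloch_finite g) Hz)
    (Cmod_triangle (C_derive f z) (C_derive g z)) (weight_pos mu z Hz).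
  intros. nra.
Defined.

Definition bloch_scal (c : C) (f : Bloch mu) : Bloch mu.
Proof.
refine (mk_Bloch mu (fun z => (c * f z)%C) _ _ _).
- intros z Hz. rewrite bloch_off_disk by exact Hz. ring.
- intros z Hz. eexists. apply C_derive_scal_on_disk; [apply f|exact Hz].
- apply (bloch_seminorm_le_real _ (Cmod c * real (bloch_seminorm mu f))).
  intros z Hz.
  rewrite (is_C_derive_unique _ _ _ (C_derive_scal_on_disk c f z
    (bloch_holomorphic f) Hz)), Cmod_mult.
  generalize (bloch_bound f z (bloch_finite f) Hz) (Cmod_ge_0 c). intros. nra.
Defined.

Definition bloch_zero : Bloch mu.
Proof.
refine (mk_Bloch mu (fun _ => RtoC 0) _ _ _).
- reflexivity.
- intros z _. exists (RtoC 0). apply (is_derive_const (K := C_AbsRing) (V := C_NormedModule)).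
- apply (bloch_seminorm_le_real _ 0). intros z Hz.
  rewrite (is_C_derive_unique _ _ (RtoC 0)), Cmod_0. lra.
  apply (is_derive_const (K := C_AbsRing) (V := C_NormedModule)).
Defined.

Definition bloch_opp (f : Bloch mu) : Bloch mu := bloch_scal (-1)%C f.

Definition Bloch_AbelianMonoid_mixin : AbelianMonoid.mixin_of (Bloch mu).
Proof.
apply (AbelianMonoid.Mixin (Bloch mu) bloch_plus bloch_zero);
  intros; apply bloch_ext; intros; simpl; ring.
Defined.

Canonical Bloch_AbelianMonoid :=
  AbelianMonoid.Pack (Bloch mu) Bloch_AbelianMonoid_mixin (Bloch mu).

Definition Bloch_AbelianGroup_mixin : AbelianGroup.mixin_of Bloch_AbelianMonoid.
Proof.
apply (AbelianGroup.Mixin Bloch_AbelianMonoid bloch_opp).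
intros f; apply bloch_ext; intros; simpl; ring.
Defined.

Canonical Bloch_AbelianGroup :=
  AbelianGroup.Pack (Bloch mu)
    (AbelianGroup.Class _ _ Bloch_AbelianGroup_mixin) (Bloch mu).

Definition Bloch_ModuleSpace_mixin :
  ModuleSpace.mixin_of C_Ring Bloch_AbelianGroup.
Proof.
apply (ModuleSpace.Mixin C_Ring Bloch_AbelianGroup bloch_scal);
  intros; apply bloch_ext; intros; simpl;
  unfold mult, plus, one; simpl; ring.
Defined.

Canonical Bloch_ModuleSpace :=
  ModuleSpace.Pack C_Ring (Bloch mu)
    (ModuleSpace.Class _ _ _ Bloch_ModuleSpace_mixin) (Bloch mu).

Definition Bloch_norm (f : Bloch mu) : R := real (bloch_norm mu f).

Lemma Bloch_norm_eq (f : Bloch mu) :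
  Bloch_norm f = Cmod (f 0%C) + real (bloch_seminorm mu f).
Proof.
unfold Bloch_norm, bloch_norm.
now rewrite (bloch_seminorm_finite f (bloch_finite f)).
Qed.

Lemma Bloch_norm_triangle (f g : Bloch mu) :
  Bloch_norm (plus f g) <= Bloch_norm f + Bloch_norm g.
Proof.
rewrite !Bloch_norm_eq. simpl.
assert (H : real (bloch_seminorm mu (fun z => (f z + g z)%C)) <=
  real (bloch_seminorm mu f) + real (bloch_seminorm mu g)).
{ apply bloch_seminorm_le_real. intros z Hz.
  rewrite (is_C_derive_unique _ _ _ (C_derive_plus_on_disk f g z
    (bloch_holomorphic f) (bloch_holomorphic g) Hz)).
  generalize (bloch_bound f z (bloch_finite f) Hz)
    (bloch_bound g z (bloch_finite g) Hz)
    (Cmod_triangle (C_derive f z) (C_derive g z)) (weight_pos mu z Hz).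
  intros. nra. }
generalize (Cmod_triangle (f 0%C) (g 0%C)). lra.
Qed.

Lemma Bloch_norm_scal (c : C) (f : Bloch mu) :
  Bloch_norm (scal c f) <= Cmod c * Bloch_norm f.
Proof.
rewrite !Bloch_norm_eq. simpl.
assert (H : real (bloch_seminorm mu (fun z => (c * f z)%C)) <=
  Cmod c * real (bloch_seminorm mu f)).
{ apply bloch_seminorm_le_real. intros z Hz.
  rewrite (is_C_derive_unique _ _ _ (C_derive_scal_on_disk c f z
    (bloch_holomorphic f) Hz)), Cmod_mult.
  generalize (bloch_bound f z (bloch_finite f) Hz) (Cmod_ge_0 c). intros. nra. }
rewrite Cmod_mult. lra.
Qed.

Lemma Bloch_norm_opp (f : Bloch mu) : Bloch_norm (opp f) <= Bloch_norm f.
Proof.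
apply Rle_trans with (1 := Bloch_norm_scal (-1)%C f).
rewrite Cmod_R, Rabs_left by lra. lra.
Qed.

Lemma Bloch_norm_minus_sym (f g : Bloch mu) :
  Bloch_norm (minus f g) <= Bloch_norm (minus g f).
Proof. rewrite <- opp_minus. apply Bloch_norm_opp. Qed.

Lemma holomorphic_derive0_const (f : C -> C) :
  holomorphic_on_disk f -> (forall z, unit_disk z -> C_derive f z = 0%C) ->
  forall z, unit_disk z -> f z = f 0%C.
Proof.
intros Hf Hd z Hz.
assert (Hsmall : forall s, 0 <= s <= 1 -> forall eps : posreal,
  locally s (fun t : R => Cmod (f (t * z)%C - f (s * z)%C) <= eps * Rabs (t - s))).
{ intros s Hs eps.
  assert (Hsz : unit_disk (s * z)%C).
  { unfold unit_disk in *. rewrite Cmod_mult, Cmod_R, Rabs_pos_eq by lra.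
    generalize (Cmod_ge_0 z). nra. }
  destruct (C_derive_correct f (s * z)%C (RtoC 0) (Hf _ Hsz)) as [_ H].
  specialize (H (s * z)%C (fun P H => H) eps). rewrite (Hd _ Hsz) in H.
  destruct H as [d H].
  exists d. intros t Ht.
  assert (E : Cmod (t * z - s * z)%C <= Rabs (t - s)).
  { replace (t * z - s * z)%C with (RtoC (t - s) * z)%C
      by (rewrite RtoC_minus; ring).
    rewrite Cmod_mult, Cmod_R. unfold unit_disk in Hz.
    generalize (Rabs_pos (t - s)) (Cmod_ge_0 z). nra. }
  assert (Hb : ball (M := AbsRing_UniformSpace C_AbsRing) (s * z)%C d (t * z)%C).
  { apply Rle_lt_trans with (1 := E). exact Ht. }
  specialize (H _ Hb).
  change (Cmod ((f (t * z)%C - f (s * z)%C) - ((t * z - s * z) * 0)%C)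
    <= eps * Cmod (t * z - s * z)%C) in H.
  replace ((f (t * z)%C - f (s * z)%C) - ((t * z - s * z) * 0)%C)%C
    with (f (t * z)%C - f (s * z)%C)%C in H by ring.
  generalize (cond_pos eps). nra. }
assert (Hpr : forall p : C -> R,
  (forall u v : C, Rabs (p u - p v) <= Cmod (u - v)%C) -> p (f z) = p (f 0%C)).
{ intros p Hp.
  assert (D : forall s, 0 <= s <= 1 -> is_derive (fun t : R => p (f (t * z)%C)) s 0).
  { intros s Hs. split.
    - apply is_linear_scal_l.
    - intros x Hx. rewrite <- (is_filter_lim_locally_unique s x Hx). intros eps.
      apply filter_imp with (2 := Hsmall s Hs eps). intros t Ht.
      change (Rabs ((p (f (t * z)%C) - p (f (s * z)%C)) - (t - s) * 0)
        <= eps * Rabs (t - s)).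
      rewrite Rmult_0_r, Rminus_0_r.
      apply Rle_trans with (2 := Ht). apply Hp. }
  destruct (MVT_gen (fun t : R => p (f (t * z)%C)) 0 1 (fun _ => 0)) as [c [_ Hc]].
  - intros x. rewrite Rmin_left, Rmax_right by lra. intros Hx. apply D. lra.
  - intros x. rewrite Rmin_left, Rmax_right by lra. intros Hx.
    apply continuity_pt_filterlim.
    apply (ex_derive_continuous (K := R_AbsRing) (V := R_NormedModule)).
    exists 0. apply D. lra.
  - cbv beta in Hc.
    replace (1 * z)%C with z in Hc by ring.
    replace (0 * z)%C with (RtoC 0) in Hc by ring. lra. }
apply injective_projections.
- apply (Hpr fst). intros u v. exact (Rle_trans _ _ _ (Rmax_l _ _) (Rmax_Cmod (u - v)%C)).
- apply (Hpr snd). intros u v. exact (Rle_trans _ _ _ (Rmax_r _ _) (Rmax_Cmod (u - v)%C)).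
Qed.

Lemma Bloch_norm_eq0 (f : Bloch mu) : Bloch_norm f = 0 -> f = zero.
Proof.
rewrite Bloch_norm_eq. intros H.
assert (Hs := bloch_seminorm_ge0 f).
rewrite (bloch_seminorm_finite f (bloch_finite f)) in Hs. simpl in Hs.
generalize (Cmod_ge_0 (f 0%C)). intros H0.
apply bloch_ext. intros z Hz.
rewrite (holomorphic_derive0_const f); [|apply f| |exact Hz].
- apply Cmod_eq_0. lra.
- intros w Hw. apply Cmod_eq_0.
  generalize (bloch_bound f w (bloch_finite f) Hw) (weight_pos mu w Hw)
    (Cmod_ge_0 (C_derive f w)). intros. nra.
Qed.

Definition Bloch_UniformSpace_mixin : UniformSpace.mixin_of (Bloch mu).
Proof.
apply (UniformSpace.Mixin (Bloch mu) bloch_zero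
  (fun f e g => Bloch_norm (minus g f) < e)).
- intros f e. rewrite minus_eq_zero.
  apply Rle_lt_trans with 0; [|apply cond_pos].
  generalize (Bloch_norm_scal 0%C zero).
  replace (scal (RtoC 0 : C_Ring) (zero : Bloch mu)) with (zero : Bloch mu)
    by (symmetry; apply (scal_zero_r (K := C_Ring) (V := Bloch_ModuleSpace))).
  rewrite Cmod_0, Rmult_0_l. exact (fun H => H).
- intros f g e. apply Rle_lt_trans, Bloch_norm_minus_sym.
- intros f g h e1 e2 H1 H2. rewrite (minus_trans g), Rplus_comm.
  apply Rle_lt_trans with (1 := Bloch_norm_triangle (minus h g) (minus g f)).
  apply Rplus_lt_compat; assumption.
Defined.

Canonical Bloch_UniformSpace :=
  UniformSpace.Pack (Bloch mu) Bloch_UniformSpace_mixin (Bloch mu).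

Canonical Bloch_NormedModuleAux :=
  NormedModuleAux.Pack C_AbsRing (Bloch mu)
    (NormedModuleAux.Class C_AbsRing _
      (ModuleSpace.class _ Bloch_ModuleSpace)
      Bloch_UniformSpace_mixin) (Bloch mu).

Definition Bloch_NormedModule_mixin :
  NormedModule.mixin_of C_AbsRing Bloch_NormedModuleAux.
Proof.
apply (NormedModule.Mixin C_AbsRing Bloch_NormedModuleAux Bloch_norm 1).
- exact Bloch_norm_triangle.
- exact Bloch_norm_scal.
- intros f g e H. exact H.
- intros f g e H. rewrite Rmult_1_l. exact H.
- exact Bloch_norm_eq0.
Defined.

Canonical Bloch_NormedModule :=
  NormedModule.Pack C_AbsRing (Bloch mu)
    (NormedModule.Class _ _ _ Bloch_NormedModule_mixin) (Bloch mu).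

End BlochSpace.

Definition standard_weight_fun (alpha : R) (z : C) : R :=
  Rpower (1 - Cmod z ^ 2) alpha.

Definition standard_weight (alpha : R) (Halpha : 0 < alpha) : weight.
Proof.
assert (Hpos : forall z, unit_disk z -> 0 < 1 - Cmod z ^ 2).
{ unfold unit_disk. intros z Hz. generalize (Cmod_ge_0 z). nra. }
refine (mk_weight (standard_weight_fun alpha) _ _ _).
- exists 1. intros z Hz. unfold standard_weight_fun.
  rewrite <- (Rpower_1 1) at 2 by lra.
  replace (Rpower 1 1) with (Rpower 1 alpha)
    by (unfold Rpower; rewrite ln_1, !Rmult_0_r; reflexivity).
  apply Rle_Rpower_l; [lra|]. split; [apply Hpos, Hz|].
  generalize (pow2_ge_0 (Cmod z)). lra.
- intros z Hz. unfold standard_weight_fun.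
  apply (continuous_comp (U := C_UniformSpace) (V := R_UniformSpace) (W := R_UniformSpace)
    Cmod (fun x => Rpower (1 - x ^ 2) alpha)).
  + apply (filterlim_norm (K := C_AbsRing) (V := C_NormedModule)).
  + apply (ex_derive_continuous (K := R_AbsRing) (V := R_NormedModule)).
    unfold Rpower. auto_derive. generalize (Hpos z Hz). simpl. lra.
- intros z Hz. apply exp_pos.
Defined.

(* Principal argument, with values in (-PI, PI] (and value 0 at 0). *)
Definition Carg (z : C) : R :=
  if Rlt_dec 0 (Re z) then atan (Im z / Re z)
  else if Rlt_dec (Re z) 0 then
    if Rle_dec 0 (Im z) then atan (Im z / Re z) + PI else atan (Im z / Re z) - PI
  else if Rlt_dec 0 (Im z) then PI / 2
  else if Rlt_dec (Im z) 0 then - (PI / 2)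
  else 0.

Definition Cexp (z : C) : C := (exp (Re z) * (cos (Im z), sin (Im z)))%C.

Definition Clog (z : C) : C := (ln (Cmod z), Carg z).

Definition Cpower (z : C) (s : R) : C := Cexp (s * Clog z)%C.

Definition sigma_fun (alpha : R) (a z : C) : C :=
  ((1 - Cmod a)%R * (Cpower (1 - Cconj a * z) (- alpha) - 1))%C.

Definition is_composition_operator {mu nu : weight} (phi : C -> C)
    (T : Bloch mu -> Bloch nu) : Prop :=
  forall (f : Bloch mu) (z : C), unit_disk z -> T f z = f (phi z).

Definition operator_norm {K : AbsRing} {X Y : NormedModule K} (T : X -> Y) : Rbar :=
  Lub_Rbar (fun r : R => exists x : X, norm x <= 1 /\ r = norm (T x)).

(* [is_linear] is Coquelicot's notion of a continuous linear map. *)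
Definition compact_operator {K : AbsRing} {X Y : NormedModule K} (T : X -> Y) : Prop :=
  is_linear T /\
  forall x : nat -> X, (exists M : R, forall n, norm (x n) <= M) ->
    exists (s : nat -> nat) (y : Y),
      (forall n, (s n < s (S n))%nat) /\
      filterlim (fun n => T (x (s n))) eventually (locally y).

Definition essential_norm {K : AbsRing} {X Y : NormedModule K} (T : X -> Y) : Rbar :=
  Rbar_glb (fun r : Rbar => exists S : X -> Y,
    compact_operator S /\ r = operator_norm (fun x => minus (T x) (S x))).

(* limsup of [F a] as [Cmod a] tends to 1 from below, as inf over r < 1 of the
   supremum over r < |a| < 1. *)
Definition limsup_boundary (F : C -> Rbar) : Rbar :=
  Rbar_glb (fun s : Rbar => exists r : R, r < 1 /\
    s = Rbar_lub (fun t : Rbar => exists a : C, r < Cmod a < 1 /\ t = F a)).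

(* Main.v *)
Require Import Defs.
From Stdlib Require Import Reals Lra Lia ClassicalEpsilon.
From Coquelicot Require Import Coquelicot.
Open Scope R_scope.

(** For [limsup <= M * ||C_phi||_e]: a compact [K] sends the test functions [sigma_a] to 0 in norm as
    [|a| -> 1]: the derivatives of [sigma_a] concentrate near the boundary, so along a sufficiently
    sparse sequence the partial sums of the [sigma_a] are bounded, while their images under [K]
    would otherwise add up linearly in a limit direction.

    For [||C_phi||_e <= M * limsup]: [C_phi] is compared with the finite-rank operators
    [f |-> P (s phi)], where [P] is a Taylor polynomial of [f] and [s < 1]. Where [|phi|] is bounded
    away from 1 the error is small uniformly on the unit ball by Cauchy's estimates; elsewhere it is
    at most [2 mu |phi'| / (1 - |phi|^2)^alpha], which testing [C_phi] on [sigma_a] at the points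
    with [phi z = a] controls. *)

(** * Complex differentiation *)

(** Neither direction uses weak convergence or normal families. A compact operator is confronted
    only with the fact that sums of sparse [sigma_a], of any length, have norm at most 4 alpha
    2^alpha. In the other direction Taylor polynomials alone give no control near the boundary that
    is uniform in [f]. The dilation supplies it: the weight decreases with the modulus, so passing
    to [f (s .)] does not increase the weighted derivative, and [f - f (s .)] costs at most a factor
    2 near the boundary while being small on smaller disks. Now [f (s .)] only sees [f] on the disk
    of radius [s], where Taylor polynomials converge uniformly over the unit ball. Their
    coefficients are integrals, hence bounded functionals, and compactness reduces to
    Bolzano-Weierstrass for scalars. Constants: c = 2 alpha 2^alpha bounds the norms of all
    [sigma_a]. Testing at a point with phi z = a costs 3 / alpha, because |a| / (1 + |a|) >= 1/3
    once |a| >= 1/2, and the factor 2 of the dilation turns this into 6 / alpha. *)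

Local Notation Cderiv := (is_derive (K := C_AbsRing) (V := C_NormedModule)).

(** Componentwise, so that the real mean value theorem, the fundamental theorem of calculus and
    [auto_derive] apply to each part; [Rderiv_iff] recovers the complex estimate. *)
Definition Rderiv (g : R -> C) (t : R) (l : C) : Prop :=
  is_derive (fun s => Re (g s)) t (Re l) /\ is_derive (fun s => Im (g s)) t (Im l).

Lemma Cmod_Re (z : C) : Rabs (Re z) <= Cmod z.
Proof. exact (Rle_trans _ _ _ (Rmax_l _ _) (Rmax_Cmod z)). Qed.

Lemma Cmod_Im (z : C) : Rabs (Im z) <= Cmod z.
Proof. exact (Rle_trans _ _ _ (Rmax_r _ _) (Rmax_Cmod z)). Qed.

Lemma Cmod_le_Re_Im (z : C) : Cmod z <= Rabs (Re z) + Rabs (Im z).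
Proof.
replace z with (RtoC (Re z) + Ci * RtoC (Im z))%C at 1.
- eapply Rle_trans; [apply Cmod_triangle|].
  rewrite Cmod_mult, !Cmod_R.
  replace (Cmod Ci) with 1; [lra|].
  rewrite <- sqrt_1. unfold Cmod, Ci. f_equal. simpl. ring.
- destruct z; unfold Re, Im; apply injective_projections; simpl; ring.
Qed.

Lemma Cmod_minus_sym (x y : C) : Cmod (x - y) = Cmod (y - x).
Proof. replace (x - y)%C with (- (y - x))%C by ring. apply Cmod_opp. Qed.

Lemma Cmod_triangle_minus (x y : C) : Cmod (x - y) <= Cmod x + Cmod y.
Proof.
unfold Cminus. eapply Rle_trans; [apply Cmod_triangle|]. rewrite Cmod_opp. lra.
Qed.

Lemma Cmod_triangle_inv (x y : C) : Cmod x - Cmod y <= Cmod (x - y).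
Proof.
generalize (Cmod_triangle (x - y) y). replace (x - y + y)%C with x by ring. lra.
Qed.

Lemma Cderiv_iff (f : C -> C) (z l : C) :
  Cderiv f z l <->
  forall eps, 0 < eps -> exists d, 0 < d /\ forall y, Cmod (y - z) < d ->
    Cmod (f y - f z - l * (y - z)) <= eps * Cmod (y - z).
Proof.
split.
- intros [_ H] eps Heps.
  destruct (H z (fun P H => H) (mkposreal eps Heps)) as [d Hd].
  exists d. split; [apply cond_pos|]. intros y Hy. rewrite (Cmult_comm l). exact (Hd y Hy).
- intros H. split; [apply is_linear_scal_l|].
  intros x Hx. rewrite <- (is_filter_lim_locally_unique (V := AbsRing_NormedModule C_AbsRing) z x Hx).
  intros [eps Heps].
  destruct (H eps Heps) as [d [Hd1 Hd2]]. exists (mkposreal d Hd1).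
  intros y Hy. specialize (Hd2 y Hy). rewrite (Cmult_comm l) in Hd2. exact Hd2.
Qed.

Lemma is_derive_R_iff (f : R -> R) (z l : R) :
  is_derive f z l <->
  forall eps, 0 < eps -> exists d, 0 < d /\ forall y, Rabs (y - z) < d ->
    Rabs (f y - f z - l * (y - z)) <= eps * Rabs (y - z).
Proof.
split.
- intros [_ H] eps Heps.
  destruct (H z (fun P H => H) (mkposreal eps Heps)) as [d Hd].
  exists d. split; [apply cond_pos|]. intros y Hy. rewrite (Rmult_comm l). exact (Hd y Hy).
- intros H. split; [apply is_linear_scal_l|].
  intros x Hx. rewrite <- (is_filter_lim_locally_unique z x Hx). intros [eps Heps].
  destruct (H eps Heps) as [d [Hd1 Hd2]]. exists (mkposreal d Hd1).
  intros y Hy. specialize (Hd2 y Hy). rewrite (Rmult_comm l) in Hd2. exact Hd2.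
Qed.

Lemma Rderiv_iff (g : R -> C) (t : R) (l : C) :
  Rderiv g t l <->
  forall eps, 0 < eps -> exists d, 0 < d /\ forall s, Rabs (s - t) < d ->
    Cmod (g s - g t - l * RtoC (s - t)) <= eps * Rabs (s - t).
Proof.
unfold Rderiv. rewrite !is_derive_R_iff.
assert (ERe : forall s, Re (g s - g t - l * RtoC (s - t))%C
  = Re (g s) - Re (g t) - Re l * (s - t)).
{ intros s. unfold Re, Im. destruct (g s), (g t), l. simpl. ring. }
assert (EIm : forall s, Im (g s - g t - l * RtoC (s - t))%C
  = Im (g s) - Im (g t) - Im l * (s - t)).
{ intros s. unfold Re, Im. destruct (g s), (g t), l. simpl. ring. }
split.
- intros [H1 H2] eps Heps.
  destruct (H1 (eps / 2)) as [d1 [Hd1 K1]]; [lra|].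
  destruct (H2 (eps / 2)) as [d2 [Hd2 K2]]; [lra|].
  exists (Rmin d1 d2). split; [apply Rmin_pos; assumption|]. intros s Hs.
  eapply Rle_trans; [apply Cmod_le_Re_Im|]. rewrite ERe, EIm.
  specialize (K1 s (Rlt_le_trans _ _ _ Hs (Rmin_l _ _))).
  specialize (K2 s (Rlt_le_trans _ _ _ Hs (Rmin_r _ _))). lra.
- intros H. split; intros eps Heps; destruct (H eps Heps) as [d [Hd K]];
    exists d; (split; [exact Hd|]); intros s Hs; specialize (K s Hs);
    [rewrite <- ERe|rewrite <- EIm]; eapply Rle_trans; try exact K;
    [apply Cmod_Re|apply Cmod_Im].
Qed.

Lemma Cderiv_continuous (f : C -> C) (z l : C) : Cderiv f z l ->
  forall eps, 0 < eps -> exists d, 0 < d /\ forall y, Cmod (y - z) < d ->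
    Cmod (f y - f z) < eps.
Proof.
intros H eps Heps. rewrite Cderiv_iff in H. destruct (H 1 Rlt_0_1) as [d [Hd K]].
assert (Hl := Cmod_ge_0 l).
assert (Hp : 0 < eps / (2 + Cmod l)) by (apply Rdiv_lt_0_compat; lra).
exists (Rmin d (eps / (2 + Cmod l))). split; [apply Rmin_pos; assumption|].
intros y Hy.
specialize (K y (Rlt_le_trans _ _ _ Hy (Rmin_l _ _))).
assert (Hy2 := Rlt_le_trans _ _ _ Hy (Rmin_r _ _)).
assert (E := Cmod_triangle (f y - f z - l * (y - z)) (l * (y - z))).
replace (f y - f z - l * (y - z) + l * (y - z))%C with (f y - f z)%C in E by ring.
rewrite Cmod_mult in E.
assert (Hz := Cmod_ge_0 (y - z)).
apply Rmult_lt_compat_r with (r := 2 + Cmod l) in Hy2; [|lra].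
replace (eps / (2 + Cmod l) * (2 + Cmod l)) with eps in Hy2 by (field; lra).
nra.
Qed.

Lemma Rderiv_comp (f : C -> C) (g : R -> C) (t : R) (df dg : C) :
  Cderiv f (g t) df -> Rderiv g t dg -> Rderiv (fun s => f (g s)) t (df * dg)%C.
Proof.
rewrite Cderiv_iff, !Rderiv_iff. intros Hf Hg eps Heps.
assert (Hdf := Cmod_ge_0 df). assert (Hdg := Cmod_ge_0 dg).
(* The error is that of [f] on the increment of [g] plus [df] times that of [g]; each gets
   [eps / 2]. The cap 1 in [e2] makes [g] Lipschitz at [t] with constant [1 + Cmod dg]. *)
set (e1 := eps / (2 * (1 + Cmod dg))).
assert (He1 : 0 < e1) by (apply Rdiv_lt_0_compat; lra).
set (e2 := Rmin 1 (eps / (2 * (1 + Cmod df)))).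
assert (He2 : 0 < e2) by (apply Rmin_pos; [lra|apply Rdiv_lt_0_compat; lra]).
destruct (Hf e1 He1) as [d1 [Hd1 K1]].
destruct (Hg e2 He2) as [d2 [Hd2 K2]].
assert (Hd3 : 0 < d1 / (1 + Cmod dg)) by (apply Rdiv_lt_0_compat; lra).
exists (Rmin d2 (d1 / (1 + Cmod dg))). split; [apply Rmin_pos; assumption|].
intros s Hs.
specialize (K2 s (Rlt_le_trans _ _ _ Hs (Rmin_l _ _))).
assert (Hs2 := Rlt_le_trans _ _ _ Hs (Rmin_r _ _)).
assert (Hs0 := Rabs_pos (s - t)).
assert (E : Cmod (g s - g t) <= (1 + Cmod dg) * Rabs (s - t)).
{ assert (E := Cmod_triangle (g s - g t - dg * RtoC (s - t)) (dg * RtoC (s - t))).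
  replace (g s - g t - dg * RtoC (s - t) + dg * RtoC (s - t))%C
    with (g s - g t)%C in E by ring.
  rewrite Cmod_mult, Cmod_R in E.
  assert (e2 <= 1) by apply Rmin_l. nra. }
assert (Hlt : Cmod (g s - g t) < d1).
{ apply Rle_lt_trans with (1 := E).
  apply Rmult_lt_compat_l with (r := 1 + Cmod dg) in Hs2; [|lra].
  replace ((1 + Cmod dg) * (d1 / (1 + Cmod dg))) with d1 in Hs2 by (field; lra). lra. }
specialize (K1 _ Hlt).
replace (f (g s) - f (g t) - df * dg * RtoC (s - t))%C with
  ((f (g s) - f (g t) - df * (g s - g t)) + df * (g s - g t - dg * RtoC (s - t)))%C by ring.
eapply Rle_trans; [apply Cmod_triangle|]. rewrite Cmod_mult.
assert (A1 : e1 * Cmod (g s - g t) <= eps / 2 * Rabs (s - t)).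
{ apply Rle_trans with (e1 * ((1 + Cmod dg) * Rabs (s - t))).
  - apply Rmult_le_compat_l; lra.
  - unfold e1. right. field. lra. }
assert (A2 : Cmod df * (e2 * Rabs (s - t)) <= eps / 2 * Rabs (s - t)).
{ rewrite <- Rmult_assoc. apply Rmult_le_compat_r; [exact Hs0|].
  apply Rle_trans with (Cmod df * (eps / (2 * (1 + Cmod df)))).
  - apply Rmult_le_compat_l; [exact Hdf|apply Rmin_r].
  - apply Rle_trans with ((1 + Cmod df) * (eps / (2 * (1 + Cmod df)))).
    + apply Rmult_le_compat_r; [|lra]. apply Rlt_le, Rdiv_lt_0_compat; lra.
    + right. field. lra. }
assert (A3 : Cmod df * Cmod (g s - g t - dg * RtoC (s - t)) <= Cmod df * (e2 * Rabs (s - t)))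
  by (apply Rmult_le_compat_l; assumption).
lra.
Qed.

(* The factor 2 here and in [CInt_bound] comes from treating real and imaginary parts separately. *)
Lemma Rderiv_bound (g dg : R -> C) (a b M : R) : a <= b ->
  (forall t, a <= t <= b -> Rderiv g t (dg t)) ->
  (forall t, a <= t <= b -> Cmod (dg t) <= M) ->
  Cmod (g b - g a) <= 2 * M * (b - a).
Proof.
intros Hab Hg HM.
assert (Hp : forall p : C -> R, (forall z, Rabs (p z) <= Cmod z) ->
  (forall t, a <= t <= b -> is_derive (fun s => p (g s)) t (p (dg t))) ->
  Rabs (p (g b) - p (g a)) <= M * (b - a)).
{ intros p Hp Hd.
  destruct (MVT_gen (fun s => p (g s)) a b (fun s => p (dg s))) as [c [Hc1 Hc2]].
  - intros x. rewrite Rmin_left, Rmax_right by lra. intros Hx. apply Hd. lra.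
  - intros x. rewrite Rmin_left, Rmax_right by lra. intros Hx.
    apply continuity_pt_filterlim.
    apply (ex_derive_continuous (K := R_AbsRing) (V := R_NormedModule)).
    exists (p (dg x)). apply Hd. lra.
  - rewrite Rmin_left, Rmax_right in Hc1 by lra. rewrite Hc2, Rabs_mult.
    rewrite (Rabs_pos_eq (b - a)) by lra.
    apply Rmult_le_compat_r; [lra|].
    apply Rle_trans with (1 := Hp _). apply HM. exact Hc1. }
eapply Rle_trans; [apply Cmod_le_Re_Im|].
assert (H1 := Hp Re Cmod_Re (fun t Ht => proj1 (Hg t Ht))).
assert (H2 := Hp Im Cmod_Im (fun t Ht => proj2 (Hg t Ht))).
change (Re (g b - g a)) with (Re (g b) - Re (g a)).
change (Im (g b - g a)) with (Im (g b) - Im (g a)).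
lra.
Qed.

Lemma Rderiv_line (p v : C) (t : R) : Rderiv (fun s => (p + RtoC s * v)%C) t v.
Proof.
apply Rderiv_iff. intros eps Heps. exists 1. split; [lra|]. intros s _.
replace (p + RtoC s * v - (p + RtoC t * v) - v * RtoC (s - t))%C with (RtoC 0)
  by (rewrite RtoC_minus; ring).
rewrite Cmod_0. apply Rmult_le_pos; [lra|apply Rabs_pos].
Qed.

Lemma Cderiv_segment_bound (f df : C -> C) (x y : C) (M : R) :
  (forall t, 0 <= t <= 1 -> Cderiv f (x + RtoC t * (y - x))%C (df (x + RtoC t * (y - x))%C)) ->
  (forall t, 0 <= t <= 1 -> Cmod (df (x + RtoC t * (y - x))%C) <= M) ->
  Cmod (f y - f x) <= 2 * M * Cmod (y - x).
Proof.
intros Hd HM.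
generalize (Rderiv_bound (fun t => f (x + RtoC t * (y - x))%C)
  (fun t => (df (x + RtoC t * (y - x)) * (y - x))%C) 0 1 (M * Cmod (y - x)) Rle_0_1).
replace (x + 1 * (y - x))%C with y by ring.
replace (x + 0 * (y - x))%C with x by ring.
intros H. replace (2 * M * Cmod (y - x)) with (2 * (M * Cmod (y - x)) * (1 - 0)) by ring.
apply H.
- intros t Ht. apply (Rderiv_comp f (fun t => (x + RtoC t * (y - x))%C)).
  + apply Hd, Ht.
  + apply Rderiv_line.
- intros t Ht. rewrite Cmod_mult. apply Rmult_le_compat_r; [apply Cmod_ge_0|]. auto.
Qed.

Lemma Cderiv_const (c z : C) : Cderiv (fun _ => c) z (RtoC 0).
Proof. apply (is_derive_const (K := C_AbsRing) (V := C_NormedModule)). Qed.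

Lemma Cderiv_id (z : C) : Cderiv (fun x => x) z (RtoC 1).
Proof.
apply Cderiv_iff. intros eps Heps. exists 1. split; [lra|]. intros y _.
replace (y - z - 1 * (y - z))%C with (RtoC 0) by ring.
rewrite Cmod_0. apply Rmult_le_pos; [lra|apply Cmod_ge_0].
Qed.

Lemma Cderiv_plus (f g : C -> C) (z df dg : C) :
  Cderiv f z df -> Cderiv g z dg -> Cderiv (fun x => (f x + g x)%C) z (df + dg)%C.
Proof. exact (is_derive_plus (K := C_AbsRing) (V := C_NormedModule) f g z df dg). Qed.

(** The chain and product rules of Coquelicot ask for values in [C_AbsRing] as a module over itself.
    It carries the same norm as [C_NormedModule], so the little-o condition is literally the
    same. *)
Lemma Cderiv_AbsRing (f : C -> C) (z l : C) : Cderiv f z l ->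
  is_derive (K := C_AbsRing) (V := AbsRing_NormedModule C_AbsRing) f z l.
Proof. intros [_ H]. split; [apply is_linear_scal_l|exact H]. Qed.

Lemma Cderiv_comp (f g : C -> C) (z df dg : C) :
  Cderiv f (g z) df -> Cderiv g z dg -> Cderiv (fun x => f (g x)) z (df * dg)%C.
Proof.
intros Hf Hg. rewrite Cmult_comm.
apply (is_derive_comp (K := C_AbsRing) (V := C_NormedModule) f g z df dg Hf).
now apply Cderiv_AbsRing.
Qed.

Lemma Cderiv_mult (f g : C -> C) (z df dg : C) :
  Cderiv f z df -> Cderiv g z dg ->
  Cderiv (fun x => (f x * g x)%C) z (df * g z + f z * dg)%C.
Proof.
intros Hf Hg.
assert (H := is_derive_mult (K := C_AbsRing) f g z df dg
  (Cderiv_AbsRing _ _ _ Hf) (Cderiv_AbsRing _ _ _ Hg) Cmult_comm).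
destruct H as [_ H]. split; [apply is_linear_scal_l|exact H].
Qed.

Lemma Cderiv_ext (f g : C -> C) (z l : C) (d : R) : 0 < d ->
  (forall y, Cmod (y - z) < d -> f y = g y) -> Cderiv f z l -> Cderiv g z l.
Proof.
intros Hd E. rewrite !Cderiv_iff. intros H eps Heps.
destruct (H eps Heps) as [d' [Hd' K]].
exists (Rmin d d'). split; [apply Rmin_pos; assumption|]. intros y Hy.
rewrite <- !E.
- apply K. exact (Rlt_le_trans _ _ _ Hy (Rmin_r _ _)).
- replace (z - z)%C with (RtoC 0) by ring. now rewrite Cmod_0.
- exact (Rlt_le_trans _ _ _ Hy (Rmin_l _ _)).
Qed.

Lemma Cderiv_inv (z : C) : z <> 0 -> Cderiv Cinv z (- / (z * z))%C.
Proof.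
intros Hz. apply Cderiv_iff. intros eps Heps.
assert (Hm : 0 < Cmod z) by now apply Cmod_gt_0.
set (m := Cmod z) in *.
assert (Hp : 0 < eps * m ^ 3 / 2) by (apply Rdiv_lt_0_compat; [apply Rmult_lt_0_compat; [lra|apply pow_lt; lra]|lra]).
(* The remainder is exactly (y - z)^2 / (y z^2). The first radius keeps |y| > m / 2; the second then
   makes one factor |y - z| at most [eps] times the denominator. *)
exists (Rmin (m / 2) (eps * m ^ 3 / 2)). split; [apply Rmin_pos; lra|].
intros y Hy.
assert (H1 := Rlt_le_trans _ _ _ Hy (Rmin_l _ _)).
assert (H2 := Rlt_le_trans _ _ _ Hy (Rmin_r _ _)).
assert (Hym : m / 2 < Cmod y).
{ generalize (Cmod_triangle_inv z y). rewrite Cmod_minus_sym. fold m. lra. }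
assert (Hy0 : y <> 0) by (apply Cmod_gt_0; lra).
replace (/ y - / z - - / (z * z) * (y - z))%C
  with ((y - z) * (y - z) * / (y * (z * z)))%C by (field; auto).
rewrite !Cmod_mult, Cmod_inv, !Cmod_mult by (repeat apply Cmult_neq_0; assumption).
fold m.
set (q := Cmod (y - z)) in *. assert (Hq : 0 <= q) by apply Cmod_ge_0.
replace (q * q * / (Cmod y * (m * m))) with (q * / (Cmod y * (m * m)) * q) by ring.
apply Rmult_le_compat_r; [exact Hq|].
assert (Hd : 0 < Cmod y * (m * m)) by (apply Rmult_lt_0_compat; nra).
apply Rmult_le_reg_r with (1 := Hd).
rewrite Rmult_assoc, Rinv_l, Rmult_1_r by lra.
apply Rle_trans with (eps * m ^ 3 / 2); [lra|].
replace (eps * m ^ 3 / 2) with (eps * (m / 2 * (m * m))) by field.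
apply Rmult_le_compat_l; [lra|]. apply Rmult_le_compat_r; nra.
Qed.

Lemma Cderiv_pow (n : nat) (z : C) :
  Cderiv (fun x => (x ^ n)%C) z (INR n * z ^ pred n)%C.
Proof.
induction n as [|n IH].
- simpl. replace (0 * 1)%C with (RtoC 0) by ring. apply Cderiv_const.
- simpl pred. replace (INR (S n) * z ^ n)%C with (1 * z ^ n + z * (INR n * z ^ pred n))%C.
  + apply (Cderiv_mult (fun x => x) (fun x => (x ^ n)%C)); [apply Cderiv_id|exact IH].
  + rewrite S_INR, RtoC_plus. destruct n as [|n]; simpl; ring.
Qed.

(** * Integrals of complex-valued functions on an interval *)

Definition Rcont (g : R -> C) (t : R) : Prop :=
  forall eps, 0 < eps -> exists d, 0 < d /\ forall s, Rabs (s - t) < d ->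
    Cmod (g s - g t) < eps.

Lemma Rcont_Re (g : R -> C) (t : R) : Rcont g t -> continuous (fun s => Re (g s)) t.
Proof.
intros H. apply filterlim_locally. intros [e He].
destruct (H e He) as [d [Hd K]]. exists (mkposreal d Hd). intros s Hs.
apply Rle_lt_trans with (2 := K s Hs). apply (Cmod_Re (g s - g t)).
Qed.

Lemma Rcont_Im (g : R -> C) (t : R) : Rcont g t -> continuous (fun s => Im (g s)) t.
Proof.
intros H. apply filterlim_locally. intros [e He].
destruct (H e He) as [d [Hd K]]. exists (mkposreal d Hd). intros s Hs.
apply Rle_lt_trans with (2 := K s Hs). apply (Cmod_Im (g s - g t)).
Qed.

Lemma Rcont_const (c : C) (t : R) : Rcont (fun _ => c) t.
Proof.
intros e He. exists 1. split; [lra|]. intros s _.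
replace (c - c)%C with (RtoC 0) by ring. now rewrite Cmod_0.
Qed.

Lemma Rderiv_Rcont (g : R -> C) (t : R) (l : C) : Rderiv g t l -> Rcont g t.
Proof.
rewrite Rderiv_iff. intros H e He. destruct (H 1 Rlt_0_1) as [d [Hd K]].
assert (Hl := Cmod_ge_0 l).
assert (Hp : 0 < e / (2 + Cmod l)) by (apply Rdiv_lt_0_compat; lra).
exists (Rmin d (e / (2 + Cmod l))). split; [apply Rmin_pos; assumption|].
intros s Hs.
specialize (K s (Rlt_le_trans _ _ _ Hs (Rmin_l _ _))).
assert (Hs2 := Rlt_le_trans _ _ _ Hs (Rmin_r _ _)).
assert (E := Cmod_triangle (g s - g t - l * RtoC (s - t)) (l * RtoC (s - t))).
replace (g s - g t - l * RtoC (s - t) + l * RtoC (s - t))%C with (g s - g t)%C in E by ring.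
rewrite Cmod_mult, Cmod_R in E.
assert (Hz := Rabs_pos (s - t)).
apply Rmult_lt_compat_r with (r := 2 + Cmod l) in Hs2; [|lra].
replace (e / (2 + Cmod l) * (2 + Cmod l)) with e in Hs2 by (field; lra).
nra.
Qed.

Lemma Rcont_comp (f : C -> C) (g : R -> C) (t : R) (l : C) :
  Cderiv f (g t) l -> Rcont g t -> Rcont (fun s => f (g s)) t.
Proof.
intros Hf Hg e He. destruct (Cderiv_continuous _ _ _ Hf e He) as [d [Hd K]].
destruct (Hg d Hd) as [d' [Hd' K']]. exists d'. split; [exact Hd'|]. auto.
Qed.

Lemma Rcont_plus (f g : R -> C) (t : R) :
  Rcont f t -> Rcont g t -> Rcont (fun s => (f s + g s)%C) t.
Proof.
intros Hf Hg e He.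
destruct (Hf (e / 2)) as [d1 [Hd1 K1]]; [lra|].
destruct (Hg (e / 2)) as [d2 [Hd2 K2]]; [lra|].
exists (Rmin d1 d2). split; [apply Rmin_pos; assumption|]. intros s Hs.
specialize (K1 s (Rlt_le_trans _ _ _ Hs (Rmin_l _ _))).
specialize (K2 s (Rlt_le_trans _ _ _ Hs (Rmin_r _ _))).
replace (f s + g s - (f t + g t))%C with ((f s - f t) + (g s - g t))%C by ring.
eapply Rle_lt_trans; [apply Cmod_triangle|]. lra.
Qed.

Lemma Rcont_mult (f g : R -> C) (t : R) :
  Rcont f t -> Rcont g t -> Rcont (fun s => (f s * g s)%C) t.
Proof.
intros Hf Hg e He.
assert (Hf0 := Cmod_ge_0 (f t)). assert (Hg0 := Cmod_ge_0 (g t)).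
set (M := 1 + Cmod (f t) + Cmod (g t)).
assert (HM : 1 <= M) by (unfold M; lra).
set (e1 := Rmin 1 (e / (3 * M))).
assert (He1 : 0 < e1) by (apply Rmin_pos; [lra|apply Rdiv_lt_0_compat; lra]).
destruct (Hf e1 He1) as [d1 [Hd1 K1]].
destruct (Hg e1 He1) as [d2 [Hd2 K2]].
exists (Rmin d1 d2). split; [apply Rmin_pos; assumption|]. intros s Hs.
specialize (K1 s (Rlt_le_trans _ _ _ Hs (Rmin_l _ _))).
specialize (K2 s (Rlt_le_trans _ _ _ Hs (Rmin_r _ _))).
replace (f s * g s - f t * g t)%C
  with ((f s - f t) * (g s - g t) + (f s - f t) * g t + f t * (g s - g t))%C by ring.
eapply Rle_lt_trans; [apply Cmod_triangle|].
eapply Rle_lt_trans; [apply Rplus_le_compat_r, Cmod_triangle|].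
rewrite !Cmod_mult.
assert (H1 : e1 <= 1) by apply Rmin_l.
assert (H2 : e1 * (3 * M) <= e).
{ apply Rle_trans with (e / (3 * M) * (3 * M)).
  - apply Rmult_le_compat_r; [lra|apply Rmin_r].
  - right. field. lra. }
assert (P1 := Cmod_ge_0 (f s - f t)). assert (P2 := Cmod_ge_0 (g s - g t)).
unfold M in H2. nra.
Qed.

Lemma Rcont_opp (f : R -> C) (t : R) : Rcont f t -> Rcont (fun s => (- f s)%C) t.
Proof.
intros H e He. destruct (H e He) as [d [Hd K]]. exists d. split; [exact Hd|].
intros s Hs. replace (- f s - - f t)%C with (- (f s - f t))%C by ring.
rewrite Cmod_opp. auto.
Qed.

Definition CInt (f : R -> C) (a b : R) : C :=
  (RInt (fun t => Re (f t)) a b, RInt (fun t => Im (f t)) a b).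

(** [Rcont] at an end point also looks outside the interval. This is harmless here: the integrands
    come from curves defined for all real parameters and functions complex differentiable at every
    point of the curve. *)
Definition Cont_on (f : R -> C) (a b : R) : Prop := forall t, a <= t <= b -> Rcont f t.

Lemma Cont_on_ex_RInt (f : R -> C) (a b : R) : a <= b -> Cont_on f a b ->
  ex_RInt (fun t => Re (f t)) a b /\ ex_RInt (fun t => Im (f t)) a b.
Proof.
intros Hab H. split; apply (ex_RInt_continuous (V := R_CompleteNormedModule));
  rewrite Rmin_left, Rmax_right by lra; intros t Ht;
  [apply Rcont_Re|apply Rcont_Im]; auto.
Qed.

Lemma CInt_plus (f g : R -> C) (a b : R) : a <= b -> Cont_on f a b -> Cont_on g a b ->
  CInt (fun t => (f t + g t)%C) a b = (CInt f a b + CInt g a b)%C.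
Proof.
intros Hab Hf Hg.
destruct (Cont_on_ex_RInt f a b Hab Hf), (Cont_on_ex_RInt g a b Hab Hg).
apply injective_projections; simpl;
  [apply (RInt_plus (V := R_CompleteNormedModule) (fun t => Re (f t)) (fun t => Re (g t)))
  |apply (RInt_plus (V := R_CompleteNormedModule) (fun t => Im (f t)) (fun t => Im (g t)))];
  assumption.
Qed.

Lemma CInt_scal (c : C) (f : R -> C) (a b : R) : a <= b -> Cont_on f a b ->
  CInt (fun t => (c * f t)%C) a b = (c * CInt f a b)%C.
Proof.
intros Hab Hf. destruct (Cont_on_ex_RInt f a b Hab Hf) as [H1 H2].
destruct c as [x y].
apply (RInt_correct (V := R_CompleteNormedModule)) in H1.
apply (RInt_correct (V := R_CompleteNormedModule)) in H2.
apply injective_projections; apply is_RInt_unique.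
- apply (is_RInt_minus (V := R_NormedModule)
    (fun t => scal x (Re (f t))) (fun t => scal y (Im (f t))));
    apply (is_RInt_scal (V := R_NormedModule)); assumption.
- apply (is_RInt_plus (V := R_NormedModule)
    (fun t => scal x (Im (f t))) (fun t => scal y (Re (f t))));
    apply (is_RInt_scal (V := R_NormedModule)); assumption.
Qed.

Lemma CInt_minus (f g : R -> C) (a b : R) : a <= b -> Cont_on f a b -> Cont_on g a b ->
  CInt (fun t => (f t - g t)%C) a b = (CInt f a b - CInt g a b)%C.
Proof.
intros Hab Hf Hg.
destruct (Cont_on_ex_RInt f a b Hab Hf), (Cont_on_ex_RInt g a b Hab Hg).
apply injective_projections; simpl;
  [apply (RInt_minus (V := R_CompleteNormedModule) (fun t => Re (f t)) (fun t => Re (g t)))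
  |apply (RInt_minus (V := R_CompleteNormedModule) (fun t => Im (f t)) (fun t => Im (g t)))];
  assumption.
Qed.

Lemma CInt_ext (f g : R -> C) (a b : R) : a <= b ->
  (forall t, a <= t <= b -> f t = g t) -> CInt f a b = CInt g a b.
Proof.
intros Hab H. unfold CInt. f_equal; apply (RInt_ext (V := R_CompleteNormedModule));
  rewrite Rmin_left, Rmax_right by lra; intros t Ht; rewrite H; (reflexivity || lra).
Qed.

Lemma CInt_bound (f : R -> C) (a b M : R) : a <= b -> Cont_on f a b ->
  (forall t, a <= t <= b -> Cmod (f t) <= M) -> Cmod (CInt f a b) <= 2 * M * (b - a).
Proof.
intros Hab Hf HM. destruct (Cont_on_ex_RInt f a b Hab Hf) as [H1 H2].
eapply Rle_trans; [apply Cmod_le_Re_Im|].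
assert (E1 : Rabs (Re (CInt f a b)) <= (b - a) * M).
{ apply (norm_RInt_le_const (V := R_NormedModule) (fun t => Re (f t)) a b _ M Hab).
  - intros t Ht. apply Rle_trans with (2 := HM t Ht). apply Cmod_Re.
  - apply (RInt_correct (V := R_CompleteNormedModule)). exact H1. }
assert (E2 : Rabs (Im (CInt f a b)) <= (b - a) * M).
{ apply (norm_RInt_le_const (V := R_NormedModule) (fun t => Im (f t)) a b _ M Hab).
  - intros t Ht. apply Rle_trans with (2 := HM t Ht). apply Cmod_Im.
  - apply (RInt_correct (V := R_CompleteNormedModule)). exact H2. }
lra.
Qed.

Lemma CInt_Chasles (f : R -> C) (a b c : R) : a <= b -> b <= c -> Cont_on f a c ->
  CInt f a c = (CInt f a b + CInt f b c)%C.
Proof.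
intros Hab Hbc H.
destruct (Cont_on_ex_RInt f a b) as [H1 H2]; [lra|intros t Ht; apply H; lra|].
destruct (Cont_on_ex_RInt f b c) as [H3 H4]; [lra|intros t Ht; apply H; lra|].
symmetry.
apply injective_projections; simpl; apply (RInt_Chasles (V := R_CompleteNormedModule));
  assumption.
Qed.

Lemma CInt_derive (g dg : R -> C) (a b : R) : a <= b ->
  (forall t, a <= t <= b -> Rderiv g t (dg t)) -> Cont_on dg a b ->
  CInt dg a b = (g b - g a)%C.
Proof.
intros Hab Hg Hc.
apply injective_projections; simpl; apply is_RInt_unique.
- apply (is_RInt_derive (V := R_CompleteNormedModule) (fun t => Re (g t)));
  rewrite Rmin_left, Rmax_right by lra; intros t Ht.
  + apply Hg, Ht.
  + apply Rcont_Re. auto.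
- apply (is_RInt_derive (V := R_CompleteNormedModule) (fun t => Im (g t)));
  rewrite Rmin_left, Rmax_right by lra; intros t Ht.
  + apply Hg, Ht.
  + apply Rcont_Im. auto.
Qed.

Lemma CInt_const (c : C) (a b : R) : a <= b -> CInt (fun _ => c) a b = (c * RtoC (b - a))%C.
Proof.
intros Hab.
rewrite (CInt_derive (fun t => (0 + RtoC t * c)%C) (fun _ => c) a b Hab).
- rewrite RtoC_minus. ring.
- intros t _. apply Rderiv_line.
- intros t _. apply Rcont_const.
Qed.

(** * Nested intervals and bisection of a rectangle *)

Lemma nested_intervals (a b : nat -> R) :
  (forall n, a n <= a (S n)) -> (forall n, b (S n) <= b n) -> (forall n, a n <= b n) ->
  exists p, forall n, a n <= p <= b n.
Proof.
intros Ha Hb Hab.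
assert (Ha' : forall n k, a n <= a (n + k)%nat).
{ intros n k. induction k as [|k IH]; [rewrite Nat.add_0_r; lra|].
  rewrite Nat.add_succ_r. apply Rle_trans with (1 := IH), Ha. }
assert (Hb' : forall n k, b (n + k)%nat <= b n).
{ intros n k. induction k as [|k IH]; [rewrite Nat.add_0_r; lra|].
  rewrite Nat.add_succ_r. apply Rle_trans with (2 := IH), Hb. }
assert (H : forall n m, a n <= b m).
{ intros n m. apply Rle_trans with (1 := Ha' n m).
  apply Rle_trans with (1 := Hab _). rewrite Nat.add_comm. apply Hb'. }
destruct (completeness (fun x => exists n, x = a n)) as [p [Hp1 Hp2]].
- exists (b O). intros x [n ->]. apply H.
- exists (a O), O. reflexivity.
- exists p. intros n. split.
  + apply Hp1. now exists n.
  + apply Hp2. intros x [m ->]. apply H.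
Qed.

Lemma exists_pow_half_lt (A d : R) : 0 < d -> exists n : nat, A / 2 ^ n < d.
Proof.
intros Hd. destruct (Rle_lt_dec A 0) as [HA|HA].
- exists O. simpl. lra.
- destruct (Pow_x_infinity 2) with (b := 2 * A / d) as [n Hn].
  { rewrite Rabs_pos_eq; lra. }
  exists n. specialize (Hn n (le_n n)).
  assert (Hp : 0 < 2 ^ n) by (apply pow_lt; lra).
  rewrite Rabs_pos_eq in Hn by lra.
  apply Rmult_lt_reg_r with (2 ^ n); [exact Hp|].
  unfold Rdiv at 1. rewrite Rmult_assoc, Rinv_l, Rmult_1_r by lra.
  apply Rge_le in Hn.
  apply Rmult_le_compat_l with (r := d) in Hn; [|lra].
  replace (d * (2 * A / d)) with (2 * A) in Hn by (field; lra). lra.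
Qed.

(** Goursat's argument freed from integrals. Some quarter always keeps a fourth of the quantity, so
    after k steps N0 / 4^k <= eps ((A + B) / 2^k)^2 near the limit point; the powers cancel and
    [eps] is arbitrary. *)
Lemma bisection (N : R -> R -> R -> R -> R) (x0 y0 A B : R) : 0 <= A -> 0 <= B ->
  (forall x y u v, 0 <= u -> 0 <= v -> x0 <= x -> x + 2 * u <= x0 + A ->
    y0 <= y -> y + 2 * v <= y0 + B ->
    N x y (2 * u) (2 * v) <=
      N x y u v + N (x + u) y u v + N x (y + v) u v + N (x + u) (y + v) u v) ->
  (forall p q, x0 <= p <= x0 + A -> y0 <= q <= y0 + B -> forall eps, 0 < eps ->
    exists d, 0 < d /\ forall x y u v, 0 <= u < d -> 0 <= v < d ->
      x <= p <= x + u -> y <= q <= y + v ->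
      x0 <= x -> x + u <= x0 + A -> y0 <= y -> y + v <= y0 + B ->
      N x y u v <= eps * (u + v) ^ 2) ->
  N x0 y0 A B <= 0.
Proof.
intros HA HB Hsub Hloc.
set (N0 := N x0 y0 A B).
(* The last branch needs no test: if three quarters fall below the threshold, subadditivity forces
   the fourth above it. *)
set (step := fun (k : nat) (z : R * R) =>
  let x := fst z in let y := snd z in
  let u := A / 2 ^ S k in let v := B / 2 ^ S k in
  if Rle_dec (N0 / 4 ^ S k) (N x y u v) then (x, y)
  else if Rle_dec (N0 / 4 ^ S k) (N (x + u) y u v) then (x + u, y)
  else if Rle_dec (N0 / 4 ^ S k) (N x (y + v) u v) then (x, y + v)
  else (x + u, y + v)).
set (z := fix z (k : nat) : R * R := match k with O => (x0, y0) | S k => step k (z k) end).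
assert (P2 : forall k, 0 < 2 ^ k) by (intros; apply pow_lt; lra).
assert (P4 : forall k, 0 < 4 ^ k) by (intros; apply pow_lt; lra).
assert (Hhalf : forall D k, D / 2 ^ k = 2 * (D / 2 ^ S k)).
{ intros D k. simpl. field. generalize (P2 k). lra. }
assert (Hnn : forall D k, 0 <= D -> 0 <= D / 2 ^ k).
{ intros D k HD. apply Rmult_le_pos; [exact HD|]. apply Rlt_le, Rinv_0_lt_compat, P2. }
assert (Hstep : forall k,
  (fst (z (S k)) = fst (z k) \/ fst (z (S k)) = fst (z k) + A / 2 ^ S k) /\
  (snd (z (S k)) = snd (z k) \/ snd (z (S k)) = snd (z k) + B / 2 ^ S k)).
{ intros k. change (z (S k)) with (step k (z k)). unfold step.
  repeat destruct Rle_dec; cbn [fst snd]; auto. }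
assert (HX : forall k, x0 <= fst (z k) /\ fst (z k) + A / 2 ^ k <= x0 + A /\
  y0 <= snd (z k) /\ snd (z k) + B / 2 ^ k <= y0 + B).
{ induction k as [|k IH].
  - simpl. lra.
  - destruct (Hstep k) as [H1 H2]. rewrite (Hhalf A k), (Hhalf B k) in IH.
    generalize (Hnn A (S k) HA) (Hnn B (S k) HB). lra. }
assert (HN : forall k, N0 / 4 ^ k <= N (fst (z k)) (snd (z k)) (A / 2 ^ k) (B / 2 ^ k)).
{ induction k as [|k IH].
  - simpl. unfold Rdiv. rewrite Rinv_1, !Rmult_1_r. apply Rle_refl.
  - destruct (HX k) as [H1 [H2 [H3 H4]]].
    rewrite (Hhalf A k), (Hhalf B k) in *.
    assert (E := Hsub _ _ _ _ (Hnn A (S k) HA) (Hnn B (S k) HB) H1 H2 H3 H4).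
    assert (E4 : N0 / 4 ^ k = 4 * (N0 / 4 ^ S k)).
    { simpl. field. generalize (P4 k). lra. }
    rewrite E4 in IH.
    change (z (S k)) with (step k (z k)). unfold step.
    repeat destruct Rle_dec; cbn [fst snd]; lra. }
destruct (nested_intervals (fun k => fst (z k)) (fun k => fst (z k) + A / 2 ^ k)) as [p Hp].
{ intros k. destruct (Hstep k) as [H1 _]. generalize (Hnn A (S k) HA). lra. }
{ intros k. rewrite (Hhalf A k). destruct (Hstep k) as [H1 _].
  generalize (Hnn A (S k) HA). lra. }
{ intros k. generalize (Hnn A k HA). lra. }
destruct (nested_intervals (fun k => snd (z k)) (fun k => snd (z k) + B / 2 ^ k)) as [q Hq].
{ intros k. destruct (Hstep k) as [_ H1]. generalize (Hnn B (S k) HB). lra. }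
{ intros k. rewrite (Hhalf B k). destruct (Hstep k) as [_ H1].
  generalize (Hnn B (S k) HB). lra. }
{ intros k. generalize (Hnn B k HB). lra. }
assert (Hfin : forall eps, 0 < eps -> N0 <= eps * (A + B) ^ 2).
{ intros eps Heps.
  assert (Hp0 := Hp O). assert (Hq0 := Hq O). cbn [fst snd z pow] in Hp0, Hq0.
  destruct (Hloc p q) with (eps := eps) as [d [Hd K]]; [lra|lra|exact Heps|].
  destruct (exists_pow_half_lt (A + B) d Hd) as [k Hk].
  assert (E : (A + B) / 2 ^ k = A / 2 ^ k + B / 2 ^ k) by (field; generalize (P2 k); lra).
  destruct (HX k) as [H1 [H2 [H3 H4]]].
  assert (HAk := Hnn A k HA). assert (HBk := Hnn B k HB).
  specialize (K (fst (z k)) (snd (z k)) (A / 2 ^ k) (B / 2 ^ k)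
    ltac:(lra) ltac:(lra) (Hp k) (Hq k) H1 H2 H3 H4).
  assert (K' := Rle_trans _ _ _ (HN k) K).
  rewrite <- E in K'.
  replace (eps * ((A + B) / 2 ^ k) ^ 2) with (eps * (A + B) ^ 2 / 4 ^ k) in K'.
  - apply Rmult_le_reg_r with (/ 4 ^ k); [apply Rinv_0_lt_compat, P4|]. exact K'.
  - replace 4 with (2 * 2) by ring. rewrite Rpow_mult_distr. field.
    generalize (P2 k). lra. }
apply Rnot_lt_le. intros Hlt.
assert (HAB : 0 <= (A + B) ^ 2) by apply pow2_ge_0.
specialize (Hfin (N0 / (2 * (1 + (A + B) ^ 2)))).
assert (H0 : 0 < N0 / (2 * (1 + (A + B) ^ 2))) by (apply Rdiv_lt_0_compat; lra).
specialize (Hfin H0).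
assert (E : N0 / (2 * (1 + (A + B) ^ 2)) * (A + B) ^ 2 <= N0 / 2).
{ apply Rle_trans with (N0 / (2 * (1 + (A + B) ^ 2)) * (1 + (A + B) ^ 2)).
  - apply Rmult_le_compat_l; lra.
  - right. field. lra. }
lra.
Qed.

(** * Goursat's theorem *)

(** The line integral of P dt + Q ds, counterclockwise; [u] and [v] are side lengths, not end
    points. *)
Definition boundary_integral (P Q : R -> R -> C) (x y u v : R) : C :=
  (CInt (fun t => P t y) x (x + u) + CInt (fun s => Q (x + u)%R s) y (y + v)
   - CInt (fun t => P t (y + v)%R) x (x + u) - CInt (fun s => Q x s) y (y + v))%C.

(** Each inner edge is traversed once in either direction, so after Chasles' relation only ring
    arithmetic remains. *)
Lemma boundary_integral_split (P Q : R -> R -> C) (x y u v : R) : 0 <= u -> 0 <= v ->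
  (forall s, y <= s <= y + 2 * v -> Cont_on (fun t => P t s) x (x + 2 * u)) ->
  (forall t, x <= t <= x + 2 * u -> Cont_on (fun s => Q t s) y (y + 2 * v)) ->
  boundary_integral P Q x y (2 * u) (2 * v) =
  (boundary_integral P Q x y u v + boundary_integral P Q (x + u) y u v
   + boundary_integral P Q x (y + v) u v + boundary_integral P Q (x + u) (y + v) u v)%C.
Proof.
intros Hu Hv HP HQ. unfold boundary_integral.
replace (x + 2 * u) with (x + u + u) in * by ring.
replace (y + 2 * v) with (y + v + v) in * by ring.
rewrite (CInt_Chasles (fun t => P t y) x (x + u) (x + u + u)),
  (CInt_Chasles (fun t => P t (y + v + v)) x (x + u) (x + u + u)),
  (CInt_Chasles (fun s => Q (x + u + u) s) y (y + v) (y + v + v)),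
  (CInt_Chasles (fun s => Q x s) y (y + v) (y + v + v));
  try lra; try (apply HP; lra); try (apply HQ; lra).
ring.
Qed.

(** [Phi] is a primitive of the affine approximation h0 + h1 (z - z0), whose integral along any
    curve is therefore the increment of [Phi]; what is left is the integral of the approximation
    error. *)
Lemma CInt_linear_approx (h : C -> C) (g dg : R -> C) (a b e L : R) (z0 h0 h1 : C) :
  a <= b -> 0 <= e ->
  (forall t, a <= t <= b -> Rderiv g t (dg t)) ->
  Cont_on dg a b -> Cont_on (fun t => h (g t)) a b ->
  (forall t, a <= t <= b -> Cmod (h (g t) - h0 - h1 * (g t - z0)) <= e) ->
  (forall t, a <= t <= b -> Cmod (dg t) <= L) ->
  let Phi z := (h0 * (z - z0) + h1 * ((z - z0) * (z - z0)) / 2)%C in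
  Cmod (CInt (fun t => (h (g t) * dg t)%C) a b - (Phi (g b) - Phi (g a)))
    <= 2 * (e * L) * (b - a).
Proof.
intros Hab He Hg Hdg Hh Hap HL Phi.
assert (HPhi : forall z, Cderiv Phi z (h0 + h1 * (z - z0))%C).
{ intros z. apply Cderiv_iff. intros eps Heps.
  assert (H1 := Cmod_ge_0 h1).
  exists (eps / (1 + Cmod h1)). split; [apply Rdiv_lt_0_compat; lra|].
  intros y Hy. unfold Phi.
  match goal with |- Cmod ?X <= _ => replace X with (h1 * (y - z) * (y - z) * / 2)%C by field end.
  rewrite <- RtoC_inv, !Cmod_mult, Cmod_R, (Rabs_pos_eq (/ 2)) by lra.
  assert (Hz := Cmod_ge_0 (y - z)).
  apply Rmult_lt_compat_l with (r := 1 + Cmod h1) in Hy; [|lra].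
  replace ((1 + Cmod h1) * (eps / (1 + Cmod h1))) with eps in Hy by (field; lra).
  assert (Cmod h1 * Cmod (y - z) <= eps) by lra.
  assert (0 <= Cmod h1 * Cmod (y - z)) by (apply Rmult_le_pos; assumption).
  nra. }
assert (Hd : forall t, a <= t <= b ->
  Rderiv (fun s => Phi (g s)) t ((h0 + h1 * (g t - z0)) * dg t)%C).
{ intros t Ht. apply Rderiv_comp; [apply HPhi|apply Hg, Ht]. }
assert (Hc : Cont_on (fun t => ((h0 + h1 * (g t - z0)) * dg t)%C) a b).
{ intros t Ht. apply Rcont_mult; [|apply Hdg, Ht].
  apply Rcont_plus; [apply Rcont_const|]. apply Rcont_mult; [apply Rcont_const|].
  apply Rcont_plus; [|apply Rcont_const]. apply (Rderiv_Rcont _ _ _ (Hg t Ht)). }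
assert (Hc' : Cont_on (fun t => (h (g t) * dg t)%C) a b).
{ intros t Ht. apply Rcont_mult; auto. }
rewrite <- (CInt_derive (fun t => Phi (g t)) _ a b Hab Hd Hc).
rewrite <- CInt_minus by assumption.
apply CInt_bound; [exact Hab| |].
- intros t Ht. apply Rcont_plus; [|apply Rcont_opp]; auto.
- intros t Ht.
  replace (h (g t) * dg t - (h0 + h1 * (g t - z0)) * dg t)%C
    with ((h (g t) - h0 - h1 * (g t - z0)) * dg t)%C by ring.
  rewrite Cmod_mult. apply Rmult_le_compat; auto using Cmod_ge_0.
Qed.

(* Goursat's bisection, run in the parameter rectangle of a homotopy rather than in the plane. *)
Lemma goursat (g gt gs : R -> R -> C) (h : C -> C) (x0 y0 A B L : R) : 0 <= A -> 0 <= B ->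
  (forall t s, x0 <= t <= x0 + A -> y0 <= s <= y0 + B ->
     Rderiv (fun t => g t s) t (gt t s) /\ Rderiv (fun s => g t s) s (gs t s) /\
     Rcont (fun t => gt t s) t /\ Rcont (fun s => gs t s) s /\
     Cmod (gt t s) <= L /\ Cmod (gs t s) <= L /\ exists l, Cderiv h (g t s) l) ->
  boundary_integral (fun t s => (h (g t s) * gt t s)%C) (fun t s => (h (g t s) * gs t s)%C)
    x0 y0 A B = 0.
Proof.
intros HA HB H.
set (P := fun t s => (h (g t s) * gt t s)%C).
set (Q := fun t s => (h (g t s) * gs t s)%C).
assert (HL : 0 <= L).
{ destruct (H x0 y0) as (_ & _ & _ & _ & HL & _); [lra|lra|].
  apply Rle_trans with (2 := HL), Cmod_ge_0. }
assert (Hh1 : forall t s, x0 <= t <= x0 + A -> y0 <= s <= y0 + B ->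
  Rcont (fun t => h (g t s)) t).
{ intros t s Ht Hs. destruct (H t s Ht Hs) as (H1 & _ & _ & _ & _ & _ & l & H3).
  apply (Rcont_comp h (fun t => g t s) t l H3). apply (Rderiv_Rcont _ _ _ H1). }
assert (Hh2 : forall t s, x0 <= t <= x0 + A -> y0 <= s <= y0 + B ->
  Rcont (fun s => h (g t s)) s).
{ intros t s Ht Hs. destruct (H t s Ht Hs) as (_ & H1 & _ & _ & _ & _ & l & H3).
  apply (Rcont_comp h (fun s => g t s) s l H3). apply (Rderiv_Rcont _ _ _ H1). }
assert (HP : forall t s, x0 <= t <= x0 + A -> y0 <= s <= y0 + B ->
  Rcont (fun t => P t s) t).
{ intros t s Ht Hs. apply Rcont_mult; [apply Hh1; assumption|apply (H t s Ht Hs)]. }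
assert (HQ : forall t s, x0 <= t <= x0 + A -> y0 <= s <= y0 + B ->
  Rcont (fun s => Q t s) s).
{ intros t s Ht Hs. apply Rcont_mult; [apply Hh2; assumption|apply (H t s Ht Hs)]. }
apply Cmod_eq_0, Rle_antisym; [|apply Cmod_ge_0].
apply (bisection (fun x y u v => Cmod (boundary_integral P Q x y u v))); [exact HA|exact HB| |].
- intros x y u v Hu Hv H1 H2 H3 H4.
  rewrite boundary_integral_split; [|exact Hu|exact Hv| |].
  + eapply Rle_trans; [apply Cmod_triangle|]. apply Rplus_le_compat_r.
    eapply Rle_trans; [apply Cmod_triangle|]. apply Rplus_le_compat_r.
    apply Cmod_triangle.
  + intros s Hs t Ht. apply HP; lra.
  + intros t Ht s Hs. apply HQ; lra.
- intros p q Hp Hq eps Heps.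
  destruct (H p q Hp Hq) as (_ & _ & _ & _ & _ & _ & h1 & Hh).
  rewrite Cderiv_iff in Hh.
  (* The four edges have total length 2 (u + v) and error 2 E L per unit length, where E = 2 e L (u
     + v) is introduced below; together this is 8 L^2 e (u + v)^2. *)
  set (e := eps / (8 * (1 + L) ^ 2)).
  assert (H8 : 0 < 8 * (1 + L) ^ 2) by (apply Rmult_lt_0_compat; [lra|apply pow_lt; lra]).
  assert (He : 0 < e) by (apply Rdiv_lt_0_compat; lra).
  destruct (Hh e He) as [d [Hd K]].
  (* With this bound on the sides, 2 L (u + v) < d: the image of the small rectangle stays where the
     linear approximation of [h] at [g p q] is valid. *)
  exists (d / (4 * (1 + L))). split; [apply Rdiv_lt_0_compat; lra|].
  intros x y u v Hu Hv Hxp Hyq Hx1 Hx2 Hy1 Hy2.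
  assert (Hdist : forall t s, x <= t <= x + u -> y <= s <= y + v ->
    Cmod (g t s - g p q) <= 2 * L * (u + v)).
  { intros t s Ht Hs.
    assert (E1 : forall t1 t2 s, x <= t1 <= t2 -> t2 <= x + u -> y <= s <= y + v ->
      Cmod (g t2 s - g t1 s) <= 2 * L * u).
    { intros t1 t2 s' Ht1 Ht2 Hs'. apply Rle_trans with (2 * L * (t2 - t1)).
      - apply (Rderiv_bound (fun t => g t s') (fun t => gt t s')); [lra| |];
          intros t' Ht'; apply H; lra.
      - apply Rmult_le_compat_l; lra. }
    assert (E2 : forall s1 s2 t, y <= s1 <= s2 -> s2 <= y + v -> x <= t <= x + u ->
      Cmod (g t s2 - g t s1) <= 2 * L * v).
    { intros s1 s2 t' Hs1 Hs2 Ht'. apply Rle_trans with (2 * L * (s2 - s1)).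
      - apply (Rderiv_bound (fun s => g t' s) (fun s => gs t' s)); [lra| |];
          intros s' Hs'; apply H; lra.
      - apply Rmult_le_compat_l; lra. }
    replace (g t s - g p q)%C with ((g t s - g p s) + (g p s - g p q))%C by ring.
    eapply Rle_trans; [apply Cmod_triangle|]. rewrite Rmult_plus_distr_l.
    apply Rplus_le_compat.
    - destruct (Rle_dec p t); [|rewrite Cmod_minus_sym]; apply E1; lra.
    - destruct (Rle_dec q s); [|rewrite Cmod_minus_sym]; apply E2; lra. }
  assert (Hsmall : 2 * L * (u + v) < d).
  { apply Rle_lt_trans with (2 * (1 + L) * (u + v)); [nra|].
    apply Rlt_le_trans with (2 * (1 + L) * (d / (4 * (1 + L)) + d / (4 * (1 + L)))).
    - apply Rmult_lt_compat_l; lra.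
    - right. field. lra. }
  set (E := e * (2 * L * (u + v))).
  assert (HE : 0 <= E).
  { unfold E. apply Rmult_le_pos; [lra|]. apply Rmult_le_pos; lra. }
  assert (Hap : forall t s, x <= t <= x + u -> y <= s <= y + v ->
    Cmod (h (g t s) - h (g p q) - h1 * (g t s - g p q)) <= E).
  { intros t s Ht Hs. specialize (Hdist t s Ht Hs).
    eapply Rle_trans; [apply K; lra|]. apply Rmult_le_compat_l; lra. }
  assert (S1 : forall s, y <= s <= y + v ->
    let Phi z := (h (g p q) * (z - g p q) + h1 * ((z - g p q) * (z - g p q)) / 2)%C in
    Cmod (CInt (fun t => P t s) x (x + u) - (Phi (g (x + u)%R s) - Phi (g x s)))
      <= 2 * (E * L) * (x + u - x)).
  { intros s Hs. apply (CInt_linear_approx h (fun t => g t s) (fun t => gt t s));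
      try lra; intros t Ht; [apply H; lra|apply H; lra|apply Hh1; lra| |apply H; lra].
    apply Hap; lra. }
  assert (S2 : forall t, x <= t <= x + u ->
    let Phi z := (h (g p q) * (z - g p q) + h1 * ((z - g p q) * (z - g p q)) / 2)%C in
    Cmod (CInt (fun s => Q t s) y (y + v) - (Phi (g t (y + v)%R) - Phi (g t y)))
      <= 2 * (E * L) * (y + v - y)).
  { intros t Ht. apply (CInt_linear_approx h (fun s => g t s) (fun s => gs t s));
      try lra; intros s Hs; [apply H; lra|apply H; lra|apply Hh2; lra| |apply H; lra].
    apply Hap; lra. }
  assert (A1 := S1 y ltac:(lra)). assert (A2 := S2 (x + u) ltac:(lra)).
  assert (A3 := S1 (y + v) ltac:(lra)). assert (A4 := S2 x ltac:(lra)).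
  cbv zeta in A1, A2, A3, A4. clear S1 S2.
  unfold boundary_integral.
  set (I1 := CInt (fun t => P t y) x (x + u)) in *.
  set (I2 := CInt (fun s => Q (x + u) s) y (y + v)) in *.
  set (I3 := CInt (fun t => P t (y + v)) x (x + u)) in *.
  set (I4 := CInt (fun s => Q x s) y (y + v)) in *.
  match type of A1 with Cmod (_ - (?a - ?b)) <= _ => set (F10 := a) in *; set (F00 := b) in * end.
  match type of A3 with Cmod (_ - (?a - ?b)) <= _ => set (F11 := a) in *; set (F01 := b) in * end.
  (* The increments of the primitive along the four edges telescope to zero, which leaves only the
     four approximation errors. *)
  replace (I1 + I2 - I3 - I4)%C with
    ((I1 - (F10 - F00)) + (I2 - (F11 - F10)) - (I3 - (F11 - F01)) - (I4 - (F01 - F00)))%C by ring.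
  eapply Rle_trans; [apply Cmod_triangle_minus|].
  eapply Rle_trans; [apply Rplus_le_compat_r, Cmod_triangle_minus|].
  eapply Rle_trans; [apply Rplus_le_compat_r, Rplus_le_compat_r, Cmod_triangle|].
  apply Rle_trans with (8 * L ^ 2 * e * (u + v) ^ 2).
  + replace (8 * L ^ 2 * e * (u + v) ^ 2) with (4 * (E * L) * (u + v)) by (unfold E; ring). lra.
  + apply Rmult_le_compat_r; [apply pow2_ge_0|].
    apply Rle_trans with (8 * (1 + L) ^ 2 * e).
    * apply Rmult_le_compat_r; [lra|]. nra.
    * unfold e. right. field. lra.
Qed.

(** * Cauchy's formula and Taylor expansion *)

Definition cis (s : R) : C := (cos s, sin s).

Lemma Cmod_cis (s : R) : Cmod (cis s) = 1.
Proof.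
rewrite <- sqrt_1. unfold Cmod, cis. f_equal. simpl.
generalize (sin2_cos2 s). unfold Rsqr. lra.
Qed.

Lemma cis_neq_0 (s : R) : cis s <> 0%C.
Proof. apply Cmod_gt_0. rewrite Cmod_cis. lra. Qed.

Lemma Rderiv_ext (f g : R -> C) (t : R) (l : C) :
  (forall s, f s = g s) -> Rderiv f t l -> Rderiv g t l.
Proof.
intros E [H1 H2]. split; [revert H1|revert H2]; apply is_derive_ext; intros s; now rewrite E.
Qed.

Lemma Rderiv_cis (c : C) (k : C) (s : R) :
  Rderiv (fun s => (c + k * cis s)%C) s (k * (Ci * cis s))%C.
Proof.
destruct c as [c1 c2], k as [k1 k2].
unfold Rderiv, cis, Re, Im. simpl. split; auto_derive; trivial; ring.
Qed.

Lemma Rcont_cis (c k : C) (s : R) : Rcont (fun s => (c + k * cis s)%C) s.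
Proof. exact (Rderiv_Rcont _ _ _ (Rderiv_cis c k s)). Qed.

Lemma Rcont_circle (k : C) (s : R) : Rcont (fun s => (k * cis s)%C) s.
Proof.
intros e He. destruct (Rcont_cis 0 k s e He) as [d [Hd K]].
exists d. split; [exact Hd|]. intros x Hx. specialize (K x Hx).
now rewrite !Cplus_0_l in K.
Qed.

Lemma Cmod_circle (r s : R) : 0 <= r -> Cmod (r * cis s) = r.
Proof. intros Hr. rewrite Cmod_mult, Cmod_R, Cmod_cis, Rabs_pos_eq; lra. Qed.

(** Points of the boundary circle are included, with differentiability in the whole plane; the
    derivative is not assumed continuous. *)
Definition holomorphic_closed_disk (f : C -> C) (r : R) : Prop :=
  forall z, Cmod z <= r -> exists l, Cderiv f z l.

Lemma Rcont_on_circle (f : C -> C) (r s : R) : 0 <= r ->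
  (forall z, Cmod z = r -> exists l, Cderiv f z l) ->
  Rcont (fun s => f (r * cis s)%C) s.
Proof.
intros Hr Hf. destruct (Hf (r * cis s)%C) as [l Hl].
- now apply Cmod_circle.
- apply (Rcont_comp f (fun s => (r * cis s)%C) s l Hl), Rcont_circle.
Qed.

Lemma Cderiv_div_sub (f : C -> C) (z w l : C) : z <> w -> Cderiv f z l ->
  exists l', Cderiv (fun x => (f x * / (x - w))%C) z l'.
Proof.
intros Hzw Hf. eexists. apply Cderiv_mult; [exact Hf|].
apply (Cderiv_comp Cinv (fun x => (x - w)%C)).
- apply Cderiv_inv. intros E. apply Hzw.
  replace z with (z - w + w)%C by ring. rewrite E. ring.
- apply (Cderiv_plus (fun x => x) (fun _ => (- w)%C)); [apply Cderiv_id|apply Cderiv_const].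
Qed.

Lemma two_PI_gt_0 : 0 < 2 * PI.
Proof. generalize PI_RGT_0. lra. Qed.

(** On the circle z = r e^(is) one has dz = i z ds, so integrating [f] times this kernel in [s]
    gives Cauchy's integral of f(z) / (z - w) dz, up to the factor i. *)
Definition cauchy_kernel (z w : C) : C := (z * / (z - w))%C.

Lemma Cderiv_cauchy_kernel (f : C -> C) (z w l : C) : z <> w -> Cderiv f z l ->
  exists l', Cderiv (fun x => (f x * cauchy_kernel x w)%C) z l'.
Proof.
intros Hzw Hf.
destruct (Cderiv_div_sub (fun x => (f x * x)%C) z w (l * z + f z * 1)%C Hzw) as [l' Hl'].
- apply (Cderiv_mult f (fun x => x)); [exact Hf|apply Cderiv_id].
- exists l'. apply Cderiv_ext with (3 := Hl') (1 := Rlt_0_1).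
  intros y _. unfold cauchy_kernel. ring.
Qed.

Lemma Rcont_cauchy_kernel (f : C -> C) (r s : R) (w : C) : Cmod w < r ->
  (forall z, Cmod z = r -> exists l, Cderiv f z l) ->
  Rcont (fun s => (f (r * cis s) * cauchy_kernel (r * cis s) w)%C) s.
Proof.
intros Hw Hf. assert (Hw0 := Cmod_ge_0 w).
apply (Rcont_on_circle (fun z => (f z * cauchy_kernel z w)%C)); [lra|].
intros z Hz. destruct (Hf z Hz) as [l Hl].
apply (Cderiv_cauchy_kernel f z w l); [|exact Hl].
intros ->. lra.
Qed.

(** Between the two circles f(z) / (z - w) is holomorphic, so [goursat] applies to the deformation
    of one into the other. The only singularity is avoided, not integrated over. *)
Lemma cauchy_shift (f : C -> C) (r rho : R) (w : C) : 0 < rho -> Cmod w + rho <= r ->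
  holomorphic_closed_disk f r ->
  CInt (fun s => (f (r * cis s) * cauchy_kernel (r * cis s) w)%C) 0 (2 * PI)
  = CInt (fun s => f (w + rho * cis s)%C) 0 (2 * PI).
Proof.
intros Hrho Hw Hf.
assert (Hw0 := Cmod_ge_0 w).
assert (HPI := two_PI_gt_0).
(* [g] deforms the circle of radius [rho] around [w] into the circle [|z| = r]. *)
set (g := fun t s => ((w + rho * cis s) + RtoC t * (r * cis s - (w + rho * cis s)))%C).
set (gt := fun (t s : R) => (r * cis s - (w + rho * cis s))%C).
set (gs := fun t s => (((1 - t) * rho + t * r)%R * (Ci * cis s))%C).
set (h := fun z => (f z * / (z - w))%C).
assert (Hgs : forall t s, g t s = (RtoC (1 - t) * w + ((1 - t) * rho + t * r)%R * cis s)%C).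
{ intros t s. unfold g. rewrite RtoC_plus, !RtoC_mult, RtoC_minus. ring. }
(* If [g t s] were [w], moduli would give (1 - t) rho + t r = t |w|, which r >= |w| + rho excludes.
   The same inequality keeps the curve in the closed disk. *)
assert (Hgw : forall t s, 0 <= t <= 1 -> Cmod (g t s) <= r /\ g t s <> w).
{ intros t s Ht.
  assert (Hpos : 0 <= (1 - t) * rho + t * r) by nra.
  split.
  - rewrite Hgs. eapply Rle_trans; [apply Cmod_triangle|].
    rewrite Cmod_circle, Cmod_mult, Cmod_R, Rabs_pos_eq by lra. nra.
  - intros E.
    assert (E1 : (((1 - t) * rho + t * r)%R * cis s)%C = (RtoC t * w)%C).
    { rewrite Hgs in E.
      replace (RtoC t * w)%C with (w - RtoC (1 - t) * w)%C by (rewrite RtoC_minus; ring).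
      rewrite <- E at 1. ring. }
    apply (f_equal Cmod) in E1.
    rewrite Cmod_circle, Cmod_mult, Cmod_R, Rabs_pos_eq in E1 by lra. nra. }
assert (G : boundary_integral (fun t s => (h (g t s) * gt t s)%C)
  (fun t s => (h (g t s) * gs t s)%C) 0 0 1 (2 * PI) = 0%C).
{ apply goursat with (L := 2 * r + Cmod w); [lra|lra|].
  intros t s Ht Hs. rewrite !Rplus_0_l in *.
  split; [|split; [|split; [|split; [|split; [|split]]]]].
  - apply Rderiv_line.
  - apply (Rderiv_ext (fun s => RtoC (1 - t) * w + ((1 - t) * rho + t * r)%R * cis s)%C).
    + intros x. now rewrite Hgs.
    + apply Rderiv_cis.
  - apply (Rcont_const (gt 0 s)).
  - unfold gs. apply Rcont_mult; [apply Rcont_const|]. apply Rcont_circle.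
  - unfold gt. eapply Rle_trans; [apply Cmod_triangle_minus|].
    eapply Rle_trans; [apply Rplus_le_compat_l, Cmod_triangle|].
    rewrite !Cmod_circle by lra. lra.
  - unfold gs. rewrite !Cmod_mult, Cmod_cis, Cmod_R.
    replace (Cmod Ci) with 1.
    + rewrite Rabs_pos_eq by nra. nra.
    + rewrite <- sqrt_1. unfold Cmod, Ci. f_equal. simpl. ring.
  - destruct (Hgw t s Ht) as [H1 H2]. destruct (Hf _ H1) as [l Hl].
    exact (Cderiv_div_sub f _ w l H2 Hl). }
unfold boundary_integral in G. rewrite !Rplus_0_l in G.
(* The edges s = 0 and s = 2 PI trace the same segment, so they cancel and only the two circles
   remain. *)
assert (EP : CInt (fun t => (h (g t (2 * PI)%R) * gt t (2 * PI)%R)%C) 0 1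
  = CInt (fun t => (h (g t 0%R) * gt t 0%R)%C) 0 1).
{ apply CInt_ext; [lra|]. intros t _. unfold g, gt, cis.
  now rewrite cos_2PI, sin_2PI, cos_0, sin_0. }
rewrite EP in G.
assert (Hk : Cont_on (fun s => (f (r * cis s) * cauchy_kernel (r * cis s) w)%C) 0 (2 * PI)).
{ intros s _. apply Rcont_cauchy_kernel; [lra|]. intros z Hz. apply Hf. lra. }
assert (Hk' : Cont_on (fun s => f (w + rho * cis s)%C) 0 (2 * PI)).
{ intros s _. destruct (Hf (w + rho * cis s)%C) as [l Hl].
  - eapply Rle_trans; [apply Cmod_triangle|]. rewrite Cmod_circle; lra.
  - apply (Rcont_comp f (fun s => (w + rho * cis s)%C) s l Hl), Rcont_cis. }
assert (E1 : CInt (fun s => (h (g 1%R s) * gs 1%R s)%C) 0 (2 * PI)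
  = (Ci * CInt (fun s => (f (r * cis s) * cauchy_kernel (r * cis s) w)%C) 0 (2 * PI))%C).
{ rewrite <- CInt_scal by (assumption || lra). apply CInt_ext; [lra|].
  intros s _. unfold h.
  replace (g 1%R s) with (r * cis s)%C by (unfold g; ring).
  unfold gs, cauchy_kernel. replace ((1 - 1) * rho + 1 * r) with r by ring. ring. }
(* On the small circle the denominator rho e^(is) cancels against the velocity, leaving i times the
   integral of [f] itself. *)
assert (E0 : CInt (fun s => (h (g 0%R s) * gs 0%R s)%C) 0 (2 * PI)
  = (Ci * CInt (fun s => f (w + rho * cis s)%C) 0 (2 * PI))%C).
{ rewrite <- CInt_scal by (assumption || lra). apply CInt_ext; [lra|].
  intros s _. unfold h.
  replace (g 0%R s) with (w + rho * cis s)%C by (unfold g; ring).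
  unfold gs. replace ((1 - 0) * rho + 0 * r) with rho by ring.
  replace (w + rho * cis s - w)%C with (rho * cis s)%C by ring.
  field. split; [apply cis_neq_0|intros E; apply RtoC_inj in E; lra]. }
rewrite E1, E0 in G.
assert (HCi : Ci <> 0%C) by (intros E; apply (f_equal snd) in E; simpl in E; lra).
match goal with |- ?x = ?y => assert (E : (Ci * (x - y))%C = 0%C) end.
{ rewrite <- G. ring. }
apply (f_equal (Cmult (/ Ci))) in E.
rewrite Cmult_assoc, Cinv_l, Cmult_1_l, Cmult_0_r in E by exact HCi.
match goal with |- ?x = ?y => replace x with (x - y + y)%C by ring end.
rewrite E. ring.
Qed.

(** By [cauchy_shift] the left side equals an integral over a circle around [w] of any small radius;
    continuity of [f] at [w] brings it arbitrarily close to 2 PI f(w). *)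
Lemma cauchy_formula (f : C -> C) (r : R) (w : C) : Cmod w < r ->
  holomorphic_closed_disk f r ->
  CInt (fun s => (f (r * cis s) * cauchy_kernel (r * cis s) w)%C) 0 (2 * PI)
  = (RtoC (2 * PI) * f w)%C.
Proof.
intros Hw Hf. assert (Hw0 := Cmod_ge_0 w). assert (HPI := two_PI_gt_0).
set (X := CInt _ _ _).
assert (H : forall e, 0 < e -> Cmod (X - RtoC (2 * PI) * f w) <= 2 * e * (2 * PI)).
{ intros e He. destruct (Hf w) as [l Hl]; [lra|].
  destruct (Cderiv_continuous _ _ _ Hl e He) as [d [Hd K]].
  set (rho := Rmin (d / 2) (r - Cmod w)).
  assert (Hrho : 0 < rho) by (apply Rmin_pos; lra).
  assert (Hr1 : rho <= d / 2) by apply Rmin_l.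
  assert (Hr2 : rho <= r - Cmod w) by apply Rmin_r.
  unfold X. rewrite (cauchy_shift f r rho w Hrho) by (assumption || lra).
  replace (RtoC (2 * PI) * f w)%C with (CInt (fun _ => f w) 0 (2 * PI)).
  2:{ rewrite CInt_const by lra. rewrite Rminus_0_r. ring. }
  assert (Hc : Cont_on (fun s => f (w + rho * cis s)%C) 0 (2 * PI)).
  { intros s _. destruct (Hf (w + rho * cis s)%C) as [l' Hl'].
    - eapply Rle_trans; [apply Cmod_triangle|]. rewrite Cmod_circle; lra.
    - apply (Rcont_comp f (fun s => (w + rho * cis s)%C) s l' Hl'), Rcont_cis. }
  rewrite <- CInt_minus; [|lra|exact Hc|intros s _; apply Rcont_const].
  rewrite <- (Rminus_0_r (2 * PI)) at 2.
  apply CInt_bound; [lra| |].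
  - intros s Hs. apply Rcont_plus; [apply Hc, Hs|]. apply Rcont_const.
  - intros s Hs. apply Rlt_le, K.
    replace (w + rho * cis s - w)%C with (rho * cis s)%C by ring.
    rewrite Cmod_circle; lra. }
assert (E : Cmod (X - RtoC (2 * PI) * f w) = 0).
{ apply Rle_antisym; [|apply Cmod_ge_0]. apply Rnot_lt_le. intros Hlt.
  set (c := Cmod (X - RtoC (2 * PI) * f w)) in *. specialize (H (c / (8 * PI))).
  assert (0 < c / (8 * PI)) by (apply Rdiv_lt_0_compat; lra).
  specialize (H ltac:(assumption)).
  replace (2 * (c / (8 * PI)) * (2 * PI)) with (c / 2) in H by (field; lra). lra. }
apply Cmod_eq_0 in E.
replace X with (X - RtoC (2 * PI) * f w + RtoC (2 * PI) * f w)%C by ring.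
rewrite E. ring.
Qed.

Lemma Cderiv_le_Lipschitz (f : C -> C) (z l : C) (d K : R) : 0 < d ->
  (forall y, Cmod (y - z) < d -> Cmod (f y - f z) <= K * Cmod (y - z)) ->
  Cderiv f z l -> Cmod l <= K.
Proof.
intros Hd HK Hf. rewrite Cderiv_iff in Hf.
apply Rnot_lt_le. intros Hlt.
destruct (Hf ((Cmod l - K) / 2)) as [d' [Hd' H]]; [lra|].
set (q := Rmin d d' / 2).
assert (Hm : 0 < Rmin d d') by (apply Rmin_pos; assumption).
assert (Hq1 : q < d) by (unfold q; generalize (Rmin_l d d'); lra).
assert (Hq2 : q < d') by (unfold q; generalize (Rmin_r d d'); lra).
assert (Hq : 0 < q) by (unfold q; lra).
specialize (HK (z + q)%C). specialize (H (z + q)%C).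
replace (z + q - z)%C with (RtoC q) in * by ring.
rewrite !Cmod_R, !Rabs_pos_eq in HK, H by lra.
specialize (HK Hq1). specialize (H Hq2).
assert (E := Cmod_triangle_inv (l * q) (f (z + q)%C - f z)).
rewrite (Cmod_minus_sym (l * q)), Cmod_mult, Cmod_R, Rabs_pos_eq in E by lra.
nra.
Qed.

Lemma Cmod_circle_sub (r s : R) (w : C) : 0 <= r -> r - Cmod w <= Cmod (r * cis s - w).
Proof.
intros Hr. rewrite <- (Cmod_circle r s Hr) at 1. apply Cmod_triangle_inv.
Qed.

Lemma Cmod_cauchy_kernel (r s : R) (w : C) : Cmod w < r ->
  Cmod (cauchy_kernel (r * cis s) w) <= r / (r - Cmod w).
Proof.
intros Hw. assert (Hw0 := Cmod_ge_0 w). unfold cauchy_kernel.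
assert (Hs := Cmod_circle_sub r s w ltac:(lra)).
rewrite Cmod_mult, Cmod_circle, Cmod_inv by (try apply Cmod_gt_0; lra).
unfold Rdiv. apply Rmult_le_compat_l; [lra|]. apply Rinv_le_contravar; lra.
Qed.

(** Cauchy's formula is not differentiated under the integral. Subtracting it at two points bounds
    the increments of [f] near [w], and a local Lipschitz constant bounds the derivative. With q = r
    - |w|, both denominators are at least q / 2, which gives 4; the other factor 2 is that of
    [CInt_bound]. *)
Lemma cauchy_estimate (f : C -> C) (r m : R) (w l : C) : Cmod w < r ->
  holomorphic_closed_disk f r -> (forall z, Cmod z = r -> Cmod (f z) <= m) ->
  Cderiv f w l -> Cmod l <= 8 * m * r / (r - Cmod w) ^ 2.
Proof.
intros Hw Hf Hm Hl. assert (Hw0 := Cmod_ge_0 w). assert (HPI := two_PI_gt_0).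
set (q := r - Cmod w). assert (Hq : 0 < q) by (unfold q; lra).
assert (Hfc : forall z, Cmod z = r -> exists l, Cderiv f z l) by (intros z Hz; apply Hf; lra).
apply Cderiv_le_Lipschitz with (d := q / 2) (3 := Hl); [lra|].
intros y Hy.
assert (Hyr : Cmod y < r - q / 2).
{ assert (E := Cmod_triangle (y - w) w). replace (y - w + w)%C with y in E by ring.
  unfold q in *. lra. }
assert (E : Cmod (RtoC (2 * PI) * f y - RtoC (2 * PI) * f w)
  <= 2 * (m * (4 * r / q ^ 2 * Cmod (y - w))) * (2 * PI - 0)).
{ rewrite <- !(cauchy_formula f r) by (assumption || lra).
  rewrite <- CInt_minus; [|lra|intros s _; apply Rcont_cauchy_kernel; (assumption || lra)
    |intros s _; apply Rcont_cauchy_kernel; (assumption || lra)].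
  apply CInt_bound; [lra| |].
  - intros s _. apply Rcont_plus; [|apply Rcont_opp];
      apply Rcont_cauchy_kernel; (assumption || lra).
  - intros s _.
    assert (D1 := Cmod_circle_sub r s y ltac:(lra)).
    assert (D2 := Cmod_circle_sub r s w ltac:(lra)).
    fold q in D2.
    assert (N1 : (r * cis s - y)%C <> 0%C) by (apply Cmod_gt_0; lra).
    assert (N2 : (r * cis s - w)%C <> 0%C) by (apply Cmod_gt_0; lra).
    unfold cauchy_kernel.
    set (z := (r * cis s)%C) in *.
    replace (f z * (z * / (z - y)) - f z * (z * / (z - w)))%C
      with (f z * (z * (y - w) * (/ (z - y) * / (z - w))))%C by (field; split; assumption).
    assert (Hz : Cmod z = r) by (apply Cmod_circle; lra).
    rewrite (Cmod_mult (f z)). apply Rmult_le_compat; [apply Cmod_ge_0|apply Cmod_ge_0|auto|].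
    rewrite !Cmod_mult, !Cmod_inv, Hz by assumption.
    replace (4 * r / q ^ 2 * Cmod (y - w)) with (r * Cmod (y - w) * (/ (q / 2) * / (q / 2)))
      by (field; lra).
    apply Rmult_le_compat_l.
    + apply Rmult_le_pos; [lra|apply Cmod_ge_0].
    + apply Rmult_le_compat; try (apply Rlt_le, Rinv_0_lt_compat; lra);
        apply Rinv_le_contravar; lra. }
replace (RtoC (2 * PI) * f y - RtoC (2 * PI) * f w)%C
  with (RtoC (2 * PI) * (f y - f w))%C in E by ring.
rewrite Cmod_mult, Cmod_R, Rabs_pos_eq in E by lra.
apply Rmult_le_reg_l with (2 * PI); [lra|].
apply Rle_trans with (1 := E). right. field. lra.
Qed.

Fixpoint Csum (a : nat -> C) (n : nat) : C :=
  match n with O => 0%C | S n => (Csum a n + a n)%C end.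

(** The coefficient as the integral of f(z) / z^(k+1) dz over 2 PI i, on the circle of radius [r].
    In this form linearity and boundedness in [f] are immediate. *)
Definition taylor_coef (r : R) (f : C -> C) (k : nat) : C :=
  (/ RtoC (2 * PI) * CInt (fun s => f (r * cis s) * (/ (r * cis s)) ^ k) 0 (2 * PI))%C.

Lemma Rcont_moment (f : C -> C) (r s : R) (k : nat) : 0 < r ->
  (forall z, Cmod z = r -> exists l, Cderiv f z l) ->
  Rcont (fun s => (f (r * cis s) * (/ (r * cis s)) ^ k)%C) s.
Proof.
intros Hr Hf.
apply (Rcont_on_circle (fun z => (f z * (/ z) ^ k)%C)); [lra|].
intros z Hz. destruct (Hf z Hz) as [l Hl]. eexists.
apply Cderiv_mult; [exact Hl|].
apply (Cderiv_comp (fun x => (x ^ k)%C) Cinv); [apply Cderiv_pow|].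
apply Cderiv_inv. apply Cmod_gt_0. lra.
Qed.

(* Expand the kernel [z / (z - w)] as a finite geometric series in [w / z]. *)
Lemma taylor_remainder (f : C -> C) (r m : R) (w : C) (N : nat) : Cmod w < r ->
  holomorphic_closed_disk f r -> (forall z, Cmod z = r -> Cmod (f z) <= m) ->
  Cmod (f w - Csum (fun k => taylor_coef r f k * w ^ k)%C N)
    <= 2 * m * (Cmod w / r) ^ N * (r / (r - Cmod w)).
Proof.
intros Hw Hf Hm. assert (Hw0 := Cmod_ge_0 w). assert (HPI := two_PI_gt_0).
assert (Hfc : forall z, Cmod z = r -> exists l, Cderiv f z l) by (intros z Hz; apply Hf; lra).
set (T := fun N s => (f (r * cis s) * (/ (r * cis s)) ^ N *
  cauchy_kernel (r * cis s) w)%C).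
assert (HT : forall N, Cont_on (T N) 0 (2 * PI)).
{ intros k s _.
  apply (Rcont_cauchy_kernel (fun z => f z * (/ z) ^ k)%C); [exact Hw|].
  intros z Hz. destruct (Hfc z Hz) as [l Hl]. eexists.
  apply Cderiv_mult; [exact Hl|].
  apply (Cderiv_comp (fun x => (x ^ k)%C) Cinv); [apply Cderiv_pow|].
  apply Cderiv_inv. apply Cmod_gt_0. lra. }
assert (H2 : RtoC (2 * PI) <> 0%C) by (intros E; apply RtoC_inj in E; lra).
(* With z on the circle, z / (z - w) = 1 + (w / z) (z / (z - w)): each use splits off one Taylor
   coefficient and replaces [T N] by w times [T (S N)]. *)
assert (E : forall N, (RtoC (2 * PI) * (f w - Csum (fun k => taylor_coef r f k * w ^ k) N))%C
  = (w ^ N * CInt (T N) 0 (2 * PI))%C).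
{ clear N. induction N as [|N IH].
  - simpl. replace (RtoC (2 * PI) * (f w - 0))%C with (RtoC (2 * PI) * f w)%C by ring.
    rewrite <- (cauchy_formula f r w Hw Hf), Cmult_1_l. apply CInt_ext; [lra|].
    intros s _. unfold T. simpl. ring.
  - simpl Csum.
    replace (RtoC (2 * PI) * (f w - (Csum (fun k => taylor_coef r f k * w ^ k) N
        + taylor_coef r f N * w ^ N)))%C
      with (RtoC (2 * PI) * (f w - Csum (fun k => taylor_coef r f k * w ^ k) N)
        - RtoC (2 * PI) * taylor_coef r f N * w ^ N)%C by ring.
    rewrite IH. unfold taylor_coef.
    replace (CInt (T N) 0 (2 * PI)) with
      (CInt (fun s => f (r * cis s) * (/ (r * cis s)) ^ N) 0 (2 * PI)
       + w * CInt (T (S N)) 0 (2 * PI))%C.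
    + rewrite Cpow_S. field. exact H2.
    + rewrite <- CInt_scal by (apply HT || lra).
      rewrite <- CInt_plus; [|lra|intros s _; apply Rcont_moment; (assumption || lra)
        |intros s Hs; apply Rcont_mult; [apply Rcont_const|apply HT, Hs]].
      apply CInt_ext; [lra|]. intros s _. unfold T, cauchy_kernel. rewrite Cpow_S.
      assert (N1 := Cmod_circle_sub r s w ltac:(lra)).
      assert (N2 := Cmod_circle r s ltac:(lra)).
      field. split; [apply Cmod_gt_0; lra|].
      split; [apply cis_neq_0|intros E; apply RtoC_inj in E; lra]. }
specialize (E N). apply (f_equal Cmod) in E.
rewrite !Cmod_mult, Cmod_R, Rabs_pos_eq, Cmod_pow in E by lra.
apply Rmult_le_reg_l with (2 * PI); [lra|]. rewrite E.
assert (B : Cmod (CInt (T N) 0 (2 * PI)) <=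
  2 * (m * (/ r) ^ N * (r / (r - Cmod w))) * (2 * PI - 0)).
{ apply CInt_bound; [lra|apply HT|]. intros s _. unfold T.
  assert (N2 := Cmod_circle r s ltac:(lra)).
  rewrite !Cmod_mult, Cmod_pow, Cmod_inv, N2 by (apply Cmod_gt_0; lra).
  apply Rmult_le_compat; [| |apply Rmult_le_compat_r|apply Cmod_cauchy_kernel; exact Hw].
  - apply Rmult_le_pos; [apply Cmod_ge_0|apply pow_le, Rlt_le, Rinv_0_lt_compat; lra].
  - apply Cmod_ge_0.
  - apply pow_le, Rlt_le, Rinv_0_lt_compat; lra.
  - auto. }
apply Rle_trans with (Cmod w ^ N * (2 * (m * (/ r) ^ N * (r / (r - Cmod w))) * (2 * PI - 0))).
- apply Rmult_le_compat_l; [apply pow_le, Hw0|exact B].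
- right. unfold Rdiv at 2. rewrite Rpow_mult_distr. ring.
Qed.

(** * The test functions *)

Lemma Cmod_Cexp (z : C) : Cmod (Cexp z) = exp (Re z).
Proof.
unfold Cexp. rewrite Cmod_mult, Cmod_R, Rabs_pos_eq by (left; apply exp_pos).
change (cos (Im z), sin (Im z)) with (cis (Im z)). rewrite Cmod_cis. ring.
Qed.

Lemma Cexp_plus (z w : C) : Cexp (z + w) = (Cexp z * Cexp w)%C.
Proof.
destruct z as [a b], w as [c d]. unfold Cexp, Re, Im. simpl.
rewrite exp_plus, cos_plus, sin_plus.
apply injective_projections; simpl; ring.
Qed.

Lemma Cexp_0 : Cexp 0 = 1%C.
Proof.
unfold Cexp, Re, Im. simpl. rewrite exp_0, cos_0, sin_0.
apply injective_projections; simpl; ring.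
Qed.

Lemma Rderiv_Cexp_line (h : C) (t : R) :
  Rderiv (fun t => Cexp (RtoC t * h)) t (h * Cexp (RtoC t * h))%C.
Proof.
destruct h as [a b].
unfold Rderiv, Cexp, Re, Im. simpl. split; auto_derive; trivial; unfold Rminus; ring.
Qed.

(** Two mean value bounds along the segment from 0 to h. First |exp| <= 3 there gives |exp(th) - 1|
    <= 6 |h|; this bounds the derivative of exp(th) - th, and the factor 2 of [Rderiv_bound] leads
    to 12. *)
Lemma Cexp_first_order (h : C) : Cmod h <= 1 ->
  Cmod (Cexp h - 1 - h) <= 12 * Cmod h ^ 2.
Proof.
intros Hh. assert (Hh0 := Cmod_ge_0 h).
assert (B : forall t, 0 <= t <= 1 -> Cmod (Cexp (RtoC t * h)) <= 3).
{ intros t Ht. rewrite Cmod_Cexp. apply Rle_trans with (exp 1); [|apply exp_le_3].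
  assert (E : Re (RtoC t * h) <= 1).
  { apply Rle_trans with (1 := Rle_abs _). apply Rle_trans with (1 := Cmod_Re _).
    rewrite Cmod_mult, Cmod_R, Rabs_pos_eq by lra. nra. }
  destruct E as [E|E]; [left; now apply exp_increasing|rewrite E; lra]. }
assert (B1 : forall t, 0 <= t <= 1 -> Cmod (Cexp (RtoC t * h) - 1) <= 6 * Cmod h).
{ intros t Ht.
  assert (E := Rderiv_bound (fun t => Cexp (RtoC t * h)) _ 0 t (Cmod h * 3) (proj1 Ht)
    (fun t _ => Rderiv_Cexp_line h t)).
  cbv beta in E. rewrite Cmult_0_l, Cexp_0 in E.
  eapply Rle_trans; [apply E|nra].
  intros s Hs. rewrite Cmod_mult. apply Rmult_le_compat_l; [exact Hh0|apply B; lra]. }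
assert (D : forall t, 0 <= t <= 1 ->
  Rderiv (fun t => (Cexp (RtoC t * h) + (0 + RtoC t * (- h)))%C) t
    (h * (Cexp (RtoC t * h) - 1))%C).
{ intros t _. replace (h * (Cexp (RtoC t * h) - 1))%C with (h * Cexp (RtoC t * h) + (- h))%C by ring.
  assert (D1 := Rderiv_Cexp_line h t). assert (D2 := Rderiv_line 0 (- h)%C t).
  destruct D1 as [D1 D1'], D2 as [D2 D2']. split.
  - exact (is_derive_plus (K := R_AbsRing) (V := R_NormedModule) _ _ t _ _ D1 D2).
  - exact (is_derive_plus (K := R_AbsRing) (V := R_NormedModule) _ _ t _ _ D1' D2'). }
assert (E := Rderiv_bound _ _ 0 1 (Cmod h * (6 * Cmod h)) Rle_0_1 D).
cbv beta in E. rewrite !Cmult_1_l, !Cmult_0_l, Cexp_0 in E.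
replace (Cexp h - 1 - h)%C with (Cexp h + (0 + - h) - (1 + (0 + 0)))%C by ring.
eapply Rle_trans; [apply E|right; ring].
intros t Ht. rewrite Cmod_mult. apply Rmult_le_compat_l; [exact Hh0|auto].
Qed.

Lemma Cderiv_Cexp (z : C) : Cderiv Cexp z (Cexp z).
Proof.
apply Cderiv_iff. intros e He.
assert (H0 : 0 < Cmod (Cexp z)) by (rewrite Cmod_Cexp; apply exp_pos).
set (m := Cmod (Cexp z)) in *.
assert (Hp : 0 < e / (12 * m)) by (apply Rdiv_lt_0_compat; lra).
exists (Rmin 1 (e / (12 * m))). split; [apply Rmin_pos; lra|].
intros y Hy.
assert (H1 := Rlt_le_trans _ _ _ Hy (Rmin_l _ _)).
assert (H2 := Rlt_le_trans _ _ _ Hy (Rmin_r _ _)).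
replace y with (z + (y - z))%C at 1 by ring. rewrite Cexp_plus.
replace (Cexp z * Cexp (y - z) - Cexp z - Cexp z * (y - z))%C
  with (Cexp z * (Cexp (y - z) - 1 - (y - z)))%C by ring.
rewrite Cmod_mult. fold m.
assert (E := Cexp_first_order (y - z) (Rlt_le _ _ H1)).
set (q := Cmod (y - z)) in *. assert (Hq : 0 <= q) by apply Cmod_ge_0.
apply Rle_trans with (m * (12 * q ^ 2)); [apply Rmult_le_compat_l; lra|].
apply Rmult_lt_compat_l with (r := 12 * m) in H2; [|lra].
replace (12 * m * (e / (12 * m))) with e in H2 by (field; lra). nra.
Qed.

Lemma Re_pos_neq_0 (z : C) : 0 < Re z -> z <> 0%C.
Proof. intros H E. rewrite E in H. simpl in H. lra. Qed.

(** The right half-plane, where [Carg] is an arctangent, is enough: [1 - Cconj a * z] has positive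
    real part for [a] and [z] in the disk. *)
Lemma Cexp_Clog (z : C) : 0 < Re z -> Cexp (Clog z) = z.
Proof.
intros Hz. assert (Hm : 0 < Cmod z) by now apply Cmod_gt_0, Re_pos_neq_0.
unfold Cexp, Clog, Carg. simpl. destruct (Rlt_dec 0 (Re z)) as [_|]; [|lra].
rewrite exp_ln, cos_atan, sin_atan by exact Hm.
assert (E : sqrt (1 + (Im z / Re z)²) = Cmod z / Re z).
{ rewrite <- (sqrt_pow2 (Cmod z / Re z)) by (left; now apply Rdiv_lt_0_compat).
  f_equal. unfold Rdiv at 2. rewrite Rpow_mult_distr. unfold Cmod.
  rewrite pow2_sqrt by (generalize (pow2_ge_0 (fst z)) (pow2_ge_0 (snd z)); lra).
  unfold Rsqr, Re, Im in *. field. lra. }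
rewrite E. apply injective_projections; unfold Re, Im in *; simpl; field; lra.
Qed.

(** The balls of [C_UniformSpace] are squares, those of the modulus are discs; the disc lies in the
    square of the same size. *)
Lemma continuous_C_eps (p : C -> R) (z : C) :
  continuous (T := C_UniformSpace) (U := R_UniformSpace) p z ->
  forall e, 0 < e -> exists d, 0 < d /\ forall y, Cmod (y - z) < d -> Rabs (p y - p z) < e.
Proof.
intros H e He.
destruct (proj1 (filterlim_locally (U := R_UniformSpace) p (p z)) H (mkposreal e He)) as [d Hd].
exists d. split; [apply cond_pos|]. intros y Hy.
apply Hd. now apply C_NormedModule_mixin_compat1.
Qed.

Lemma Clog_continuous (z : C) : 0 < Re z ->
  forall e, 0 < e -> exists d, 0 < d /\ forall y, Cmod (y - z) < d ->
    0 < Re y /\ Cmod (Clog y - Clog z) < e.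
Proof.
intros Hz e He.
assert (Hm : 0 < Cmod z) by now apply Cmod_gt_0, Re_pos_neq_0.
destruct (continuous_C_eps (fun y => ln (Cmod y)) z) with (e := e / 2) as [d1 [Hd1 K1]].
{ apply (continuous_comp (U := C_UniformSpace) (V := R_UniformSpace) (W := R_UniformSpace)
    Cmod ln).
  - apply (filterlim_norm (K := C_AbsRing) (V := C_NormedModule)).
  - apply (ex_derive_continuous (K := R_AbsRing) (V := R_NormedModule)).
    auto_derive. exact Hm. }
{ lra. }
destruct (continuous_C_eps (fun y => atan (Im y * / Re y)) z) with (e := e / 2)
  as [d2 [Hd2 K2]].
{ apply (continuous_comp (U := C_UniformSpace) (V := R_UniformSpace) (W := R_UniformSpace)
    (fun y : C => Im y * / Re y) atan).
  - apply (continuous_mult (U := C_UniformSpace) (K := R_AbsRing)).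
    + apply (continuous_snd (U := R_UniformSpace) (V := R_UniformSpace)).
    + apply (continuous_comp (U := C_UniformSpace) (V := R_UniformSpace) (W := R_UniformSpace)
        Re Rinv).
      * apply (continuous_fst (U := R_UniformSpace) (V := R_UniformSpace)).
      * apply (ex_derive_continuous (K := R_AbsRing) (V := R_NormedModule)).
        auto_derive. apply Rgt_not_eq. exact Hz.
  - apply (ex_derive_continuous (K := R_AbsRing) (V := R_NormedModule)).
    auto_derive. trivial. }
{ lra. }
exists (Rmin (Re z) (Rmin d1 d2)).
split; [repeat apply Rmin_pos; assumption|]. intros y Hy.
assert (Hy1 := Rlt_le_trans _ _ _ Hy (Rmin_l _ _)).
assert (Hy' := Rlt_le_trans _ _ _ Hy (Rmin_r _ _)).
assert (Hy2 := Rlt_le_trans _ _ _ Hy' (Rmin_l _ _)).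
assert (Hy3 := Rlt_le_trans _ _ _ Hy' (Rmin_r _ _)).
assert (HRe : 0 < Re y).
{ assert (E := Rle_lt_trans _ _ _ (Cmod_Re (y - z)) Hy1).
  change (Re (y - z)) with (Re y - Re z) in E. apply Rabs_def2 in E. lra. }
split; [exact HRe|].
eapply Rle_lt_trans; [apply Cmod_le_Re_Im|].
unfold Clog, Carg. destruct (Rlt_dec 0 (Re y)) as [_|]; [|lra].
destruct (Rlt_dec 0 (Re z)) as [_|]; [|lra].
specialize (K1 y Hy2). specialize (K2 y Hy3).
unfold Rdiv at 1 2. simpl Re. simpl Im.
unfold Rminus in K1, K2. lra.
Qed.

(** Differentiation of an inverse: [Clog] is continuous, [Cexp] undoes it near [z], and the
    derivative of [Cexp] at [Clog z] is z, which is not 0. *)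
Lemma Cderiv_Clog (z : C) : 0 < Re z -> Cderiv Clog z (/ z)%C.
Proof.
intros Hz. assert (Hz0 := Re_pos_neq_0 z Hz).
assert (Hm : 0 < Cmod z) by now apply Cmod_gt_0.
apply Cderiv_iff. intros e He.
(* With u the increment of [Clog], the first bound yields |u| |z| <= 2 |y - z|; the second then
   brings the error e1 |u| / |z| below e |y - z|. *)
set (e1 := Rmin (Cmod z / 2) (e * Cmod z ^ 2 / 2)).
assert (Hm2 : 0 < Cmod z ^ 2) by now apply pow_lt.
assert (He1 : 0 < e1).
{ apply Rmin_pos; [lra|]. apply Rdiv_lt_0_compat; [|lra]. now apply Rmult_lt_0_compat. }
assert (D := Cderiv_Cexp (Clog z)). rewrite Cderiv_iff in D.
destruct (D e1 He1) as [d [Hd K]].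
destruct (Clog_continuous z Hz d Hd) as [d' [Hd' K']].
exists d'. split; [exact Hd'|]. intros y Hy.
destruct (K' y Hy) as [Hy1 Hy2]. specialize (K _ Hy2).
rewrite !Cexp_Clog in K by assumption.
set (u := (Clog y - Clog z)%C) in *.
assert (E : (u - / z * (y - z))%C = (- (y - z - z * u) * / z)%C) by (field; exact Hz0).
rewrite E, Cmod_mult, Cmod_opp, Cmod_inv by exact Hz0.
assert (F : Cmod u * Cmod z <= Cmod (y - z) + e1 * Cmod u).
{ rewrite Rmult_comm, <- Cmod_mult.
  replace (z * u)%C with ((y - z) - (y - z - z * u))%C by ring.
  eapply Rle_trans; [apply Cmod_triangle_minus|]. lra. }
assert (F1 : e1 <= Cmod z / 2) by apply Rmin_l.
assert (F2 : e1 <= e * Cmod z ^ 2 / 2) by apply Rmin_r.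
assert (Hu := Cmod_ge_0 u).
assert (F3 : Cmod u * Cmod z <= 2 * Cmod (y - z)) by nra.
apply Rmult_le_reg_r with (Cmod z); [exact Hm|].
rewrite Rmult_assoc, Rinv_l, Rmult_1_r by lra.
apply Rle_trans with (1 := K).
apply Rmult_le_reg_r with (Cmod z); [exact Hm|].
rewrite Rmult_assoc.
apply Rle_trans with (e1 * (2 * Cmod (y - z))); [apply Rmult_le_compat_l; lra|].
assert (Hq := Cmod_ge_0 (y - z)). nra.
Qed.

Lemma Cderiv_Cpower (z : C) (s : R) : 0 < Re z ->
  Cderiv (fun z => Cpower z s) z (Cpower z s * (s * / z))%C.
Proof.
intros Hz. apply (Cderiv_comp Cexp (fun z => (s * Clog z)%C)).
- apply Cderiv_Cexp.
- replace (s * / z)%C with (0 * Clog z + s * / z)%C by ring.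
  apply (Cderiv_mult (fun _ => RtoC s) Clog); [apply Cderiv_const|now apply Cderiv_Clog].
Qed.

Lemma Cmod_Cpower (z : C) (s : R) : Cmod (Cpower z s) = Rpower (Cmod z) s.
Proof.
unfold Cpower. rewrite Cmod_Cexp. unfold Rpower, Clog, Re. simpl. f_equal. ring.
Qed.

Lemma Cpower_1 (s : R) : Cpower 1 s = 1%C.
Proof.
unfold Cpower, Clog, Carg. rewrite Cmod_1, ln_1. simpl.
destruct (Rlt_dec 0 1) as [_|]; [|lra].
rewrite Rdiv_0_l, atan_0. replace (s * (0, 0))%C with (RtoC 0).
- apply Cexp_0.
- apply injective_projections; simpl; ring.
Qed.

Definition sigma_derive (alpha : R) (a z : C) : C :=
  ((1 - Cmod a)%R * (Cpower (1 - Cconj a * z) (- alpha) *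
    (RtoC (- alpha) * / (1 - Cconj a * z)) * - Cconj a))%C.

Lemma Re_1_sub_conj_pos (a z : C) : Cmod a < 1 -> Cmod z < 1 -> 0 < Re (1 - Cconj a * z).
Proof.
intros Ha Hz. change (Re (1 - Cconj a * z)) with (1 - Re (Cconj a * z)).
assert (E := Cmod_Re (Cconj a * z)). rewrite Cmod_mult, Cmod_conj in E.
generalize (Rle_abs (Re (Cconj a * z))) (Cmod_ge_0 a) (Cmod_ge_0 z). nra.
Qed.

Lemma Cmod_1_sub_conj (a z : C) : Cmod a < 1 -> Cmod z < 1 ->
  1 - Cmod a <= Cmod (1 - Cconj a * z) /\ 1 - Cmod z <= Cmod (1 - Cconj a * z).
Proof.
intros Ha Hz. assert (E := Cmod_triangle_inv 1 (Cconj a * z)).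
rewrite Cmod_1, Cmod_mult, Cmod_conj in E.
generalize (Cmod_ge_0 a) (Cmod_ge_0 z). nra.
Qed.

Lemma Cderiv_sigma (alpha : R) (a z : C) : Cmod a < 1 -> Cmod z < 1 ->
  Cderiv (sigma_fun alpha a) z (sigma_derive alpha a z).
Proof.
intros Ha Hz. unfold sigma_fun, sigma_derive.
set (D := (Cpower (1 - Cconj a * z) (- alpha) *
    (RtoC (- alpha) * / (1 - Cconj a * z)) * - Cconj a)%C).
replace ((1 - Cmod a)%R * D)%C with
  (0 * (Cpower (1 - Cconj a * z) (- alpha) - 1) + (1 - Cmod a)%R * (D + 0))%C by ring.
apply (Cderiv_mult (fun _ => RtoC (1 - Cmod a))
  (fun z => Cpower (1 - Cconj a * z) (- alpha) - 1)%C); [apply Cderiv_const|].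
apply (Cderiv_plus (fun z => Cpower (1 - Cconj a * z) (- alpha)) (fun _ => (- (1))%C));
  [|apply Cderiv_const].
apply (Cderiv_comp (fun z => Cpower z (- alpha)) (fun z => 1 - Cconj a * z)%C).
- apply Cderiv_Cpower. now apply Re_1_sub_conj_pos.
- replace (- Cconj a)%C with (0 + (0 * z + - Cconj a * 1))%C by ring.
  apply Cderiv_ext with (1 := Rlt_0_1) (f := (fun z => 1 + - Cconj a * z)%C);
    [intros; ring|].
  apply (Cderiv_plus (fun _ => RtoC 1) (fun z => - Cconj a * z)%C); [apply Cderiv_const|].
  apply (Cderiv_mult (fun _ => (- Cconj a)%C) (fun z => z)); [apply Cderiv_const|apply Cderiv_id].
Qed.

Lemma sigma_fun_0 (alpha : R) (a : C) : sigma_fun alpha a 0 = 0%C.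
Proof.
unfold sigma_fun. replace (1 - Cconj a * 0)%C with (RtoC 1) by ring.
rewrite Cpower_1. ring.
Qed.

Lemma Cmod_sigma_derive (alpha : R) (a z : C) : 0 < alpha -> Cmod a < 1 -> Cmod z < 1 ->
  Cmod (sigma_derive alpha a z) = (1 - Cmod a) * alpha * Cmod a *
    Rpower (Cmod (1 - Cconj a * z)) (- alpha) / Cmod (1 - Cconj a * z).
Proof.
intros Hal Ha Hz. unfold sigma_derive.
rewrite !Cmod_mult, Cmod_opp, Cmod_conj, Cmod_inv, Cmod_Cpower, !Cmod_R
  by now apply Re_pos_neq_0, Re_1_sub_conj_pos.
rewrite Rabs_Ropp, !Rabs_pos_eq by lra. unfold Rdiv. ring.
Qed.

(** * Summing the derivatives of test functions along sparse sequences *)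

Fixpoint Rsum (u : nat -> R) (n : nat) : R :=
  match n with O => 0 | S n => Rsum u n + u n end.

(** Cut to 0, not to 1, above 1: along a geometric sequence the large terms then contribute nothing
    and the sum stays bounded for every length. *)
Definition cap1 (x : R) : R := if Rle_dec x 1 then x else 0.

(** A counted term has s N <= 1, so adding it to a sum that is at most s N gives at most 2 s N,
    hence at most both 2 and s (S N). Terms above 1 leave the sum unchanged. *)
Lemma doubling_sum (s : nat -> R) (N : nat) : (forall n, 0 <= s n) ->
  (forall n, 2 * s n <= s (S n)) -> Rsum (fun n => cap1 (s n)) N <= Rmin 2 (s N).
Proof.
intros H0 H. induction N as [|N IH]; simpl.
- apply Rmin_glb; [lra|apply H0].
- specialize (H N). specialize (H0 N).
  assert (I1 := Rle_trans _ _ _ IH (Rmin_l _ _)).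
  assert (I2 := Rle_trans _ _ _ IH (Rmin_r _ _)).
  unfold cap1 at 2. destruct (Rle_dec (s N) 1); apply Rmin_glb; lra.
Qed.

(** The second summand reserves room for the terms still to come, at most 2 s N in total. Without it
    the induction would not close. *)
Lemma halving_sum (s : nat -> R) (N : nat) : (forall n, 0 <= s n) ->
  (forall n, 2 * s (S n) <= s n) ->
  Rsum (fun n => cap1 (s n)) N + Rmin 2 (2 * s N) <= 2.
Proof.
intros H0 H. induction N as [|N IH]; simpl.
- generalize (Rmin_l 2 (2 * s O)). lra.
- specialize (H N). specialize (H0 (S N)).
  unfold cap1 at 2. destruct (Rle_dec (s N) 1) as [Hs|Hs].
  + rewrite (Rmin_right 2 (2 * s N)) in IH by lra.
    generalize (Rmin_r 2 (2 * s (S N))). lra.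
  + rewrite (Rmin_left 2 (2 * s N)) in IH by lra.
    generalize (Rmin_l 2 (2 * s (S N))). lra.
Qed.

Lemma Rpower_pos (x s : R) : 0 < Rpower x s.
Proof. apply exp_pos. Qed.

(** Let x = 1 - |a|, y = 1 - |z| and D = |1 - conj(a) z|, which is at least x and y. The left side
    is at most alpha 2^alpha (x / D) (y / D)^alpha, the power of 2 coming from 1 - |z|^2 <= 2 y.
    Taking D = y if x <= y and D = x otherwise leaves one of the two capped terms, and the other is
    nonnegative. So the derivative is sizeable only where x and y are comparable. *)
Lemma sigma_term_bound (alpha : R) (a z : C) : 0 < alpha -> Cmod a < 1 -> Cmod z < 1 ->
  standard_weight_fun alpha z * Cmod (sigma_derive alpha a z) <=
  alpha * Rpower 2 alpha *
    (cap1 ((1 - Cmod a) / (1 - Cmod z))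
     + cap1 (Rpower ((1 - Cmod z) / (1 - Cmod a)) alpha)).
Proof.
intros Hal Ha Hz. rewrite Cmod_sigma_derive by assumption.
assert (Ha0 := Cmod_ge_0 a). assert (Hz0 := Cmod_ge_0 z).
destruct (Cmod_1_sub_conj a z Ha Hz) as [D1 D2].
set (D := Cmod (1 - Cconj a * z)) in *.
unfold standard_weight_fun.
set (x := 1 - Cmod a) in *. set (y := 1 - Cmod z) in *.
assert (Hx : 0 < x) by (unfold x; lra). assert (Hy : 0 < y) by (unfold y; lra).
assert (HD : 0 < D) by lra.
assert (Hv : Rpower (1 - Cmod z ^ 2) alpha <= Rpower (2 * y) alpha).
{ apply Rle_Rpower_l; [lra|]. unfold y. split; nra. }
rewrite <- Rpower_mult_distr in Hv by lra.
assert (P2 := Rpower_pos 2 alpha). assert (Py := Rpower_pos y alpha).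
assert (PD := Rpower_pos D (- alpha)).
assert (HE : Rpower y alpha * Rpower D (- alpha) = Rpower (y / D) alpha).
{ unfold Rdiv. rewrite <- Rpower_mult_distr by (try apply Rinv_0_lt_compat; assumption).
  f_equal. rewrite Rpower_Ropp. unfold Rpower. rewrite ln_Rinv, <- exp_Ropp by assumption.
  f_equal. ring. }
apply Rle_trans with (alpha * Rpower 2 alpha * (x / D * Rpower (y / D) alpha)).
- rewrite <- HE.
  apply Rle_trans with (Rpower 2 alpha * Rpower y alpha *
    (x * alpha * 1 * Rpower D (- alpha) / D)).
  + apply Rmult_le_compat; [left; apply Rpower_pos| |exact Hv|].
    * apply Rmult_le_pos; [|left; now apply Rinv_0_lt_compat].
      repeat apply Rmult_le_pos; lra.
    * unfold Rdiv. apply Rmult_le_compat_r; [left; now apply Rinv_0_lt_compat|].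
      apply Rmult_le_compat_r; [lra|]. apply Rmult_le_compat_l; [|lra].
      apply Rmult_le_pos; lra.
  + right. field. lra.
- apply Rmult_le_compat_l; [apply Rmult_le_pos; lra|].
  assert (HD0 : 0 < / D) by now apply Rinv_0_lt_compat.
  assert (C0 : forall t, 0 <= t -> 0 <= cap1 t).
  { intros t Ht. unfold cap1. destruct Rle_dec; lra. }
  assert (Q1 : 0 < x / D) by now apply Rdiv_lt_0_compat.
  assert (Q2 : 0 < y / D) by now apply Rdiv_lt_0_compat.
  assert (L1 : forall t, 0 < t -> t <= D -> t / D <= 1).
  { intros t Ht1 Ht2. apply Rmult_le_reg_r with D; [exact HD|].
    unfold Rdiv. rewrite Rmult_assoc, Rinv_l; lra. }
  assert (One : forall t, 0 < t <= 1 -> Rpower t alpha <= 1).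
  { intros t Ht. replace 1 with (Rpower 1 alpha).
    - apply Rle_Rpower_l; lra.
    - unfold Rpower. now rewrite ln_1, Rmult_0_r, exp_0. }
  assert (P := Rpower_pos (y / D) alpha).
  assert (Pyx := Rpower_pos (y / x) alpha).
  destruct (Rle_dec x y) as [Hxy|Hxy].
  + apply Rle_trans with (x / y).
    * apply Rle_trans with (x / D * 1).
      -- apply Rmult_le_compat_l; [lra|]. apply One. split; [exact Q2|auto].
      -- rewrite Rmult_1_r. unfold Rdiv. apply Rmult_le_compat_l; [lra|].
         now apply Rinv_le_contravar.
    * assert (x / y <= 1).
      { apply Rmult_le_reg_r with y; [exact Hy|]. unfold Rdiv.
        rewrite Rmult_assoc, Rinv_l; lra. }
      unfold cap1 at 1. destruct Rle_dec; [|lra].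
      generalize (C0 (Rpower (y / x) alpha)). lra.
  + assert (Hyx : 0 < y / x) by now apply Rdiv_lt_0_compat.
    assert (Hyx1 : y / x <= 1).
    { apply Rmult_le_reg_r with x; [exact Hx|]. unfold Rdiv.
      rewrite Rmult_assoc, Rinv_l; lra. }
    apply Rle_trans with (Rpower (y / x) alpha).
    * apply Rle_trans with (1 * Rpower (y / D) alpha).
      -- apply Rmult_le_compat_r; [lra|auto].
      -- rewrite Rmult_1_l. apply Rle_Rpower_l; [lra|]. split; [exact Q2|].
         unfold Rdiv. apply Rmult_le_compat_l; [lra|]. apply Rinv_le_contravar; lra.
    * specialize (One _ (conj Hyx Hyx1)).
      unfold cap1 at 2. destruct Rle_dec; [|lra].
      generalize (C0 (x / y)).
      assert (0 < x / y) by now apply Rdiv_lt_0_compat. lra.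
Qed.

Lemma sigma_norm_bound (alpha : R) (a z : C) : 0 < alpha -> Cmod a < 1 -> Cmod z < 1 ->
  standard_weight_fun alpha z * Cmod (sigma_derive alpha a z) <=
  2 * (alpha * Rpower 2 alpha).
Proof.
intros Hal Ha Hz.
eapply Rle_trans; [now apply sigma_term_bound|].
assert (H : forall t, cap1 t <= 1) by (intros t; unfold cap1; destruct Rle_dec; lra).
assert (P2 := Rpower_pos 2 alpha).
assert (0 < alpha * Rpower 2 alpha) by now apply Rmult_lt_0_compat.
assert (H1 := H ((1 - Cmod a) / (1 - Cmod z))).
assert (H2 := H (Rpower ((1 - Cmod z) / (1 - Cmod a)) alpha)).
nra.
Qed.

Lemma Rsum_plus (u v : nat -> R) (N : nat) :
  Rsum (fun n => u n + v n) N = Rsum u N + Rsum v N.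
Proof. induction N as [|N IH]; simpl; [|rewrite IH]; ring. Qed.

Lemma Rsum_scal (c : R) (u : nat -> R) (N : nat) : Rsum (fun n => c * u n) N = c * Rsum u N.
Proof. induction N as [|N IH]; simpl; [|rewrite IH]; ring. Qed.

Lemma Rsum_le (u v : nat -> R) (N : nat) : (forall n, u n <= v n) -> Rsum u N <= Rsum v N.
Proof.
intros H. induction N as [|N IH]; simpl; [lra|]. generalize (H N). lra.
Qed.

(** At a fixed [z] the first ratio of [sigma_term_bound] at least halves from one index to the next
    and the second at least doubles, since kappa >= 2 and kappa^alpha >= 2. Each capped sum is at
    most 2. *)
Lemma sigma_sum_bound (alpha kappa : R) (a : nat -> C) (z : C) (N : nat) : 0 < alpha ->
  2 <= kappa -> 2 <= Rpower kappa alpha -> (forall n, Cmod (a n) < 1) ->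
  (forall n, kappa * (1 - Cmod (a (S n))) <= 1 - Cmod (a n)) -> Cmod z < 1 ->
  Rsum (fun n => standard_weight_fun alpha z * Cmod (sigma_derive alpha (a n) z)) N
    <= 4 * (alpha * Rpower 2 alpha).
Proof.
intros Hal Hk Hka Ha Hstep Hz.
eapply Rle_trans; [apply Rsum_le; intros n; apply sigma_term_bound; auto|].
rewrite Rsum_scal, Rsum_plus, Rmult_comm.
apply Rmult_le_compat_r.
{ apply Rmult_le_pos; [lra|left; apply Rpower_pos]. }
assert (Hy : 0 < 1 - Cmod z) by lra.
assert (Hyi := Rinv_0_lt_compat _ Hy).
assert (S1 : Rsum (fun n => cap1 ((1 - Cmod (a n)) / (1 - Cmod z))) N <= 2).
{ assert (E := halving_sum (fun n => (1 - Cmod (a n)) / (1 - Cmod z)) N).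
  cbv beta in E.
  assert (Hpos : forall n, 0 <= (1 - Cmod (a n)) / (1 - Cmod z)).
  { intros n. specialize (Ha n). apply Rmult_le_pos; lra. }
  specialize (E Hpos).
  assert (Hm : 0 <= Rmin 2 (2 * ((1 - Cmod (a N)) / (1 - Cmod z)))).
  { apply Rmin_glb; [lra|]. specialize (Hpos N). lra. }
  enough (Rsum (fun n => cap1 ((1 - Cmod (a n)) / (1 - Cmod z))) N
    + Rmin 2 (2 * ((1 - Cmod (a N)) / (1 - Cmod z))) <= 2) by lra.
  apply E. intros n. unfold Rdiv. rewrite <- Rmult_assoc.
  apply Rmult_le_compat_r; [lra|]. generalize (Ha (S n)) (Hstep n). nra. }
assert (S2 : Rsum (fun n => cap1 (Rpower ((1 - Cmod z) / (1 - Cmod (a n))) alpha)) N <= 2).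
{ eapply Rle_trans; [apply doubling_sum|apply Rmin_l].
  - intros n. left. apply Rpower_pos.
  - intros n. assert (H1 := Ha n). assert (H2 := Ha (S n)).
    assert (Q : 0 < (1 - Cmod z) / (1 - Cmod (a n))) by (apply Rdiv_lt_0_compat; lra).
    apply Rle_trans with (Rpower kappa alpha * Rpower ((1 - Cmod z) / (1 - Cmod (a n))) alpha).
    + apply Rmult_le_compat_r; [left; apply Rpower_pos|lra].
    + rewrite Rpower_mult_distr by lra.
      apply Rle_Rpower_l; [lra|]. split; [apply Rmult_lt_0_compat; lra|].
      apply Rmult_le_reg_r with ((1 - Cmod (a n)) * (1 - Cmod (a (S n))));
        [apply Rmult_lt_0_compat; lra|].
      replace (kappa * ((1 - Cmod z) / (1 - Cmod (a n))) *
        ((1 - Cmod (a n)) * (1 - Cmod (a (S n)))))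
        with ((1 - Cmod z) * (kappa * (1 - Cmod (a (S n))))) by (field; lra).
      replace ((1 - Cmod z) / (1 - Cmod (a (S n))) *
        ((1 - Cmod (a n)) * (1 - Cmod (a (S n)))))
        with ((1 - Cmod z) * (1 - Cmod (a n))) by (field; lra).
      apply Rmult_le_compat_l; [lra|apply Hstep]. }
lra.
Qed.

(** * Test functions under compact operators *)

Lemma bloch_Cderiv (mu : weight) (f : Bloch mu) (z : C) : unit_disk z ->
  Cderiv f z (C_derive f z).
Proof. intros Hz. apply (C_derive_correct f z (RtoC 0)), bloch_holomorphic, Hz. Qed.

Lemma bloch_C_derive (mu : weight) (f : Bloch mu) (g : C -> C) (z l : C) : unit_disk z ->
  (forall w, unit_disk w -> f w = g w) -> Cderiv g z l -> C_derive f z = l.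
Proof.
intros Hz E Hg. apply is_C_derive_unique.
apply Cderiv_ext with (d := 1 - Cmod z) (3 := Hg).
- unfold unit_disk in Hz. lra.
- intros y Hy. symmetry. apply E. unfold unit_disk.
  assert (T := Cmod_triangle (y - z) z). replace (y - z + z)%C with y in T by ring. lra.
Qed.

Lemma bloch_derive_le_norm (mu : weight) (f : Bloch mu) (z : C) : unit_disk z ->
  mu z * Cmod (C_derive f z) <= Bloch_norm mu f.
Proof.
intros Hz. rewrite Bloch_norm_eq.
generalize (bloch_bound mu f z (bloch_finite f) Hz) (Cmod_ge_0 (f 0%C)). lra.
Qed.

Lemma bloch_value0_le_norm (mu : weight) (f : Bloch mu) : Cmod (f 0%C) <= Bloch_norm mu f.
Proof.
rewrite Bloch_norm_eq.
generalize (bloch_bound mu f 0 (bloch_finite f) unit_disk_0) (Cmod_ge_0 (C_derive f 0))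
  (weight_pos mu 0 unit_disk_0). intros. nra.
Qed.

Lemma bloch_norm_le (mu : weight) (f : Bloch mu) (B : R) :
  (forall z, unit_disk z -> mu z * Cmod (C_derive f z) <= B) ->
  Bloch_norm mu f <= Cmod (f 0%C) + B.
Proof.
intros H. rewrite Bloch_norm_eq. apply Rplus_le_compat_l.
apply (bloch_seminorm_le_real mu f B H).
Qed.

(** Elements of the space must vanish off the disk, so [f] is cut off there. The disk is open, hence
    derivatives inside it are unaffected. *)
Lemma bloch_intro (mu : weight) (f df : C -> C) (B : R) :
  (forall z, unit_disk z -> Cderiv f z (df z)) ->
  (forall z, unit_disk z -> mu z * Cmod (df z) <= B) ->
  exists g : Bloch mu, (forall z, unit_disk z -> g z = f z) /\
    Bloch_norm mu g <= Cmod (f 0%C) + B.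
Proof.
intros Hf HB.
set (g := fun z => if Rlt_dec (Cmod z) 1 then f z else 0%C).
assert (Eg : forall z, unit_disk z -> g z = f z).
{ intros z Hz. unfold g. destruct Rlt_dec; [reflexivity|contradiction]. }
assert (Hg : forall z, unit_disk z -> Cderiv g z (df z)).
{ intros z Hz. apply Cderiv_ext with (d := 1 - Cmod z) (3 := Hf z Hz).
  - unfold unit_disk in Hz. lra.
  - intros y Hy. symmetry. apply Eg. unfold unit_disk.
    assert (T := Cmod_triangle (y - z) z). replace (y - z + z)%C with y in T by ring. lra. }
assert (HB' : forall z, unit_disk z -> mu z * Cmod (C_derive g z) <= B).
{ intros z Hz. rewrite (is_C_derive_unique _ _ _ (Hg z Hz)). auto. }
unshelve eexists (mk_Bloch mu g _ _ _).
- intros z Hz. unfold g. destruct Rlt_dec; [contradiction|reflexivity].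
- intros z Hz. exists (df z). auto.
- apply (bloch_seminorm_le_real mu g B HB').
- split; [exact Eg|].
  eapply Rle_trans; [apply bloch_norm_le; exact HB'|]. simpl.
  rewrite Eg by apply unit_disk_0. lra.
Qed.

(** Connects the norm of a plain function, such as the composition of [sigma_fun] with [phi], to the
    norm of an element of the space, such as the image of a test function under the operator. *)
Lemma bloch_norm_eq_on_disk (mu : weight) (f : Bloch mu) (g : C -> C) :
  (forall z, unit_disk z -> g z = f z) -> bloch_norm mu g = Finite (Bloch_norm mu f).
Proof.
intros E.
assert (D : forall z, unit_disk z -> C_derive g z = C_derive f z).
{ intros z Hz. apply is_C_derive_unique.
  apply Cderiv_ext with (d := 1 - Cmod z) (3 := bloch_Cderiv mu f z Hz).
  - unfold unit_disk in Hz. lra.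
  - intros y Hy. symmetry. apply E. unfold unit_disk.
    assert (T := Cmod_triangle (y - z) z). replace (y - z + z)%C with y in T by ring. lra. }
unfold Bloch_norm, bloch_norm.
rewrite (E 0%C) by apply unit_disk_0.
replace (bloch_seminorm mu g) with (bloch_seminorm mu f).
- rewrite (bloch_seminorm_finite mu f (bloch_finite f)). reflexivity.
- apply Lub_Rbar_eqset. intros x. split; intros [z [Hz ->]]; exists z; split; auto;
    now rewrite D.
Qed.

Fixpoint vsum {G : AbelianMonoid} (u : nat -> G) (n : nat) : G :=
  match n with O => zero | S n => plus (vsum u n) (u n) end.

Lemma vsum_bloch (mu : weight) (u : nat -> Bloch mu) (N : nat) (z : C) :
  (vsum u N : Bloch mu) z = Csum (fun n => u n z) N.
Proof. induction N as [|N IH]; [reflexivity|]. simpl. now rewrite IH. Qed.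

Lemma bloch_C_derive_plus (mu : weight) (f g : Bloch mu) (z : C) : unit_disk z ->
  C_derive (plus f g : Bloch mu) z = (C_derive f z + C_derive g z)%C.
Proof.
intros Hz. apply is_C_derive_unique. apply (C_derive_plus_on_disk f g z); auto;
  apply bloch_holomorphic.
Qed.

Lemma vsum_bloch_derive_le (mu : weight) (u : nat -> Bloch mu) (N : nat) (z : C) :
  unit_disk z ->
  mu z * Cmod (C_derive (vsum u N : Bloch mu) z)
    <= Rsum (fun n => mu z * Cmod (C_derive (u n) z)) N.
Proof.
intros Hz. assert (Hmu := weight_pos mu z Hz). induction N as [|N IH].
- simpl. rewrite (is_C_derive_unique _ _ (RtoC 0)), Cmod_0 by apply Cderiv_const. lra.
- cbn [vsum Rsum]. rewrite bloch_C_derive_plus by exact Hz.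
  assert (T := Cmod_triangle (C_derive (vsum u N : Bloch mu) z) (C_derive (u N) z)). nra.
Qed.

Lemma linear_vsum {X Y : NormedModule C_AbsRing} (T : X -> Y) (u : nat -> X) (N : nat) :
  is_linear T -> T (vsum u N) = vsum (fun n => T (u n)) N.
Proof.
intros HT. induction N as [|N IH].
- simpl. apply (linear_zero T HT).
- simpl. now rewrite (linear_plus T HT), IH.
Qed.

Lemma plus_minus_minus {G : AbelianGroup} (a b c d : G) :
  plus (minus a c) (minus b d) = minus (plus a b) (plus c d).
Proof.
unfold minus. rewrite opp_plus, <- !plus_assoc. f_equal.
rewrite !plus_assoc. f_equal. apply plus_comm.
Qed.

Lemma minus_plus_cancel {G : AbelianGroup} (y x : G) : plus (minus y x) x = y.
Proof. unfold minus. now rewrite <- plus_assoc, plus_opp_l, plus_zero_r. Qed.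

Lemma norm_minus_sym {K : AbsRing} {V : NormedModule K} (x y : V) :
  norm (minus x y) = norm (minus y x).
Proof.
rewrite <- (norm_opp (minus y x)). f_equal. symmetry.
exact (opp_minus (G := NormedModule.AbelianGroup _ V) y x).
Qed.

Lemma norm_le_minus {K : AbsRing} {V : NormedModule K} (x y : V) :
  norm y <= norm (minus y x) + norm x.
Proof.
replace y with (plus (minus y x) x) at 1
  by exact (minus_plus_cancel (G := NormedModule.AbelianGroup _ V) y x).
apply norm_triangle.
Qed.

(** Vectors close to one common [y] cannot cancel: their sum is within N e of N y. *)
Lemma norm_vsum_minus_const {Y : NormedModule C_AbsRing} (v : nat -> Y) (y : Y) (e : R) (N : nat) :
  (forall n, norm (minus (v n) y) <= e) ->
  INR N * (norm y - e) <= norm (vsum v N).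
Proof.
intros H.
assert (E : norm (minus (vsum v N) (scal (RtoC (INR N) : C_AbsRing) y)) <= INR N * e).
{ induction N as [|N IH].
  - simpl. change (RtoC 0) with (zero : C_AbsRing). rewrite (scal_zero_l (K := C_AbsRing)).
    rewrite minus_eq_zero, Rmult_0_l. apply Req_le. exact (norm_zero (V := Y)).
  - rewrite S_INR. simpl vsum.
    replace (minus (plus (vsum v N) (v N)) (scal (RtoC (INR N + 1) : C_AbsRing) y))
      with (plus (minus (vsum v N) (scal (RtoC (INR N) : C_AbsRing) y)) (minus (v N) y)).
    + eapply Rle_trans; [apply norm_triangle|]. generalize (H N). lra.
    + rewrite RtoC_plus.
      change (RtoC (INR N) + 1)%C with (plus (RtoC (INR N) : C_AbsRing) (one : C_AbsRing)).
      rewrite (scal_distr_r (K := C_AbsRing)), (scal_one (K := C_AbsRing)).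
      exact (plus_minus_minus (G := NormedModule.AbelianGroup _ Y) _ _ _ _). }
(* The axioms of a normed module only bound the norm of a multiple from above; the lower bound
   follows by scaling back with 1 / N. *)
assert (F : INR N * norm y <= norm (scal (RtoC (INR N) : C_AbsRing) y)).
{ destruct N as [|N]; [rewrite Rmult_0_l; apply norm_ge_0|].
  assert (HN : 0 < INR (S N)) by (apply lt_0_INR; lia).
  assert (G := norm_scal (K := C_AbsRing) (RtoC (/ INR (S N))) (scal (RtoC (INR (S N)) : C_AbsRing) y)).
  rewrite (scal_assoc (K := C_AbsRing)) in G.
  change (mult (RtoC (/ INR (S N)) : C_AbsRing) (RtoC (INR (S N)))) with
    (RtoC (/ INR (S N)) * RtoC (INR (S N)))%C in G.
  rewrite <- RtoC_mult, Rinv_l in G by lra.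
  change (RtoC 1) with (one : C_AbsRing) in G. rewrite (scal_one (K := C_AbsRing)) in G.
  change (abs (RtoC (/ INR (S N)) : C_AbsRing)) with (Cmod (RtoC (/ INR (S N)))) in G.
  rewrite Cmod_R, Rabs_pos_eq in G by (left; now apply Rinv_0_lt_compat).
  apply Rmult_le_compat_l with (r := INR (S N)) in G; [|lra].
  rewrite <- Rmult_assoc, Rinv_r, Rmult_1_l in G by lra. exact G. }
assert (T := norm_le_minus (vsum v N) (scal (RtoC (INR N) : C_AbsRing) y)).
rewrite norm_minus_sym in T.
rewrite Rmult_minus_distr_l.
apply Rle_trans with (norm (scal (RtoC (INR N) : C_AbsRing) y) - INR N * e); [lra|].
apply Rle_minus_l. apply Rle_trans with (1 := T). rewrite Rplus_comm.
apply Rplus_le_compat_l. exact E.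
Qed.

(** A relation rather than a function of [a]: an element of the space carries proofs that exist only
    for |a| < 1. *)
Definition is_sigma (alpha : R) (Halpha : 0 < alpha) (a : C)
  (s : Bloch (standard_weight alpha Halpha)) : Prop :=
  Cmod a < 1 /\ forall z, unit_disk z -> s z = sigma_fun alpha a z.

Lemma sigma_exists (alpha : R) (Halpha : 0 < alpha) (a : C) : Cmod a < 1 ->
  exists s, is_sigma alpha Halpha a s.
Proof.
intros Ha.
destruct (bloch_intro (standard_weight alpha Halpha) (sigma_fun alpha a)
  (sigma_derive alpha a) (2 * (alpha * Rpower 2 alpha))) as [s [Hs _]].
- intros z Hz. now apply Cderiv_sigma.
- intros z Hz. now apply sigma_norm_bound.
- now exists s.
Qed.

Lemma is_sigma_derive (alpha : R) (Halpha : 0 < alpha) (a z : C)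
  (s : Bloch (standard_weight alpha Halpha)) : is_sigma alpha Halpha a s -> unit_disk z ->
  C_derive s z = sigma_derive alpha a z.
Proof.
intros [Ha Hs] Hz. apply (bloch_C_derive _ s (sigma_fun alpha a)); auto.
now apply Cderiv_sigma.
Qed.

Lemma is_sigma_norm (alpha : R) (Halpha : 0 < alpha) (a : C)
  (s : Bloch (standard_weight alpha Halpha)) : is_sigma alpha Halpha a s ->
  Bloch_norm _ s <= 2 * (alpha * Rpower 2 alpha).
Proof.
intros H. assert (H' := H). destruct H' as [Ha Hs].
eapply Rle_trans; [apply bloch_norm_le|].
- intros z Hz. rewrite (is_sigma_derive alpha Halpha a z s H Hz).
  now apply sigma_norm_bound.
- rewrite Hs, sigma_fun_0, Cmod_0 by apply unit_disk_0. lra.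
Qed.

Lemma strictly_increasing_ge_id (t : nat -> nat) : (forall n, (t n < t (S n))%nat) ->
  forall n, (n <= t n)%nat.
Proof. intros H n. induction n as [|n IH]; [lia|]. specialize (H n). lia. Qed.

Lemma sigma_vsum_norm (alpha kappa : R) (Halpha : 0 < alpha) (a : nat -> C)
  (s : nat -> Bloch (standard_weight alpha Halpha)) (N : nat) :
  2 <= kappa -> 2 <= Rpower kappa alpha -> (forall n, is_sigma alpha Halpha (a n) (s n)) ->
  (forall n, kappa * (1 - Cmod (a (S n))) <= 1 - Cmod (a n)) ->
  Bloch_norm _ (vsum s N) <= 4 * (alpha * Rpower 2 alpha).
Proof.
intros Hk Hka Hs Hstep.
eapply Rle_trans; [apply bloch_norm_le|].
- intros z Hz. eapply Rle_trans; [now apply vsum_bloch_derive_le|].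
  eapply Rle_trans; [apply Rsum_le; intros n|].
  + rewrite (is_sigma_derive alpha Halpha (a n) z (s n) (Hs n) Hz). apply Rle_refl.
  + apply (sigma_sum_bound alpha kappa a z N); auto. intros n. apply Hs.
- rewrite vsum_bloch.
  replace (Csum (fun n => s n 0%C) N) with (RtoC 0).
  + rewrite Cmod_0. lra.
  + clear - Hs. induction N as [|N IH]; [reflexivity|]. simpl. rewrite <- IH.
    destruct (Hs N) as [_ E]. rewrite E, sigma_fun_0 by apply unit_disk_0. ring.
Qed.

(* Gliding hump: along a sequence with [1 - |a n|] decreasing fast enough the partial sums of
   the test functions stay bounded, whereas their images under [K] would add up linearly. *)
Lemma compact_sigma_small (alpha : R) (Halpha : 0 < alpha) {Y : NormedModule C_AbsRing}
  (K : Bloch (standard_weight alpha Halpha) -> Y) (e : R) : 0 < e -> compact_operator K ->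
  exists r, r < 1 /\ forall a s, r < Cmod a -> is_sigma alpha Halpha a s -> norm (K s) <= e.
Proof.
intros He [HK Hcpt].
apply NNPP. intros Hno.
assert (Hbad : forall r, r < 1 -> exists p : C * Bloch (standard_weight alpha Halpha),
  r < Cmod (fst p) /\ is_sigma alpha Halpha (fst p) (snd p) /\ e < norm (K (snd p))).
{ intros r Hr. apply NNPP. intros H. apply Hno. exists r. split; [exact Hr|].
  intros a s Ha Hs. apply Rnot_lt_le. intros Hlt. apply H. now exists (a, s). }
(* The least factor meeting both spacing conditions of [sigma_sum_bound]. *)
set (kappa := Rmax 2 (Rpower 2 (/ alpha))).
assert (Hk : 2 <= kappa) by apply Rmax_l.
assert (Hka : 2 <= Rpower kappa alpha).
{ replace 2 with (Rpower (Rpower 2 (/ alpha)) alpha) at 1.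
  - apply Rle_Rpower_l; [lra|]. split; [apply Rpower_pos|apply Rmax_r].
  - rewrite Rpower_mult, Rinv_l, Rpower_1; lra. }
set (good := fun p : C * Bloch (standard_weight alpha Halpha) =>
  is_sigma alpha Halpha (fst p) (snd p) /\ e < norm (K (snd p))).
(* By assumption bad test functions exist arbitrarily close to the boundary; choice turns this into
   a successor map whose iteration gives a sparse sequence. *)
assert (Hnext : forall p : {p | good p}, {q : {q | good q} |
  kappa * (1 - Cmod (fst (proj1_sig q))) <= 1 - Cmod (fst (proj1_sig p))}).
{ intros [p Hp]. apply constructive_indefinite_description. simpl.
  assert (Hp1 : Cmod (fst p) < 1) by apply Hp.
  destruct (Hbad (1 - (1 - Cmod (fst p)) / kappa)) as [q [Hq1 [Hq2 Hq3]]].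
  { assert (0 < (1 - Cmod (fst p)) / kappa) by (apply Rdiv_lt_0_compat; lra). lra. }
  exists (exist good q (conj Hq2 Hq3)). simpl.
  apply Rle_trans with (kappa * ((1 - Cmod (fst p)) / kappa)).
  - apply Rmult_le_compat_l; lra.
  - right. field. lra. }
destruct (Hbad 0 Rlt_0_1) as [p0 [_ Hp0]].
set (p := fix p (n : nat) : {p | good p} :=
  match n with O => exist good p0 Hp0 | S n => proj1_sig (Hnext (p n)) end).
set (a := fun n => fst (proj1_sig (p n))).
set (s := fun n => snd (proj1_sig (p n))).
assert (Hgood : forall n, is_sigma alpha Halpha (a n) (s n) /\ e < norm (K (s n)))
  by (intros n; exact (proj2_sig (p n))).
assert (Hstep : forall n, kappa * (1 - Cmod (a (S n))) <= 1 - Cmod (a n))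
  by (intros n; exact (proj2_sig (Hnext (p n)))).
assert (Ha : forall n, Cmod (a n) < 1) by (intros n; apply Hgood).
(* As kappa >= 1, skipping terms keeps the spacing, so it survives the passage to the subsequence
   given by compactness. *)
assert (Hstep' : forall n m, (n < m)%nat -> kappa * (1 - Cmod (a m)) <= 1 - Cmod (a n)).
{ intros n m Hnm. induction Hnm as [|m Hnm IH]; [apply Hstep|].
  apply Rle_trans with (2 := IH). apply Rle_trans with (1 := Hstep m).
  generalize (Ha m). nra. }
destruct (Hcpt s) as [t [y [Ht Hy]]].
{ exists (2 * (alpha * Rpower 2 alpha)). intros n.
  apply (is_sigma_norm alpha Halpha (a n)), Hgood. }
(* The limit [y] then has norm at least 3 e / 4, and every image within e / 4 of it contributes at
   least e / 2 to the sums. *)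
assert (He4 : 0 < e / 4) by lra.
apply (filterlim_locally_ball_norm (K := C_AbsRing)) with (eps := mkposreal _ He4) in Hy.
destruct Hy as [n0 Hn0].
destruct (linear_norm K HK) as [M [HM HKM]].
set (b := fun n => t (n0 + n)%nat).
assert (Hb : forall n, (b n < b (S n))%nat).
{ intros n. unfold b. rewrite Nat.add_succ_r. apply Ht. }
assert (Hclose : forall n, norm (minus (K (s (b n))) y) <= e / 4).
{ intros n. left. apply (Hn0 (n0 + n)%nat). lia. }
assert (Hy : 3 * e / 4 <= norm y).
{ assert (T := norm_le_minus y (K (s (b O)))).
  generalize (proj2 (Hgood (b O))) (Hclose O). lra. }
assert (Hfin : forall N, INR N * (e / 2) <= M * (4 * (alpha * Rpower 2 alpha))).
{ intros N.
  assert (L := norm_vsum_minus_const (fun n => K (s (b n))) y (e / 4) N Hclose).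
  rewrite <- (linear_vsum K (fun n => s (b n)) N HK) in L.
  apply Rle_trans with (INR N * (norm y - e / 4)).
  - apply Rmult_le_compat_l; [apply pos_INR|lra].
  - apply Rle_trans with (1 := L). apply Rle_trans with (1 := HKM _).
    apply Rmult_le_compat_l; [lra|].
    apply (sigma_vsum_norm alpha kappa Halpha (fun n => a (b n)) (fun n => s (b n)) N Hk Hka).
    + intros n. apply Hgood.
    + intros n. apply Hstep', Hb. }
set (X := M * (4 * (alpha * Rpower 2 alpha))) in *.
destruct (INR_unbounded (X / (e / 2))) as [N HN].
specialize (Hfin N).
apply Rmult_gt_compat_r with (r := e / 2) in HN; [|lra].
replace (X / (e / 2) * (e / 2)) with X in HN by (field; lra). lra.
Qed.

(** * Compact operators *)

Lemma strictly_increasing_monotone (t : nat -> nat) : (forall n, (t n < t (S n))%nat) ->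
  forall n m, (n < m)%nat -> (t n < t m)%nat.
Proof.
intros H n m Hnm. induction Hnm as [|m Hnm IH]; [apply H|]. specialize (H m). lia.
Qed.

(** [Bolzano_Weierstrass] only yields a cluster value; the subsequence is built by choosing, beyond
    the previous index, a term within 1 / (n + 1) of it. *)
Lemma bounded_subsequence_R (u : nat -> R) (M : R) : (forall n, Rabs (u n) <= M) ->
  exists (t : nat -> nat) (l : R), (forall n, (t n < t (S n))%nat) /\
    forall e, 0 < e -> exists N, forall n, (N <= n)%nat -> Rabs (u (t n) - l) < e.
Proof.
intros HM.
destruct (Bolzano_Weierstrass u (fun x => - M <= x <= M)) as [l Hl].
- apply compact_P3.
- intros n. now apply Rabs_le_between.
- assert (Hpick : forall n N : nat, {p : nat | (N <= p)%nat /\ Rabs (u p - l) < / INR (S n)}).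
  { intros n N. apply constructive_indefinite_description.
    assert (Hp : 0 < / INR (S n)) by (apply Rinv_0_lt_compat, lt_0_INR; lia).
    destruct (Hl (disc l (mkposreal _ Hp)) N) as [p [Hp1 Hp2]].
    - exists (mkposreal _ Hp). intros x Hx. exact Hx.
    - exists p. split; [exact Hp1|exact Hp2]. }
  set (t := fix t (n : nat) : nat := match n with
    | O => proj1_sig (Hpick O O) | S n => proj1_sig (Hpick (S n) (S (t n))) end).
  exists t, l. split.
  + intros n. exact (proj1 (proj2_sig (Hpick (S n) (S (t n))))).
  + assert (H : forall n, Rabs (u (t n) - l) < / INR (S n)).
    { intros [|n]; [exact (proj2 (proj2_sig (Hpick O O)))
      |exact (proj2 (proj2_sig (Hpick (S n) (S (t n)))))]. }
    intros e He. destruct (INR_unbounded (/ e)) as [N HN].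
    exists N. intros n Hn. apply Rlt_trans with (1 := H n).
    assert (He' := Rinv_0_lt_compat e He).
    rewrite <- (Rinv_inv e). apply Rinv_lt_contravar.
    * apply Rmult_lt_0_compat; [lra|apply lt_0_INR; lia].
    * apply Rlt_le_trans with (1 := HN). apply le_INR. lia.
Qed.

Lemma bounded_subsequence_C (u : nat -> C) (M : R) : (forall n, Cmod (u n) <= M) ->
  exists (t : nat -> nat) (l : C), (forall n, (t n < t (S n))%nat) /\
    forall e, 0 < e -> exists N, forall n, (N <= n)%nat -> Cmod (u (t n) - l) < e.
Proof.
intros HM.
destruct (bounded_subsequence_R (fun n => Re (u n)) M) as [t1 [x [Ht1 Hx]]].
{ intros n. apply Rle_trans with (1 := Cmod_Re _), HM. }
destruct (bounded_subsequence_R (fun n => Im (u (t1 n))) M) as [t2 [y [Ht2 Hy]]].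
{ intros n. apply Rle_trans with (1 := Cmod_Im _), HM. }
exists (fun n => t1 (t2 n)), (x, y). split.
- intros n. now apply strictly_increasing_monotone.
- intros e He.
  destruct (Hx (e / 2)) as [N1 H1]; [lra|].
  destruct (Hy (e / 2)) as [N2 H2]; [lra|].
  exists (max N1 N2). intros n Hn.
  apply Rle_lt_trans with (1 := Cmod_le_Re_Im _).
  assert (E1 : Rabs (Re (u (t1 (t2 n))) - x) < e / 2).
  { apply H1. generalize (strictly_increasing_ge_id t2 Ht2 n). lia. }
  assert (E2 : Rabs (Im (u (t1 (t2 n))) - y) < e / 2) by (apply H2; lia).
  change (Rabs (Re (u (t1 (t2 n))) - x) + Rabs (Im (u (t1 (t2 n))) - y) < e). lra.
Qed.

Lemma filterlim_seq_norm {K : AbsRing} {V : NormedModule K} (u : nat -> V) (y : V) :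
  (forall e, 0 < e -> exists N, forall n, (N <= n)%nat -> norm (minus (u n) y) < e) ->
  filterlim u eventually (locally y).
Proof.
intros H. apply (filterlim_locally_ball_norm (K := K)). intros [e He].
destruct (H e He) as [N HN]. exists N. exact HN.
Qed.

Lemma compact_zero {K : AbsRing} (X Y : NormedModule K) :
  compact_operator (fun _ : X => (zero : Y)).
Proof.
split; [apply is_linear_zero|].
intros x _. exists (fun n => n), zero. split; [intros; lia|]. apply filterlim_const.
Qed.

Lemma compact_plus {K : AbsRing} {X Y : NormedModule K} (S T : X -> Y) :
  compact_operator S -> compact_operator T -> compact_operator (fun x => plus (S x) (T x)).
Proof.
intros [HS CS] [HT CT]. split.
- destruct (linear_norm S HS) as [M1 [P1 B1]], (linear_norm T HT) as [M2 [P2 B2]].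
  split.
  + intros x y. rewrite (linear_plus S HS), (linear_plus T HT).
    rewrite <- !plus_assoc. f_equal. rewrite !plus_assoc. f_equal. apply plus_comm.
  + intros k x. rewrite (linear_scal S HS), (linear_scal T HT).
    symmetry. exact (scal_distr_l (V := NormedModule.ModuleSpace _ Y) k (S x) (T x)).
  + exists (M1 + M2). split; [lra|]. intros x.
    eapply Rle_trans; [apply norm_triangle|]. generalize (B1 x) (B2 x). lra.
- intros x [M HM].
  destruct (CS x (ex_intro _ M HM)) as [t1 [y1 [Ht1 L1]]].
  destruct (CT (fun n => x (t1 n)) (ex_intro _ M (fun n => HM (t1 n)))) as [t2 [y2 [Ht2 L2]]].
  exists (fun n => t1 (t2 n)), (plus y1 y2). split.
  + intros n. now apply strictly_increasing_monotone.
  + apply (filterlim_comp_2 (F := eventually) (fun n => S (x (t1 (t2 n))))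
      (fun n => T (x (t1 (t2 n)))) plus) with (3 := filterlim_plus y1 y2); [|exact L2].
    apply filterlim_comp with (f := t2) (2 := L1).
    apply eventually_subseq. exact Ht2.
Qed.

(** The scalars [c (x n)] are bounded in the plane, so a subsequence of them converges, and
    multiplying by the fixed [y] preserves this. *)
Lemma compact_rank_one {X Y : NormedModule C_AbsRing} (c : X -> C) (M : R) (y : Y) :
  (forall u v, c (plus u v) = (c u + c v)%C) ->
  (forall (k : C_AbsRing) u, c (scal k u) = (k * c u)%C) ->
  (forall u, Cmod (c u) <= M * norm u) ->
  compact_operator (fun x => scal (c x : C_AbsRing) y).
Proof.
intros Hp Hs HM. split.
- split.
  + intros u v. rewrite Hp.
    exact (scal_distr_r (V := NormedModule.ModuleSpace _ Y) (c u : C_AbsRing) (c v) y).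
  + intros k u. rewrite Hs. symmetry.
    exact (scal_assoc (V := NormedModule.ModuleSpace _ Y) k (c u : C_AbsRing) y).
  + assert (Hy := norm_ge_0 y). assert (HM0 := Rabs_pos M).
    (* [is_linear] asks for a positive constant, while [M] may be negative and [y] zero. *)
    exists (1 + Rabs M * norm y). split; [nra|]. intros u.
    eapply Rle_trans; [apply norm_scal|].
    change (abs (c u : C_AbsRing)) with (Cmod (c u)).
    assert (Hu := norm_ge_0 u).
    apply Rle_trans with (Rabs M * norm u * norm y).
    * apply Rmult_le_compat_r; [exact Hy|]. apply Rle_trans with (1 := HM u).
      apply Rmult_le_compat_r; [exact Hu|apply Rle_abs].
    * nra.
- intros x [B HB].
  destruct (bounded_subsequence_C (fun n => c (x n)) (Rabs M * B)) as [t [l [Ht Hl]]].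
  { intros n. apply Rle_trans with (1 := HM _).
    apply Rle_trans with (Rabs M * norm (x n)).
    - apply Rmult_le_compat_r; [apply norm_ge_0|apply Rle_abs].
    - apply Rmult_le_compat_l; [apply Rabs_pos|apply HB]. }
  exists t, (scal (l : C_AbsRing) y). split; [exact Ht|].
  apply filterlim_seq_norm. intros e He.
  assert (Hy := norm_ge_0 y).
  destruct (Hl (e / (1 + norm y))) as [N HN]; [apply Rdiv_lt_0_compat; lra|].
  exists N. intros n Hn. specialize (HN n Hn).
  apply Rle_lt_trans with (norm (scal (minus (c (x (t n)) : C_AbsRing) l) y)).
  { right. f_equal. symmetry.
    exact (scal_minus_distr_r (V := NormedModule.ModuleSpace _ Y) _ _ y). }
  eapply Rle_lt_trans; [apply norm_scal|].
  change (abs (minus (c (x (t n)) : C_AbsRing) l)) with (Cmod (c (x (t n)) - l)).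
  assert (Hq := Cmod_ge_0 (c (x (t n)) - l)).
  apply Rmult_lt_compat_r with (r := 1 + norm y) in HN; [|lra].
  replace (e / (1 + norm y) * (1 + norm y)) with e in HN by (field; lra). nra.
Qed.

Lemma compact_vsum {K : AbsRing} {X Y : NormedModule K} (T : nat -> X -> Y) (N : nat) :
  (forall n, compact_operator (T n)) ->
  compact_operator (fun x => vsum (fun n => T n x) N).
Proof.
intros H. induction N as [|N IH]; [apply compact_zero|]. apply compact_plus; auto.
Qed.

Lemma is_linear_minus_fct {K : AbsRing} {X Y : NormedModule K} (S T : X -> Y) :
  is_linear S -> is_linear T -> is_linear (fun x => minus (S x) (T x)).
Proof.
intros HS HT.
destruct (linear_norm S HS) as [M1 [P1 B1]], (linear_norm T HT) as [M2 [P2 B2]].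
split.
- intros x y. rewrite (linear_plus S HS), (linear_plus T HT). symmetry.
  exact (plus_minus_minus (G := NormedModule.AbelianGroup _ Y) _ _ _ _).
- intros k x. rewrite (linear_scal S HS), (linear_scal T HT). symmetry.
  exact (scal_minus_distr_l (V := NormedModule.ModuleSpace _ Y) k (S x) (T x)).
- exists (M1 + M2). split; [lra|]. intros x.
  unfold minus. eapply Rle_trans; [apply norm_triangle|].
  rewrite norm_opp. generalize (B1 x) (B2 x). lra.
Qed.

Lemma operator_norm_finite {K : AbsRing} {X Y : NormedModule K} (T : X -> Y) : is_linear T ->
  exists o, operator_norm T = Finite o /\ 0 <= o.
Proof.
intros HT. destruct (linear_norm T HT) as [M [HM HTM]].
assert (U : Rbar_le (operator_norm T) M).
{ apply Lub_Rbar_correct. intros r [x [Hx ->]]. simpl.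
  apply Rle_trans with (1 := HTM x). generalize (norm_ge_0 x). nra. }
assert (L : Rbar_le 0 (operator_norm T)).
{ apply Rbar_le_trans with (norm (T zero)); [apply norm_ge_0|].
  apply (Lub_Rbar_correct _). exists zero. split; [|reflexivity].
  rewrite norm_zero. lra. }
destruct (operator_norm T) as [o| |]; simpl in *; try contradiction. now exists o.
Qed.

(** Rescaling by an upper bound [c] of the norm instead of the norm itself spares the case x = 0. *)
Lemma operator_norm_bound {X Y : NormedModule C_AbsRing} (T : X -> Y) (o c : R) (x : X) :
  is_linear T -> operator_norm T = Finite o -> 0 < c -> norm x <= c -> norm (T x) <= c * o.
Proof.
intros HT Ho Hc Hx.
set (x' := scal (RtoC (/ c) : C_AbsRing) x).
assert (Hx' : norm x' <= 1).
{ eapply Rle_trans; [apply norm_scal|].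
  change (abs (RtoC (/ c) : C_AbsRing)) with (Cmod (RtoC (/ c))).
  assert (Hci := Rinv_0_lt_compat c Hc).
  rewrite Cmod_R, Rabs_pos_eq by lra.
  apply Rle_trans with (/ c * c); [apply Rmult_le_compat_l; lra|].
  rewrite Rinv_l; lra. }
assert (B : norm (T x') <= o).
{ change (Rbar_le (norm (T x')) o). rewrite <- Ho.
  apply (Lub_Rbar_correct _). now exists x'. }
assert (E : T x = scal (RtoC c : C_AbsRing) (T x')).
{ rewrite <- (linear_scal T HT). f_equal. unfold x'.
  rewrite (scal_assoc (V := NormedModule.ModuleSpace _ X)).
  change (mult (RtoC c : C_AbsRing) (RtoC (/ c))) with (RtoC c * RtoC (/ c))%C.
  rewrite <- RtoC_mult, Rinv_r by lra. symmetry.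
  exact (scal_one (V := NormedModule.ModuleSpace _ X) x). }
rewrite E. eapply Rle_trans; [apply norm_scal|].
change (abs (RtoC c : C_AbsRing)) with (Cmod (RtoC c)).
rewrite Cmod_R, Rabs_pos_eq by lra. apply Rmult_le_compat_l; lra.
Qed.

(** * Approximation in the Bloch space *)

Lemma standard_weight_fun_decr (alpha : R) (z w : C) : 0 < alpha -> Cmod z <= Cmod w ->
  Cmod w < 1 -> standard_weight_fun alpha w <= standard_weight_fun alpha z.
Proof.
intros Hal Hzw Hw. assert (Hz := Cmod_ge_0 z). apply Rle_Rpower_l; [lra|]. split; nra.
Qed.

Lemma bloch_derive_bound (alpha : R) (Halpha : 0 < alpha)
  (f : Bloch (standard_weight alpha Halpha)) (r : R) (w : C) : Cmod w <= r -> r < 1 ->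
  Cmod (C_derive f w) <= Bloch_norm _ f / Rpower (1 - r ^ 2) alpha.
Proof.
intros Hw Hr. assert (Hw0 := Cmod_ge_0 w).
assert (H := bloch_derive_le_norm _ f w (Rle_lt_trans _ _ _ Hw Hr)).
assert (Hv := Rpower_pos (1 - r ^ 2) alpha).
apply Rmult_le_reg_l with (1 := Hv).
unfold Rdiv. rewrite (Rmult_comm (Bloch_norm _ f)), <- Rmult_assoc, Rinv_r, Rmult_1_l by lra.
apply Rle_trans with (2 := H). apply Rmult_le_compat_r; [apply Cmod_ge_0|].
apply Rle_Rpower_l; [lra|]. split; nra.
Qed.

Lemma Cmod_segment_le (x y : C) (t r : R) : 0 <= t <= 1 -> Cmod x <= r -> Cmod y <= r ->
  Cmod (x + RtoC t * (y - x)) <= r.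
Proof.
intros Ht Hx Hy.
replace (x + RtoC t * (y - x))%C with (RtoC (1 - t) * x + RtoC t * y)%C
  by (rewrite RtoC_minus; ring).
eapply Rle_trans; [apply Cmod_triangle|].
rewrite !Cmod_mult, !Cmod_R, !Rabs_pos_eq by lra. nra.
Qed.

Lemma bloch_Lipschitz (alpha : R) (Halpha : 0 < alpha)
  (f : Bloch (standard_weight alpha Halpha)) (r : R) (x y : C) :
  Cmod x <= r -> Cmod y <= r -> r < 1 ->
  Cmod (f y - f x) <= 2 * (Bloch_norm _ f / Rpower (1 - r ^ 2) alpha) * Cmod (y - x).
Proof.
intros Hx Hy Hr.
apply (Cderiv_segment_bound f (C_derive f)); intros t Ht;
  assert (Hs := Cmod_segment_le x y t r Ht Hx Hy).
- apply bloch_Cderiv. unfold unit_disk. lra.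
- now apply bloch_derive_bound.
Qed.

Lemma Bloch_norm_ge0 (mu : weight) (f : Bloch mu) : 0 <= Bloch_norm mu f.
Proof. exact (norm_ge_0 f). Qed.

Lemma bloch_value_bound (alpha : R) (Halpha : 0 < alpha)
  (f : Bloch (standard_weight alpha Halpha)) (r : R) (w : C) : Cmod w <= r -> r < 1 ->
  Cmod (f w) <= (1 + 2 / Rpower (1 - r ^ 2) alpha) * Bloch_norm _ f.
Proof.
intros Hw Hr. assert (Hw0 := Cmod_ge_0 w).
assert (L := bloch_Lipschitz alpha Halpha f r 0 w ltac:(rewrite Cmod_0; lra) Hw Hr).
assert (H0 := bloch_value0_le_norm _ f).
assert (Hn := Bloch_norm_ge0 _ f).
replace (w - 0)%C with w in L by ring.
assert (T := Cmod_triangle (f w - f 0%C) (f 0%C)).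
replace (f w - f 0 + f 0)%C with (f w) in T by ring.
assert (Hv := Rpower_pos (1 - r ^ 2) alpha).
assert (Hvi := Rinv_0_lt_compat _ Hv).
assert (B : 2 * (Bloch_norm _ f / Rpower (1 - r ^ 2) alpha) * Cmod w
  <= 2 * (Bloch_norm _ f / Rpower (1 - r ^ 2) alpha) * 1).
{ apply Rmult_le_compat_l; [|lra]. apply Rmult_le_pos; [lra|]. apply Rmult_le_pos; lra. }
unfold Rdiv in *. lra.
Qed.

Lemma bloch_holomorphic_closed_disk (mu : weight) (f : Bloch mu) (r : R) : r < 1 ->
  holomorphic_closed_disk f r.
Proof.
intros Hr z Hz. exists (C_derive f z). apply bloch_Cderiv. unfold unit_disk. lra.
Qed.

Lemma Cderiv_scale (f : C -> C) (s : R) (z l : C) : Cderiv f (RtoC s * z)%C l ->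
  Cderiv (fun x => f (RtoC s * x)%C) z (l * RtoC s)%C.
Proof.
intros Hf. apply (Cderiv_comp f (fun x => (RtoC s * x)%C)); [exact Hf|].
assert (D := Cderiv_mult (fun _ => RtoC s) (fun x => x) z _ _
  (Cderiv_const _ _) (Cderiv_id z)).
cbv beta in D. replace (0 * z + RtoC s * 1)%C with (RtoC s) in D by ring. exact D.
Qed.

Lemma Cderiv_minus (f g : C -> C) (z df dg : C) :
  Cderiv f z df -> Cderiv g z dg -> Cderiv (fun x => (f x - g x)%C) z (df - dg)%C.
Proof.
intros Hf Hg. apply (Cderiv_plus f (fun x => (- g x)%C)); [exact Hf|].
replace (- dg)%C with (0 * g z + - (1) * dg)%C by ring.
apply Cderiv_ext with (1 := Rlt_0_1) (f := (fun x => - (1) * g x)%C); [intros; ring|].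
apply (Cderiv_mult (fun _ => (- (1))%C) g); [apply Cderiv_const|exact Hg].
Qed.

Lemma Cmod_scale_le (s : R) (w : C) : 0 <= s <= 1 -> Cmod (RtoC s * w) <= Cmod w.
Proof.
intros Hs. rewrite Cmod_mult, Cmod_R, Rabs_pos_eq by lra. generalize (Cmod_ge_0 w). nra.
Qed.

Lemma div_square_mono (c r rho x : R) : 0 <= c -> x <= rho -> rho < r ->
  c / (r - x) ^ 2 <= c / (r - rho) ^ 2.
Proof.
intros Hc Hx Hr. unfold Rdiv. apply Rmult_le_compat_l; [exact Hc|].
apply Rinv_le_contravar; [apply pow_lt; lra|]. apply pow_incr. lra.
Qed.

(** One [s] serves the whole unit ball because its elements share a Lipschitz constant on |z| <= r.
    Smallness of f - f(s .) there passes to derivatives on |w| <= rho by Cauchy's estimate, hence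
    the intermediate radius. *)
Lemma dilation_approx (alpha : R) (Halpha : 0 < alpha) (rho eta : R) :
  0 <= rho < 1 -> 0 < eta ->
  exists s, 0 < s < 1 /\ forall f : Bloch (standard_weight alpha Halpha),
    Bloch_norm _ f <= 1 -> forall w, Cmod w <= rho ->
    Cmod (f w - f (RtoC s * w)%C) <= eta /\
    Cmod (C_derive f w - C_derive f (RtoC s * w) * RtoC s) <= eta.
Proof.
intros Hrho Heta.
set (r := (1 + rho) / 2). assert (Hr : rho < r < 1) by (unfold r; lra).
set (c := 2 / Rpower (1 - r ^ 2) alpha).
assert (Hc : 0 < c) by (apply Rdiv_lt_0_compat; [lra|apply Rpower_pos]).
assert (Hd : 0 < (r - rho) ^ 2) by (apply pow_lt; lra).
(* h = 1 - s. The bound 1/2 keeps s positive, the second makes the values differ by at most c h <=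
   eta, the third absorbs the factor 8 / (r - rho)^2 of Cauchy's estimate. *)
set (h := Rmin (1 / 2) (Rmin (eta / c) (eta * (r - rho) ^ 2 / (8 * c)))).
assert (Hh : 0 < h).
{ repeat apply Rmin_pos; [lra|apply Rdiv_lt_0_compat; lra|].
  apply Rdiv_lt_0_compat; [|lra]. apply Rmult_lt_0_compat; lra. }
assert (Hh1 : h <= 1 / 2) by apply Rmin_l.
assert (Hh' : h <= Rmin (eta / c) (eta * (r - rho) ^ 2 / (8 * c))) by apply Rmin_r.
assert (Hh2 : h <= eta / c) by (eapply Rle_trans; [exact Hh'|apply Rmin_l]).
assert (Hh3 : h <= eta * (r - rho) ^ 2 / (8 * c)) by (eapply Rle_trans; [exact Hh'|apply Rmin_r]).
assert (Hch : c * h <= eta).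
{ apply Rmult_le_compat_l with (r := c) in Hh2; [|lra].
  replace (c * (eta / c)) with eta in Hh2 by (field; lra). exact Hh2. }
exists (1 - h). split; [lra|]. intros f Hf w Hw.
assert (Hn := Bloch_norm_ge0 _ f).
assert (Hg : forall z, Cmod z <= r -> Cmod (f z - f (RtoC (1 - h) * z)%C) <= c * h).
{ intros z Hz. assert (Hz0 := Cmod_ge_0 z).
  assert (Hz1 : Cmod (RtoC (1 - h) * z) <= r)
    by (eapply Rle_trans; [apply Cmod_scale_le; lra|exact Hz]).
  eapply Rle_trans; [apply (bloch_Lipschitz alpha Halpha f r); [exact Hz1|exact Hz|lra]|].
  replace (z - RtoC (1 - h) * z)%C with (RtoC h * z)%C by (rewrite RtoC_minus; ring).
  rewrite Cmod_mult, Cmod_R, Rabs_pos_eq by lra.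
  apply Rmult_le_compat; [|nra| |nra].
  - apply Rmult_le_pos; [lra|]. apply Rmult_le_pos; [exact Hn|].
    left. apply Rinv_0_lt_compat, Rpower_pos.
  - unfold c, Rdiv. apply Rmult_le_compat_l; [lra|].
    rewrite <- (Rmult_1_l (/ _)) at 2. apply Rmult_le_compat_r; [|exact Hf].
    left. apply Rinv_0_lt_compat, Rpower_pos. }
split; [apply Rle_trans with (2 := Hch), Hg; lra|].
assert (Hdg : forall z, Cmod z <= r -> Cderiv (fun z => f z - f (RtoC (1 - h) * z)%C)%C z
  (C_derive f z - C_derive f (RtoC (1 - h) * z) * RtoC (1 - h))%C).
{ intros z Hz. assert (Hz1 := Cmod_scale_le (1 - h) z ltac:(lra)).
  apply (Cderiv_minus f (fun z => f (RtoC (1 - h) * z)%C)).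
  - apply bloch_Cderiv. unfold unit_disk. lra.
  - apply (Cderiv_scale f). apply bloch_Cderiv. unfold unit_disk. lra. }
eapply Rle_trans; [apply (cauchy_estimate _ r (c * h) w _ ltac:(lra))
  with (3 := Hdg w ltac:(lra))|].
- intros z Hz. eexists. apply Hdg. exact Hz.
- intros z Hz. apply Hg. lra.
- eapply Rle_trans; [apply (div_square_mono _ r rho); [|exact Hw|lra]|].
  { assert (0 < c * h) by (now apply Rmult_lt_0_compat). nra. }
  apply Rmult_le_reg_r with ((r - rho) ^ 2); [exact Hd|].
  unfold Rdiv. rewrite Rmult_assoc, Rinv_l, Rmult_1_r by lra.
  apply Rmult_le_compat_l with (r := 8 * c) in Hh3; [|lra].
  replace (8 * c * (eta * (r - rho) ^ 2 / (8 * c))) with (eta * (r - rho) ^ 2) in Hh3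
    by (field; lra).
  apply Rle_trans with (2 := Hh3).
  assert (0 < c * h) by now apply Rmult_lt_0_compat. nra.
Qed.

Lemma Cderiv_Csum (u : nat -> C -> C) (du : nat -> C) (z : C) (N : nat) :
  (forall k, Cderiv (u k) z (du k)) ->
  Cderiv (fun x => Csum (fun k => u k x) N) z (Csum du N).
Proof.
intros H. induction N as [|N IH]; [apply (Cderiv_const 0%C)|].
apply (Cderiv_plus (fun x => Csum (fun k => u k x) N) (u N)); auto.
Qed.

Definition taylor_poly (r : R) (f : C -> C) (N : nat) (w : C) : C :=
  Csum (fun k => taylor_coef r f k * w ^ k)%C N.

Lemma Cderiv_taylor_poly (r : R) (f : C -> C) (N : nat) (w : C) :
  exists l, Cderiv (taylor_poly r f N) w l.
Proof.
eexists. apply (Cderiv_Csum (fun k w => taylor_coef r f k * w ^ k)%C). intros k.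
apply (Cderiv_mult (fun _ => taylor_coef r f k) (fun w => (w ^ k)%C));
  [apply Cderiv_const|apply Cderiv_pow].
Qed.

(** The remainder depends on [f] only through its maximum on a circle, which is uniformly bounded
    over the unit ball; so one radius and one degree serve all [f]. Quantifying over [l] avoids an
    explicit formula for the derivative of the polynomial. *)
Lemma taylor_approx (alpha : R) (Halpha : 0 < alpha) (s eta : R) : 0 <= s < 1 -> 0 < eta ->
  exists r N, 0 < r < 1 /\ forall f : Bloch (standard_weight alpha Halpha),
    Bloch_norm _ f <= 1 -> forall w, Cmod w <= s ->
    Cmod (f w - taylor_poly r f N w) <= eta /\
    forall l, Cderiv (taylor_poly r f N) w l -> Cmod (C_derive f w - l) <= eta.
Proof.
intros Hs Heta.
(* Three radii s < r1 < r: coefficients are taken on the circle of radius r, values are compared up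
   to r1, and Cauchy's estimate from r1 gives derivatives up to s. *)
set (r1 := (1 + s) / 2). set (r := (1 + r1) / 2).
assert (Hr1 : s < r1 < 1) by (unfold r1; lra).
assert (Hr : r1 < r < 1) by (unfold r; lra).
set (A := 1 + 2 / Rpower (1 - r ^ 2) alpha).
assert (HA : 0 < A).
{ assert (0 < 2 / Rpower (1 - r ^ 2) alpha)
    by (apply Rdiv_lt_0_compat; [lra|apply Rpower_pos]). unfold A. lra. }
assert (Hd : 0 < (r1 - s) ^ 2) by (apply pow_lt; lra).
set (m := Rmin eta (eta * (r1 - s) ^ 2 / 8)).
assert (Hm : 0 < m).
{ apply Rmin_pos; [exact Heta|]. apply Rdiv_lt_0_compat; [|lra]. apply Rmult_lt_0_compat; lra. }
assert (Hm1 : m <= eta) by apply Rmin_l.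
assert (Hm2 : m <= eta * (r1 - s) ^ 2 / 8) by apply Rmin_r.
set (B := 2 * A * (r / (r - r1))).
assert (Hrr : 0 < r / (r - r1)) by (apply Rdiv_lt_0_compat; lra).
assert (HB : 0 < B) by (unfold B; apply Rmult_lt_0_compat; lra).
assert (Hq : 0 < r1 / r) by (apply Rdiv_lt_0_compat; lra).
destruct (pow_lt_1_zero (r1 / r)) with (y := m / B) as [N HN].
{ rewrite Rabs_pos_eq by lra. apply Rmult_lt_reg_r with r; [lra|].
  unfold Rdiv. rewrite Rmult_assoc, Rinv_l; lra. }
{ now apply Rdiv_lt_0_compat. }
specialize (HN N (le_n N)).
rewrite Rabs_pos_eq in HN by (apply pow_le; lra).
exists r, N. split; [lra|]. intros f Hf w Hw.
assert (Hn := Bloch_norm_ge0 _ f).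
assert (Hg : forall z, Cmod z <= r1 -> Cmod (f z - taylor_poly r f N z) <= m).
{ intros z Hz. assert (Hz0 := Cmod_ge_0 z).
  eapply Rle_trans; [apply (taylor_remainder f r A z N)|].
  - lra.
  - apply bloch_holomorphic_closed_disk. lra.
  - intros y Hy. eapply Rle_trans; [apply (bloch_value_bound alpha Halpha f r); lra|].
    fold A. rewrite <- (Rmult_1_r A) at 2. apply Rmult_le_compat_l; lra.
  - apply Rle_trans with (B * (r1 / r) ^ N).
    + unfold B. replace (2 * A * (r / (r - r1)) * (r1 / r) ^ N)
        with (2 * A * (r1 / r) ^ N * (r / (r - r1))) by ring.
      apply Rmult_le_compat.
      * apply Rmult_le_pos; [lra|]. apply pow_le.
        apply Rmult_le_pos; [exact Hz0|]. left. apply Rinv_0_lt_compat. lra.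
      * apply Rmult_le_pos; [lra|]. left. apply Rinv_0_lt_compat. lra.
      * apply Rmult_le_compat_l; [lra|]. apply pow_incr. split.
        -- apply Rmult_le_pos; [exact Hz0|]. left. apply Rinv_0_lt_compat. lra.
        -- unfold Rdiv. apply Rmult_le_compat_r; [left; apply Rinv_0_lt_compat; lra|lra].
      * unfold Rdiv. apply Rmult_le_compat_l; [lra|]. apply Rinv_le_contravar; lra.
    + apply Rmult_lt_compat_l with (r := B) in HN; [|exact HB].
      replace (B * (m / B)) with m in HN by (field; lra). lra. }
split; [apply Rle_trans with (2 := Hm1), Hg; lra|].
intros l Hl.
assert (Hdg : forall z, Cmod z <= r1 -> forall l', Cderiv (taylor_poly r f N) z l' ->
  Cderiv (fun z => f z - taylor_poly r f N z)%C z (C_derive f z - l')%C).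
{ intros z Hz l' Hl'. apply (Cderiv_minus f (taylor_poly r f N)); [|exact Hl'].
  apply bloch_Cderiv. unfold unit_disk. lra. }
eapply Rle_trans; [apply (cauchy_estimate _ r1 m w _ ltac:(lra))
  with (3 := Hdg w ltac:(lra) l Hl)|].
- intros z Hz. destruct (Cderiv_taylor_poly r f N z) as [l' Hl']. eexists.
  apply (Hdg z Hz l' Hl').
- intros z Hz. apply Hg. lra.
- eapply Rle_trans; [apply (div_square_mono _ r1 s); [|exact Hw|lra]|].
  { assert (0 < m * r1) by (apply Rmult_lt_0_compat; lra). lra. }
  apply Rmult_le_reg_r with ((r1 - s) ^ 2); [exact Hd|].
  unfold Rdiv. rewrite Rmult_assoc, Rinv_l, Rmult_1_r by lra. nra.
Qed.

Lemma taylor_coef_plus (mu : weight) (r : R) (k : nat) (f g : Bloch mu) : 0 < r < 1 ->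
  taylor_coef r (plus f g : Bloch mu) k = (taylor_coef r f k + taylor_coef r g k)%C.
Proof.
intros Hr. assert (HPI := two_PI_gt_0). unfold taylor_coef.
rewrite <- Cmult_plus_distr_l. f_equal.
assert (Hc : forall f : Bloch mu,
  Cont_on (fun s => (f (r * cis s) * (/ (r * cis s)) ^ k)%C) 0 (2 * PI)).
{ intros h s _. apply Rcont_moment; [lra|]. intros z Hz.
  apply (bloch_holomorphic_closed_disk mu h r); lra. }
rewrite <- CInt_plus; [|lra|apply Hc|apply Hc].
apply CInt_ext; [lra|]. intros s _. simpl. ring.
Qed.

Lemma taylor_coef_scal (mu : weight) (r : R) (k : nat) (c : C_AbsRing) (f : Bloch mu) :
  0 < r < 1 -> taylor_coef r (scal c f : Bloch mu) k = (c * taylor_coef r f k)%C.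
Proof.
intros Hr. assert (HPI := two_PI_gt_0). unfold taylor_coef.
rewrite (Cmult_comm c), <- Cmult_assoc. f_equal. rewrite Cmult_comm.
rewrite <- CInt_scal; [|lra|].
- apply CInt_ext; [lra|]. intros s _. simpl. ring.
- intros s _. apply Rcont_moment; [lra|]. intros z Hz.
  apply (bloch_holomorphic_closed_disk mu f r); lra.
Qed.

Lemma taylor_coef_bound (alpha : R) (Halpha : 0 < alpha) (r : R) (k : nat) : 0 < r < 1 ->
  exists M, forall f : Bloch (standard_weight alpha Halpha),
    Cmod (taylor_coef r f k) <= M * Bloch_norm _ f.
Proof.
intros Hr. assert (HPI := two_PI_gt_0).
set (A := 1 + 2 / Rpower (1 - r ^ 2) alpha).
exists (/ (2 * PI) * (2 * (A * (/ r) ^ k) * (2 * PI - 0))). intros f.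
unfold taylor_coef. rewrite <- RtoC_inv, Cmod_mult, Cmod_R by lra.
rewrite Rabs_pos_eq by (left; apply Rinv_0_lt_compat; lra).
rewrite Rmult_assoc. apply Rmult_le_compat_l; [left; apply Rinv_0_lt_compat; lra|].
replace (2 * (A * (/ r) ^ k) * (2 * PI - 0) * Bloch_norm _ f)
  with (2 * (A * Bloch_norm _ f * (/ r) ^ k) * (2 * PI - 0)) by ring.
apply CInt_bound; [lra| |].
- intros s _. apply Rcont_moment; [lra|]. intros z Hz.
  apply (bloch_holomorphic_closed_disk _ f r); lra.
- intros s _. assert (E := Cmod_circle r s ltac:(lra)).
  rewrite Cmod_mult, Cmod_pow, Cmod_inv, E by (apply Cmod_gt_0; lra).
  apply Rmult_le_compat_r; [apply pow_le; left; apply Rinv_0_lt_compat; lra|].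
  apply bloch_value_bound; lra.
Qed.

Lemma standard_weight_fun_le_1 (alpha : R) (z : C) : 0 < alpha -> Cmod z < 1 ->
  standard_weight_fun alpha z <= 1.
Proof.
intros Hal Hz. assert (Hz0 := Cmod_ge_0 z).
replace 1 with (Rpower 1 alpha).
- apply Rle_Rpower_l; [lra|]. split; nra.
- unfold Rpower. now rewrite ln_1, Rmult_0_r, exp_0.
Qed.

Lemma monomial_exists (alpha : R) (Halpha : 0 < alpha) (k : nat) :
  exists p : Bloch (standard_weight alpha Halpha), forall z, unit_disk z -> p z = (z ^ k)%C.
Proof.
destruct (bloch_intro (standard_weight alpha Halpha) (fun z => (z ^ k)%C)
  (fun z => (INR k * z ^ pred k)%C) (INR k)) as [p [Hp _]].
- intros z _. apply Cderiv_pow.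
- intros z Hz. rewrite Cmod_mult, Cmod_pow, Cmod_R, Rabs_pos_eq by apply pos_INR.
  assert (H1 := standard_weight_fun_le_1 alpha z Halpha Hz).
  assert (H2 : Cmod z ^ pred k <= 1).
  { rewrite <- (pow1 (pred k)). apply pow_incr. unfold unit_disk in Hz.
    generalize (Cmod_ge_0 z). lra. }
  assert (H0 : 0 <= Cmod z ^ pred k) by apply pow_le, Cmod_ge_0.
  assert (Hk := pos_INR k).
  assert (Hv := weight_pos (standard_weight alpha Halpha) z Hz).
  apply Rle_trans with (1 * (INR k * 1)); [|lra].
  apply Rmult_le_compat; [lra|now apply Rmult_le_pos|exact H1|].
  now apply Rmult_le_compat_l.
- now exists p.
Qed.

(** * The essential norm *)

Lemma bloch_minus_value (mu : weight) (f g : Bloch mu) (z : C) :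
  (minus f g : Bloch mu) z = (f z - g z)%C.
Proof. simpl. ring. Qed.

Lemma Csum_ext (u v : nat -> C) (N : nat) : (forall k, u k = v k) -> Csum u N = Csum v N.
Proof. intros H. induction N as [|N IH]; simpl; [|rewrite IH, H]; reflexivity. Qed.

(* [K f = C_phi (P (s .))] where [P] is a Taylor polynomial of [f]: dilating by [s] keeps the
   operator norm of the error under control where [phi] is close to the boundary. *)
Lemma compact_approximation (alpha : R) (Halpha : 0 < alpha) (mu : weight) (phi : C -> C)
  (Cphi : Bloch (standard_weight alpha Halpha) -> Bloch mu) (delta b e : R) :
  analytic_self_map phi -> is_composition_operator phi Cphi ->
  delta < 1 -> 0 <= b -> 0 < e ->
  (forall z, unit_disk z -> delta < Cmod (phi z) ->
    mu z * Cmod (C_derive phi z) <= b * standard_weight_fun alpha (phi z)) ->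
  exists K : Bloch (standard_weight alpha Halpha) -> Bloch mu, compact_operator K /\
    forall f, norm f <= 1 -> norm (minus (Cphi f) (K f)) <= 2 * b + e.
Proof.
intros [Hphi Hself] Hcomp Hdelta Hb He Hbd.
assert (Hdphi : forall z, unit_disk z -> Cderiv phi z (C_derive phi z)).
{ intros z Hz. apply (C_derive_correct phi z (RtoC 0)), Hphi, Hz. }
assert (Hmono : forall k, {p : Bloch (standard_weight alpha Halpha) |
  forall z, unit_disk z -> p z = (z ^ k)%C}).
{ intros k. apply constructive_indefinite_description, monomial_exists. }
set (p := fun k => proj1_sig (Hmono k)).
assert (Hp : forall k z, unit_disk z -> p k z = (z ^ k)%C)
  by (intros k; exact (proj2_sig (Hmono k))).
(* The operator maps the identity function to [phi]; its image being in the target space bounds mu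
   |phi'| on the whole disk. *)
set (A := Bloch_norm mu (Cphi (p 1%nat))).
assert (HA : 0 <= A) by apply Bloch_norm_ge0.
assert (HAphi : forall z, unit_disk z -> mu z * Cmod (C_derive phi z) <= A).
{ intros z Hz.
  rewrite <- (bloch_C_derive mu (Cphi (p 1%nat)) phi z (C_derive phi z) Hz).
  - now apply bloch_derive_le_norm.
  - intros w Hw. rewrite Hcomp, Hp by auto. ring.
  - auto. }
set (eta := e / (4 * (1 + A))).
assert (Heta : 0 < eta) by (apply Rdiv_lt_0_compat; lra).
assert (Heta1 : (1 + A) * eta = e / 4) by (unfold eta; field; lra).
assert (HAeta : 0 <= A * eta) by (apply Rmult_le_pos; lra).
(* Including |phi 0| makes the approximation also cover the value at 0, the other half of the
   norm. *)
set (rho := Rmax delta (Cmod (phi 0%C))).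
assert (Hphi0 : Cmod (phi 0%C) < 1) by (apply Hself, unit_disk_0).
assert (Hrho : 0 <= rho < 1).
{ split; [|now apply Rmax_lub_lt]. apply Rle_trans with (2 := Rmax_r _ _), Cmod_ge_0. }
destruct (dilation_approx alpha Halpha rho eta Hrho Heta) as [s [Hs Hdil]].
destruct (taylor_approx alpha Halpha s eta ltac:(lra) Heta) as [r [N [Hr Htay]]].
set (T := fun k (f : Bloch (standard_weight alpha Halpha)) =>
  scal ((taylor_coef r f k * RtoC s ^ k)%C : C_AbsRing) (Cphi (p k))).
exists (fun f => vsum (fun k => T k f) N). split.
{ apply (compact_vsum (K := C_AbsRing) (X := Bloch_NormedModule (standard_weight alpha Halpha))
    (Y := Bloch_NormedModule mu) T N). intros k.
  destruct (taylor_coef_bound alpha Halpha r k Hr) as [M HM].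
  apply (compact_rank_one (X := Bloch_NormedModule (standard_weight alpha Halpha))
    (Y := Bloch_NormedModule mu) (fun f : Bloch (standard_weight alpha Halpha) =>
    (taylor_coef r f k * RtoC s ^ k)%C) (M * Cmod (RtoC s ^ k))).
  - intros u v. rewrite taylor_coef_plus by exact Hr. ring.
  - intros c u. rewrite taylor_coef_scal by exact Hr. ring.
  - intros u. rewrite Cmod_mult.
    apply Rle_trans with (M * Bloch_norm _ u * Cmod (RtoC s ^ k)).
    + apply Rmult_le_compat_r; [apply Cmod_ge_0|apply HM].
    + right. change (norm u) with (Bloch_norm _ u). ring. }
intros f Hf.
set (K := vsum (fun k => T k f) N : Bloch mu).
assert (HG : forall z, unit_disk z ->
  (minus (Cphi f) K : Bloch mu) z = (f (phi z) - taylor_poly r f N (RtoC s * phi z))%C).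
{ intros z Hz. rewrite bloch_minus_value, Hcomp by exact Hz. f_equal. f_equal.
  unfold K. rewrite vsum_bloch. unfold taylor_poly. apply Csum_ext. intros k.
  change ((taylor_coef r f k * RtoC s ^ k) * Cphi (p k) z =
    taylor_coef r f k * (RtoC s * phi z) ^ k)%C.
  rewrite Hcomp, Hp, Cpow_mult_l by auto. ring. }
assert (Hsphi : forall z, unit_disk z -> Cmod (RtoC s * phi z) <= s).
{ intros z Hz. rewrite Cmod_mult, Cmod_R, Rabs_pos_eq by lra.
  generalize (Hself z Hz) (Cmod_ge_0 (phi z)). unfold unit_disk. nra. }
assert (Hder : forall z, unit_disk z ->
  mu z * Cmod (C_derive (minus (Cphi f) K : Bloch mu) z) <= 2 * b + e / 2).
{ intros z Hz. assert (Hw := Hself z Hz).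
  assert (Hmu := weight_pos mu z Hz).
  destruct (Cderiv_taylor_poly r f N (RtoC s * phi z)) as [l Hl].
  assert (HD : C_derive (minus (Cphi f) K : Bloch mu) z =
    (C_derive f (phi z) * C_derive phi z - l * RtoC s * C_derive phi z)%C).
  { apply (bloch_C_derive mu _ _ z _ Hz HG).
    apply (Cderiv_minus (fun z => f (phi z))
      (fun z => taylor_poly r f N (RtoC s * phi z)%C)).
    - apply (Cderiv_comp f phi); [|auto]. apply bloch_Cderiv. exact Hw.
    - apply (Cderiv_comp (fun w => taylor_poly r f N (RtoC s * w)%C) phi); [|auto].
      now apply Cderiv_scale. }
  rewrite HD.
  (* The first bracket is the dilation error; the second, taken at [s * phi z], is the Taylor error,
     which is at most [eta] wherever [phi z] lies. *)
  replace (C_derive f (phi z) * C_derive phi z - l * RtoC s * C_derive phi z)%C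
    with (C_derive phi z * ((C_derive f (phi z) - C_derive f (RtoC s * phi z) * RtoC s)
      + RtoC s * (C_derive f (RtoC s * phi z) - l)))%C by ring.
  rewrite Cmod_mult.
  set (d1 := (C_derive f (phi z) - C_derive f (RtoC s * phi z) * RtoC s)%C).
  set (d2 := (C_derive f (RtoC s * phi z) - l)%C).
  set (D := Cmod (C_derive phi z)) in *.
  assert (HD0 : 0 <= D) by apply Cmod_ge_0.
  assert (Hd2 : Cmod d2 <= eta) by (apply (Htay f Hf); auto).
  assert (Hd2' : Cmod (RtoC s * d2) <= eta)
    by (eapply Rle_trans; [apply Cmod_scale_le; lra|exact Hd2]).
  assert (HmuD : 0 <= mu z * D) by (apply Rmult_le_pos; lra).
  assert (HmuA : mu z * D <= A) by now apply HAphi.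
  assert (P2 : mu z * D * Cmod (RtoC s * d2) <= A * eta)
    by (apply Rmult_le_compat; auto using Cmod_ge_0).
  assert (P1 : mu z * D * Cmod d1 <= Rmax (A * eta) (2 * b)).
  { destruct (Rle_dec (Cmod (phi z)) delta) as [Hcase|Hcase].
    - apply Rle_trans with (2 := Rmax_l _ _).
      apply Rmult_le_compat; auto using Cmod_ge_0.
      apply (Hdil f Hf (phi z)). apply Rle_trans with (1 := Hcase), Rmax_l.
    - apply Rle_trans with (2 := Rmax_r _ _).
      assert (Hdz := Hbd z Hz ltac:(lra)). fold D in Hdz.
      assert (Hv := weight_pos (standard_weight alpha Halpha) (phi z) Hw).
      change (0 < standard_weight_fun alpha (phi z)) in Hv.
      assert (Hsw := Cmod_scale_le s (phi z) ltac:(lra)).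
      assert (Hvs := standard_weight_fun_decr alpha (RtoC s * phi z) (phi z) Halpha Hsw Hw).
      assert (B1 := bloch_derive_le_norm _ f (phi z) Hw).
      assert (B2 := bloch_derive_le_norm _ f (RtoC s * phi z)%C (Rle_lt_trans _ _ _ Hsw Hw)).
      change (standard_weight_fun alpha (phi z) * Cmod (C_derive f (phi z))
        <= Bloch_norm _ f) in B1.
      change (standard_weight_fun alpha (RtoC s * phi z) *
        Cmod (C_derive f (RtoC s * phi z)) <= Bloch_norm _ f) in B2.
      change (Bloch_norm _ f <= 1) in Hf.
      set (v := standard_weight_fun alpha (phi z)) in *.
      assert (Hd1 : v * Cmod d1 <= 2).
      { assert (E1 := Cmod_triangle_minus (C_derive f (phi z))
          (C_derive f (RtoC s * phi z) * RtoC s)).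
        fold d1 in E1. rewrite Cmod_mult, Cmod_R, Rabs_pos_eq in E1 by lra.
        assert (Hq := Cmod_ge_0 (C_derive f (RtoC s * phi z))).
        set (q := Cmod (C_derive f (RtoC s * phi z))) in *.
        assert (v * q <= 1) by (apply Rle_trans with (2 := Rle_trans _ _ _ B2 Hf);
          apply Rmult_le_compat_r; assumption).
        assert (v * (q * s) <= v * q) by (apply Rmult_le_compat_l; nra).
        apply Rle_trans with (v * (Cmod (C_derive f (phi z)) + q * s)).
        - apply Rmult_le_compat_l; lra.
        - lra. }
      apply Rle_trans with (b * v * Cmod d1).
      + apply Rmult_le_compat_r; [apply Cmod_ge_0|exact Hdz].
      + rewrite Rmult_assoc. apply Rle_trans with (b * 2); [|lra].
        apply Rmult_le_compat_l; lra. }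
  assert (P3 : Rmax (A * eta) (2 * b) <= 2 * b + e / 4) by (apply Rmax_lub; lra).
  apply Rle_trans with (mu z * D * (Cmod d1 + Cmod (RtoC s * d2))); [|lra].
  rewrite <- Rmult_assoc. apply Rmult_le_compat_l; [exact HmuD|apply Cmod_triangle]. }
assert (H0 : Cmod ((minus (Cphi f) K : Bloch mu) 0%C) <= e / 2).
{ rewrite HG by apply unit_disk_0.
  destruct (Hdil f Hf (phi 0%C) (Rmax_r _ _)) as [E1 _].
  destruct (Htay f Hf (RtoC s * phi 0%C)%C (Hsphi 0%C unit_disk_0)) as [E2 _].
  replace (f (phi 0) - taylor_poly r f N (RtoC s * phi 0))%C with
    ((f (phi 0) - f (RtoC s * phi 0)) +
     (f (RtoC s * phi 0) - taylor_poly r f N (RtoC s * phi 0)))%C by ring.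
  eapply Rle_trans; [apply Cmod_triangle|]. lra. }
change (Bloch_norm mu (minus (Cphi f) K) <= 2 * b + e).
eapply Rle_trans; [apply (bloch_norm_le mu _ _ Hder)|]. lra.
Qed.

(* The test function [sigma_a] is used at the point [z] with [phi z = a]. *)
Lemma sigma_test (alpha : R) (Halpha : 0 < alpha) (mu : weight) (phi : C -> C)
  (Cphi : Bloch (standard_weight alpha Halpha) -> Bloch mu) (z : C)
  (s : Bloch (standard_weight alpha Halpha)) :
  analytic_self_map phi -> is_composition_operator phi Cphi -> unit_disk z ->
  1 / 2 <= Cmod (phi z) -> is_sigma alpha Halpha (phi z) s ->
  mu z * Cmod (C_derive phi z) <=
    3 / alpha * Bloch_norm mu (Cphi s) * standard_weight_fun alpha (phi z).
Proof.
intros [Hphi Hself] Hcomp Hz Hhalf Hs.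
assert (Ha := Hself z Hz). unfold unit_disk in Ha.
set (a := phi z) in *.
assert (HD : C_derive (Cphi s) z = (sigma_derive alpha a a * C_derive phi z)%C).
{ apply (bloch_C_derive mu _ (fun w => s (phi w)) z _ Hz).
  - intros w Hw. now apply Hcomp.
  - apply (Cderiv_comp s phi).
    + rewrite <- (is_sigma_derive alpha Halpha a a s Hs Ha). now apply bloch_Cderiv.
    + apply (C_derive_correct phi z (RtoC 0)), Hphi, Hz. }
assert (B := bloch_derive_le_norm mu (Cphi s) z Hz).
rewrite HD, Cmod_mult, Cmod_sigma_derive in B by assumption.
assert (E : Cmod (1 - Cconj a * a) = 1 - Cmod a ^ 2).
{ replace (1 - Cconj a * a)%C with (RtoC (1 - Cmod a ^ 2)).
  - rewrite Cmod_R. apply Rabs_pos_eq. generalize (Cmod_ge_0 a). nra.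
  - assert (M2 : Cmod a ^ 2 = fst a ^ 2 + snd a ^ 2).
    { unfold Cmod. apply pow2_sqrt.
      generalize (pow2_ge_0 (fst a)) (pow2_ge_0 (snd a)). lra. }
    rewrite M2. apply injective_projections; simpl; ring. }
rewrite E in B. unfold standard_weight_fun.
rewrite Rpower_Ropp in B.
assert (Hv := Rpower_pos (1 - Cmod a ^ 2) alpha).
set (v := Rpower (1 - Cmod a ^ 2) alpha) in *.
set (D := Cmod (C_derive phi z)) in *.
assert (HD0 : 0 <= mu z * D).
{ apply Rmult_le_pos; [left; now apply weight_pos|apply Cmod_ge_0]. }
set (nrm := Bloch_norm mu (Cphi s)) in *.
assert (Hx : 0 < 1 - Cmod a ^ 2) by nra.
(* At its own parameter a the weighted derivative of [sigma_a] has modulus alpha |a| / (1 + |a|), at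
   least alpha / 3 when |a| >= 1/2. *)
assert (Q : alpha / 3 * (mu z * D) <= nrm * v).
{ apply Rle_trans with
    (mu z * ((1 - Cmod a) * alpha * Cmod a * / v / (1 - Cmod a ^ 2) * D) * v).
  - replace (mu z * ((1 - Cmod a) * alpha * Cmod a * / v / (1 - Cmod a ^ 2) * D) * v)
      with (alpha * (Cmod a / (1 + Cmod a)) * (mu z * D)) by (field; split; nra).
    apply Rmult_le_compat_r; [exact HD0|]. unfold Rdiv at 1.
    apply Rmult_le_compat_l; [lra|].
    apply Rmult_le_reg_r with (1 + Cmod a); [lra|].
    unfold Rdiv. rewrite Rmult_assoc, Rinv_l; lra.
  - apply Rmult_le_compat_r; [lra|exact B]. }
apply Rmult_le_reg_l with (alpha / 3); [lra|].
apply Rle_trans with (1 := Q). right. field. lra.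
Qed.

Lemma Rle_forall_eps (x y c : R) : 0 <= c -> (forall e, 0 < e -> x <= y + c * e) -> x <= y.
Proof.
intros Hc H. apply Rnot_lt_le. intros Hlt.
specialize (H ((x - y) / (2 * (1 + c)))).
assert (0 < (x - y) / (2 * (1 + c))) by (apply Rdiv_lt_0_compat; lra).
specialize (H ltac:(assumption)).
assert (c * ((x - y) / (2 * (1 + c))) <= (1 + c) * ((x - y) / (2 * (1 + c))))
  by (apply Rmult_le_compat_r; lra).
replace ((1 + c) * ((x - y) / (2 * (1 + c)))) with ((x - y) / 2) in * by (field; lra).
lra.
Qed.

Lemma Rbar_glb_is_glb (P : Rbar -> Prop) : Rbar_is_glb P (Rbar_glb P).
Proof. exact (proj2_sig (Rbar_ex_glb P)). Qed.

Lemma Rbar_lub_is_lub (P : Rbar -> Prop) : Rbar_is_lub P (Rbar_lub P).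
Proof. exact (proj2_sig (Rbar_ex_lub P)). Qed.

(** Comparison with the compact operator 0 gives an upper bound, so the final inequalities can be
    handled in the reals. *)
Lemma essential_norm_finite {K : AbsRing} {X Y : NormedModule K} (T : X -> Y) : is_linear T ->
  exists e, essential_norm T = Finite e /\ 0 <= e.
Proof.
intros HT.
assert (G := Rbar_glb_is_glb (fun r : Rbar => exists S : X -> Y,
    compact_operator S /\ r = operator_norm (fun x => minus (T x) (S x)))).
fold (essential_norm T) in G. destruct G as [G1 G2].
assert (L : Rbar_le 0 (essential_norm T)).
{ apply G2. intros r [S [HS ->]].
  destruct (operator_norm_finite (fun x => minus (T x) (S x))) as [o [Ho Ho0]].
  - apply is_linear_minus_fct; [exact HT|apply HS].
  - rewrite Ho. exact Ho0. }
assert (U : exists o : R, Rbar_le (essential_norm T) o).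
{ destruct (operator_norm_finite (fun x => minus (T x) zero)) as [o [Ho _]].
  - apply is_linear_minus_fct; [exact HT|apply (compact_zero X Y)].
  - exists o. rewrite <- Ho. apply G1. exists (fun _ => zero). split; [apply compact_zero|].
    reflexivity. }
destruct U as [o U].
destruct (essential_norm T) as [e| |]; simpl in *; try contradiction. now exists e.
Qed.

Theorem theorem1p2 (alpha : R) (Halpha : 0 < alpha) :
  exists M : R, 0 < M /\
    forall (mu : weight) (phi : C -> C)
      (Cphi : Bloch (standard_weight alpha Halpha) -> Bloch mu),
      analytic_self_map phi ->
      is_composition_operator phi Cphi ->
      is_linear Cphi ->
      Rbar_le (Rbar_mult (/ M)%R (essential_norm Cphi))
        (limsup_boundary
           (fun a : C => bloch_norm mu (fun z : C => sigma_fun alpha a (phi z)))) /\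
      Rbar_le
        (limsup_boundary
           (fun a : C => bloch_norm mu (fun z : C => sigma_fun alpha a (phi z))))
        (Rbar_mult M (essential_norm Cphi)).
Proof.
set (c := 2 * (alpha * Rpower 2 alpha)).
assert (Hc : 0 < c).
{ unfold c. assert (P := Rpower_pos 2 alpha).
  assert (0 < alpha * Rpower 2 alpha) by now apply Rmult_lt_0_compat. lra. }
assert (H6 : 0 < 6 / alpha) by (apply Rdiv_lt_0_compat; lra).
(* [6 / alpha] serves the first inequality and [c] the second; the sum dominates both. *)
exists (c + 6 / alpha). split; [lra|].
intros mu phi Cphi Hphi Hcomp Hlin.
set (F := fun a : C => bloch_norm mu (fun z => sigma_fun alpha a (phi z))).
assert (HF : forall a s, is_sigma alpha Halpha a s -> F a = Finite (norm (Cphi s))).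
{ intros a s [Ha Hs]. apply (bloch_norm_eq_on_disk mu (Cphi s)). intros z Hz.
  rewrite Hcomp by exact Hz. symmetry. apply Hs, Hphi, Hz. }
assert (Hminus : forall S : Bloch (standard_weight alpha Halpha) -> Bloch mu,
  compact_operator S -> is_linear (fun x => minus (Cphi x) (S x))).
{ intros S HS. apply (is_linear_minus_fct (X := Bloch_NormedModule (standard_weight alpha Halpha))
    (Y := Bloch_NormedModule mu) Cphi S Hlin), HS. }
destruct (essential_norm_finite Cphi Hlin) as [e [He He0]].
assert (HE := Rbar_glb_is_glb (fun r : Rbar =>
  exists S : Bloch (standard_weight alpha Halpha) -> Bloch mu,
    compact_operator S /\ r = operator_norm (fun x => minus (Cphi x) (S x)))).
change (Rbar_glb _) with (essential_norm Cphi) in HE. rewrite He in HE.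
destruct HE as [HE1 HE2].
set (sup := fun r : R => Rbar_lub (fun t : Rbar => exists a : C, r < Cmod a < 1 /\ t = F a)).
assert (Hsup : forall r, (forall a, r < Cmod a < 1 -> Rbar_le (F a) (sup r)) /\
  forall B, (forall a, r < Cmod a < 1 -> Rbar_le (F a) B) -> Rbar_le (sup r) B).
{ intros r. destruct (Rbar_lub_is_lub
    (fun t : Rbar => exists a : C, r < Cmod a < 1 /\ t = F a)) as [S1 S2].
  split.
  - intros a Ha. apply S1. now exists a.
  - intros B HB. apply S2. intros t [a [Ha ->]]. auto. }
assert (HL := Rbar_glb_is_glb (fun s : Rbar => exists r : R, r < 1 /\ s = sup r)).
change (Rbar_glb _) with (limsup_boundary F) in HL.
destruct HL as [HL1 HL2].
assert (HLsup : forall r B, r < 1 -> (forall a, r < Cmod a < 1 -> Rbar_le (F a) B) ->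
  Rbar_le (limsup_boundary F) B).
{ intros r B Hr HB. apply Rbar_le_trans with (sup r).
  - apply HL1. now exists r.
  - now apply Hsup. }
assert (HL0 : Rbar_le 0 (limsup_boundary F)).
{ apply HL2. intros s [r [Hr ->]].
  (* A real parameter in the annulus r < |a| < 1; without one the supremum would be taken over the
     empty set. *)
  set (x := (1 + Rmax 0 r) / 2).
  assert (Hm : Rmax 0 r < 1) by (apply Rmax_lub_lt; lra).
  assert (Hm0 := Rmax_l 0 r). assert (Hmr := Rmax_r 0 r).
  assert (Hx : Cmod (RtoC x) = x) by (rewrite Cmod_R; apply Rabs_pos_eq; unfold x; lra).
  assert (Hx1 : r < Cmod (RtoC x) < 1) by (rewrite Hx; unfold x; lra).
  apply Rbar_le_trans with (F (RtoC x)); [|now apply (Hsup r)].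
  destruct (sigma_exists alpha Halpha (RtoC x) (proj2 Hx1)) as [s Hs].
  rewrite (HF _ _ Hs). apply norm_ge_0. }
(* Split the image of [sigma_a] as (C - S) sigma_a + S sigma_a: the first part is at most c times
   the operator norm, the second at most [eps] near the boundary. *)
assert (Hupper : forall S : Bloch (standard_weight alpha Halpha) -> Bloch mu,
  compact_operator S -> forall o, operator_norm (fun x => minus (Cphi x) (S x)) = Finite o ->
  forall eps, 0 < eps -> Rbar_le (limsup_boundary F) (c * o + 1 * eps)).
{ intros S HS o Ho eps Heps.
  destruct (compact_sigma_small alpha Halpha S eps Heps HS) as [r [Hr HSr]].
  apply (HLsup r _ Hr). intros a Ha.
  destruct (sigma_exists alpha Halpha a (proj2 Ha)) as [s Hs].
  rewrite (HF _ _ Hs). simpl.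
  apply Rle_trans with (1 := norm_le_minus (S s) (Cphi s)).
  apply Rplus_le_compat; [|rewrite Rmult_1_l; now apply (HSr a)].
  apply (operator_norm_bound (fun x => minus (Cphi x) (S x)) o c s); auto.
  - now apply (is_sigma_norm alpha Halpha a). }
assert (Hl : exists l, limsup_boundary F = Finite l /\ 0 <= l).
{ destruct (operator_norm_finite (fun x => minus (Cphi x) zero)) as [o [Ho _]].
  - apply Hminus, compact_zero.
  - assert (U := Hupper (fun _ => zero) (compact_zero _ _) o Ho 1 Rlt_0_1).
    destruct (limsup_boundary F) as [l| |]; simpl in *; try contradiction. now exists l. }
destruct Hl as [l [Hl Hl0]].
assert (Hle : l <= c * e).
(* The essential norm is an infimum, so it suffices that l / c bounds every admissible operator norm
   from below. *)
{ assert (Hlb : Rbar_le (l / c) e).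
  { apply HE2. intros r [S [HS ->]].
    destruct (operator_norm_finite (fun x => minus (Cphi x) (S x))) as [o [Ho _]].
    - now apply Hminus.
    - rewrite Ho. simpl.
      assert (Hlo : l <= c * o).
      { apply Rle_forall_eps with 1; [lra|]. intros eps Heps.
        assert (U := Hupper S HS o Ho eps Heps). rewrite Hl in U. exact U. }
      apply Rmult_le_reg_l with c; [exact Hc|].
      replace (c * (l / c)) with l by (field; lra). exact Hlo. }
  simpl in Hlb. apply Rmult_le_compat_l with (r := c) in Hlb; [|lra].
  replace (c * (l / c)) with l in Hlb by (field; lra). exact Hlb. }
assert (Hel : e <= 6 / alpha * l).
{ apply Rle_forall_eps with (6 / alpha + 1); [lra|]. intros eps Heps.
  assert (Hr : exists r, r < 1 /\ Rbar_le (sup r) (l + eps)).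
  { apply NNPP. intros Hno.
    assert (Hlow : Rbar_le (l + eps) (limsup_boundary F)).
    { apply HL2. intros s [r [Hr ->]].
      destruct (Rbar_le_dec (sup r) (l + eps)) as [Hd|Hd].
      - exfalso. apply Hno. now exists r.
      - apply Rbar_lt_le, Rbar_not_le_lt, Hd. }
    rewrite Hl in Hlow. simpl in Hlow. lra. }
  destruct Hr as [r [Hr Hsr]].
  (* By [sigma_test] this bounds mu |phi'| relative to the weight wherever |phi z| exceeds both r
     and 1/2. Then 2 b + eps = (6 / alpha) l + (6 / alpha + 1) eps. *)
  set (b := 3 / alpha * (l + eps)).
  assert (H3 : 0 < 3 / alpha) by (apply Rdiv_lt_0_compat; lra).
  assert (Hb : 0 <= b) by (apply Rmult_le_pos; lra).
  destruct (compact_approximation alpha Halpha mu phi Cphi (Rmax r (1 / 2)) b eps Hphi Hcomp)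
    as [K [HK HKb]]; [apply Rmax_lub_lt; lra|exact Hb|exact Heps| |].
  - intros z Hz Hlarge.
    assert (L1 := Rle_lt_trans _ _ _ (Rmax_l _ _) Hlarge).
    assert (L2 := Rle_lt_trans _ _ _ (Rmax_r _ _) Hlarge).
    assert (Ha : Cmod (phi z) < 1) by apply Hphi, Hz.
    destruct (sigma_exists alpha Halpha (phi z) Ha) as [s Hs].
    eapply Rle_trans; [apply (sigma_test alpha Halpha mu phi Cphi z s); auto; lra|].
    apply Rmult_le_compat_r; [left; apply Rpower_pos|].
    apply Rmult_le_compat_l; [lra|].
    change (Rbar_le (norm (Cphi s)) (l + eps)). rewrite <- (HF _ _ Hs).
    apply Rbar_le_trans with (2 := Hsr). apply Hsup. lra.
  - change (Rbar_le e (6 / alpha * l + (6 / alpha + 1) * eps)).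
    apply Rbar_le_trans with (operator_norm (fun x => minus (Cphi x) (K x))).
    + apply HE1. now exists K.
    + apply Lub_Rbar_correct. intros x [f [Hf ->]]. simpl.
      apply Rle_trans with (1 := HKb f Hf). right. unfold b. field. lra. }
fold F. rewrite He, Hl. simpl.
assert (0 <= 6 / alpha * e) by (apply Rmult_le_pos; lra).
assert (0 <= c * l) by (apply Rmult_le_pos; lra).
split.
- apply Rmult_le_reg_l with (c + 6 / alpha); [lra|].
  rewrite <- Rmult_assoc, Rinv_r, Rmult_1_l by lra. lra.
- lra.
Qed.
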